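(* Let $m\ge 1$ be an integer and $p>1$. Let $f\in C^0([0,\infty))$ be strictly increasing on $[0,\infty)$ with $f>0$ on $(0,\infty)$. Let $l\in C^0([0,\infty))$ with $l>0$ on $(0,\infty)$, and suppose that $l$ is $C$-monotone non-decreasing for some $C\ge 1$, i.e. $\sup_{s\in[0,t]} l(s)\le C\,l(t)$ for all $t\ge 0$. Suppose that $$\frac{t^{p-1}}{l(t)}=o(1)\ \text{ as }t\to 0^+,\qquad l(t)\le B_1+B_2t^{\mu}\quad\forall\,t\in[0,\infty),$$ where $B_1,B_2>0$ and $0\le\mu<1$. Assume also that there is a constant $\Lambda>0$ such that $$l(t)\,s^{p}\le\Lambda\,l(st)\qquad\forall\,s\in[0,1],\ t\in[0,\infty).$$ Set $K(t)=(p-1)\int_0^t\frac{s^{p-1}}{l(s)}\,ds$ and $F(t)=\int_0^t f(s)\,ds$ for $t\ge 0$. Then the following conditions are equivalent: (i) there exists a non-negative, non-constant weak solution $u\in C^1(H^m)$ of the inequality $\Delta^p_{H^m}u\ge f(u)\,l(|\nabla_{H^m}u|_{H^m})$ on $H^m$; (ii) $\displaystyle\frac{1}{K^{-1}(F(t))}\notin L^1(+\infty)$.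
   Context: $H^m$ is the Heisenberg group: the manifold $\mathbb{R}^{2m+1}$ with points $q=(z,t)=(x_1,\dots,x_m,y_1,\dots,y_m,t)$ and group law $q\circ q'=\left(z+z',\,t+t'+2\sum_{i=1}^m (y_ix_i'-x_iy_i')\right)$. Its horizontal left-invariant vector fields are $X_j=\frac{\partial}{\partial x_j}+2y_j\frac{\partial}{\partial t}$, $Y_j=\frac{\partial}{\partial y_j}-2x_j\frac{\partial}{\partial t}$, $j=1,\dots,m$. For $C^1$ functions $u,v$: $\nabla_{H^m}u=\sum_j (X_ju)X_j+(Y_ju)Y_j$, $\nabla_{H^m}u\cdot\nabla_{H^m}v=\sum_j (X_ju)(X_jv)+(Y_ju)(Y_jv)$, and $|\nabla_{H^m}u|_{H^m}^2=\nabla_{H^m}u\cdot\nabla_{H^m}u$. The $p$-Laplacian is $\Delta^p_{H^m}u=\sum_j\left[X_j\left(|\nabla_{H^m}u|_{H^m}^{p-2}X_ju\right)+Y_j\left(|\nabla_{H^m}u|_{H^m}^{p-2}Y_ju\right)\right]$. The differential inequality is understood weakly: $u\in C^1(H^m)$ and, for all $\zeta\in C_0^\infty(H^m)$ with $\zeta\ge 0$, $$-\int_{\mathbb{R}^{2m+1}}|\nabla_{H^m}u|_{H^m}^{p-2}\,\nabla_{H^m}u\cdot\nabla_{H^m}\zeta\ \ge\ \int_{\mathbb{R}^{2m+1}}f(u)\,l(|\nabla_{H^m}u|_{H^m})\,\zeta$$ (Lebesgue measure; the integrand on the left is $0$ where $\nabla_{H^m}u=0$). $L^1(+\infty)$ means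 integrable in a neighbourhood of $+\infty$. Under the hypotheses $K$ is an increasing bijection of $[0,\infty)$ onto itself, with inverse $K^{-1}$. *)

(* Defs.v *)
From HB Require Import structures.
From mathcomp Require Import all_boot all_order all_algebra.
From mathcomp Require Import all_classical all_reals all_analysis.

Set Implicit Arguments.
Unset Strict Implicit.
Unset Printing Implicit Defensive.

Import Order.TTheory GRing.Theory Num.Theory.
Import numFieldNormedType.Exports.

Local Open Scope classical_set_scope.
Local Open Scope ring_scope.

Section tuple_measure.
Context d (T : measurableType d) (R : realType).
Variable lam : {sigma_finite_measure set T -> \bar R}.

Definition tuple_cons n (x : T * n.-tuple T) : n.+1.-tuple T :=
  [the n.+1.-tuple _ of x.1 :: x.2].

Definition tuple_uncons n (v : n.+1.-tuple T) : T * n.-tuple T :=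
  (thead v, [tuple of behead v]).

Lemma tuple_consK n : cancel (@tuple_cons n) (@tuple_uncons n).
Proof. by move=> [x v]; congr pair; apply/val_inj. Qed.

Lemma measurable_tuple_cons n : measurable_fun setT (@tuple_cons n).
Proof. exact: measurable_cons. Qed.

Lemma measurable_tuple_uncons n : measurable_fun setT (@tuple_uncons n).
Proof.
apply/measurable_fun_pair; last exact: measurable_behead.
exact: measurable_tnth.
Qed.

Section tuple_measureS.
Variables (n : nat) (mu : {sigma_finite_measure set (n.-tuple T) -> \bar R}).

Definition tuple_measureS : set (n.+1.-tuple T) -> \bar R :=
  pushforward (lam \x mu)%E (@tuple_cons n).

Let pf := measure_function_pushforward__canonical__measure_function_Measure
  (lam \x mu)%E (@measurable_tuple_cons n).

HB.instance Definition _ := isMeasure.Build _ _ _ tuple_measureS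
  (measure0 pf) (measure_ge0 pf) (@measure_semi_sigma_additive _ _ _ pf).

Lemma tuple_measureS_sigma_finite : sigma_finite setT tuple_measureS.
Proof.
have /sigma_finiteP[F [TF ndF Foo]] := sigma_finiteT lam.
have /sigma_finiteP[G [TG ndG Goo]] := sigma_finiteT mu.
exists (fun k => @tuple_uncons n @^-1` (F k `*` G k)).
  rewrite -preimage_bigcup (_ : \bigcup_k _ = setT) ?preimage_setT//.
  rewrite -setXTT TF TG predeqE => -[x y]; split.
    by move=> [k _ []/= ? ?]; split; exists k.
  move=> [/= [k _ Fx] [l _ Gy]]; exists (maxn k l) => //; split.
  - by move: x Fx; exact/subsetPset/ndF/leq_maxl.
  - by move: y Gy; exact/subsetPset/ndG/leq_maxr.
move=> k; have [mF Fk] := Foo k; have [mG Gk] := Goo k.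
have mFG : measurable (F k `*` G k) by exact: measurableX.
split; first by rewrite -[X in measurable X]setTI; exact: measurable_tuple_uncons.
rewrite /tuple_measureS /pushforward -comp_preimage.
rewrite (_ : _ \o _ = id); last exact/funext/tuple_consK.
by rewrite preimage_id product_measure1E// lte_mul_pinfty// ge0_fin_numE.
Qed.

HB.instance Definition _ :=
  Measure_isSigmaFinite.Build _ _ _ tuple_measureS tuple_measureS_sigma_finite.

End tuple_measureS.

Fixpoint tuple_measure n : {sigma_finite_measure set (n.-tuple T) -> \bar R} :=
  match n with
  | 0 => [the {sigma_finite_measure set _ -> \bar R} of
          @dirac _ (0.-tuple T) [tuple] R]
  | k.+1 => [the {sigma_finite_measure set _ -> \bar R} of
          tuple_measureS (tuple_measure k)]
  end.

Lemma tuple_measure_box n (A : 'I_n -> set T) : (forall i, measurable (A i)) ->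
  tuple_measure n [set v | forall i, A i (tnth v i)] = (\prod_(i < n) lam (A i))%E.
Proof.
elim: n A => [|n IH] A mA.
  by rewrite big_ord0 /= diracE mem_set//; case.
rewrite big_ord_recl /= /tuple_measureS /pushforward.
rewrite -(IH (fun i => A (lift ord0 i)))//.
rewrite (_ : _ @^-1` _ =
    A ord0 `*` [set v | forall i, A (lift ord0 i) (tnth v i)]); last first.
  apply/seteqP; split => -[x v] /=.
    move=> H; split => [|i]; first exact: (H ord0).
    by have := H (lift ord0 i); rewrite tnthS.
  move=> [Hx Hv] i; case: (unliftP ord0 i) => [j|] -> //.
  by rewrite tnthS.
rewrite product_measure1E//.
rewrite (_ : [set v | _] =
    \bigcap_(i in [set: 'I_n]) [set v | A (lift ord0 i) (tnth v i)]); last first.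
  by apply/seteqP; split => [v H i _|v H i]; [exact: H|exact: H].
apply: fin_bigcap_measurable => // i _.
have := @measurable_tnth _ T n i measurableT _ (mA (lift ord0 i)).
by rewrite setTI.
Qed.

End tuple_measure.

Section euclidean.
Variable R : realType.

Definition lebesgue_Rn n :
    {sigma_finite_measure set (n.-tuple (measurableTypeR R)) -> \bar R} :=
  tuple_measure [the {sigma_finite_measure set _ -> \bar R} of
                 @lebesgue_measure R] n.

(* The measurable structure of the library lives on tuples, the normed one on
   row vectors. *)
Definition Rn_integral n (g : 'rV[R]_n -> R) : R :=
  \int[lebesgue_Rn n]_v g (\row_i tnth v i).

Definition partial n (i : 'I_n) (u : 'rV[R]_n -> R) : 'rV[R]_n -> R :=
  'D_(delta_mx 0 i) u.

Fixpoint Ck n (k : nat) (u : 'rV[R]_n -> R) : Prop :=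
  continuous u /\
  if k is k'.+1 then
    (forall (i : 'I_n) q, derivable u q (delta_mx 0 i)) /\
    (forall i : 'I_n, Ck k' (partial i u))
  else True.

Definition test_function n (zeta : 'rV[R]_n -> R) : Prop :=
  (forall k, Ck k zeta) /\ compact (closure [set q | zeta q != 0]).

End euclidean.

Section heisenberg.
Variables (R : realType) (m : nat).

(* Row layout: (x_1, ..., x_m, y_1, ..., y_m, t). *)
Definition heis := 'rV[R]_(m + m + 1).

Definition idx_x (j : 'I_m) : 'I_(m + m + 1) := lshift 1 (lshift m j).
Definition idx_y (j : 'I_m) : 'I_(m + m + 1) := lshift 1 (rshift m j).
Definition idx_t : 'I_(m + m + 1) := rshift (m + m) ord0.

Implicit Types u v : heis -> R.

Definition vfX (j : 'I_m) u (q : heis) : R :=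
  partial (idx_x j) u q + 2 * q 0 (idx_y j) * partial idx_t u q.

Definition vfY (j : 'I_m) u (q : heis) : R :=
  partial (idx_y j) u q - 2 * q 0 (idx_x j) * partial idx_t u q.

Definition hgrad_dot u v (q : heis) : R :=
  \sum_(j < m) (vfX j u q * vfX j v q + vfY j u q * vfY j v q).

Definition hgrad_norm u (q : heis) : R := Num.sqrt (hgrad_dot u u q).

(* [hgrad_dot u zeta] vanishes wherever [hgrad_norm u] does, so the left-hand
   integrand is 0 there, also when [p < 2]. *)
Definition weak_solution (p : R) (f l : R -> R) u : Prop :=
  Ck 1 u /\
  forall zeta : heis -> R,
    test_function zeta -> (forall q, 0 <= zeta q) ->
    - Rn_integral (fun q => hgrad_norm u q `^ (p - 2) * hgrad_dot u zeta q) >=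
    Rn_integral (fun q => f (u q) * l (hgrad_norm u q) * zeta q).

End heisenberg.

Section keller_osserman.
Variable R : realType.
Implicit Types f l : R -> R.

Definition C_monotone_nondecreasing l (C : R) : Prop :=
  forall t, 0 <= t -> sup [set l s | s in `[0, t]] <= C * l t.

Definition KO_K (p : R) l (t : R) : R :=
  (p - 1) * \int[lebesgue_measure]_(s in `[0, t]) (s `^ (p - 1) / l s).

Definition KO_F f (t : R) : R := \int[lebesgue_measure]_(s in `[0, t]) f s.

(* Inverse of [KO_K p l] as a map from [0, +oo) onto its image. *)
Definition KO_Kinv (p : R) l : R -> R :=
  'pinv_(fun=> 0) `[0, +oo[ (KO_K p l).

Definition L1_at_pinfty (g : R -> R) : Prop :=
  exists a : R, lebesgue_measure.-integrable `[a, +oo[ (EFin \o g).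

End keller_osserman.

(* Main.v *)
(* With [g = K^-1 o F], the radial equation [(w'^(p-1))' = f(w) l(w')] has the
   first integral [w' = g(w)], so [w] inverts a primitive [G] of [1/g]; and
   [1/g] is integrable at infinity iff [G] is bounded above, i.e. iff [w] blows
   up at a finite point.

   If [G] is unbounded above, [w] (continued evenly when [G] is bounded below)
   yields a solution [u(x, y, t) = w(x_1)].

   If [G] is bounded above, dilations of [w] give barriers [a], equal to [eta]
   at [r0] and reaching any prescribed height at a distance bounded
   independently of it; off the vertical axis through [c], [a] composed with
   the gauge centred at [c] is a strict supersolution.  Let [u] be a
   nonconstant solution and [eta] lie strictly between two of its values.  The
   difference of [u] and the barrier centred at [c] has an interior maximum on
   a large ball, and testing the inequality with the square of its positive
   part above a level close to the maximum is contradictory unless the maximum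
   point is on the axis of [c], where the horizontal gradient of the gauge
   vanishes.  If this happens for all [c] near a point [c0], moving [c] along a
   horizontal line by [s] changes the maximum by [O(s^4)] only, so the maximum
   is constant along horizontal lines, hence along commutators of horizontal
   translations, which are vertical.  But moving the centre vertically towards
   the maximum point increases the maximum. *)
Require Import Defs.
From mathcomp Require Import all_boot all_order all_algebra.
From mathcomp Require Import all_classical all_reals all_analysis.
From mathcomp Require Import measurable_realfun ring lra.

Import Order.TTheory GRing.Theory Num.Theory.
Import numFieldNormedType.Exports.

Local Open Scope classical_set_scope.
Local Open Scope ring_scope.
Set Implicit Arguments.
Unset Strict Implicit.
Unset Printing Implicit Defensive.

(** * One-variable calculus *)

Section OneVariable.
Context {R : realType}.
Implicit Types (f h k : R -> R).

(** The inequality is known weakly, against smooth test functions, while the comparison needs the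
    square of a positive part, which is merely $C^1$; hence the extension to $C^1$ test functions.
    Since the right-hand side depends on the gradient, the comparison is made at one point: at a
    maximum of the difference the gradients agree, and continuity of the right-hand side suffices.
    Let $h\le 1$ be the length of the horizontal gradient of the gauge. The $p$-Laplacian of [a]
    composed with the gauge is $h^p$ times the radial operator $(p-1)a'^{p-2}a''+(2m+1)a'^{p-1}/r$,
    whereas the right-hand side contains $l(ha')$. The condition $l(t)s^p\le\Lambda l(st)$ bridges
    the two at the cost of $\Lambda$, so barriers are needed with a small factor [k]; $w(\sigma
    s)/\sigma$ provides them, as it solves the equation with $f$ replaced by $\sigma
    f(\sigma\,\cdot)$. The exponent 4 arises because a horizontal shift of the centre by $s$, seen
    from a point on its axis, adds exactly $s^4$ to the fourth power of the gauge; cut into $n$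
    pieces, the shift changes the maximum by $O(n^{-3})$. *)

Lemma is_derive_continuous f (x d : R) : is_derive x 1 f d -> {for x, continuous f}.
Proof.
by move=> fd; apply/differentiable_continuous/derivable1_diffP; case: fd.
Qed.

Lemma near_gt (a x : R) : a < x -> \forall z \near x, a < z.
Proof.
move=> ax; have /near_in_itvoy : x \in `]a, +oo[ by rewrite in_itv/= ax.
by apply: filterS => z; rewrite in_itv/= andbT.
Qed.

Lemma near_lt (a x : R) : x < a -> \forall z \near x, z < a.
Proof.
move=> ax; have /near_in_itvNyo : x \in `]-oo, a[ by rewrite in_itv/= ax.
by apply: filterS => z; rewrite in_itv/=.
Qed.

Lemma MVT_oo f df (a b : R) : a < b ->
  (forall x, a < x < b -> is_derive x 1 f (df x)) ->
  {for a, continuous f} -> {for b, continuous f} ->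
  exists2 c, a < c < b & f b - f a = df c * (b - a).
Proof.
move=> ab fd fa fb.
have fd' : forall x, x \in `]a, b[%R -> is_derive x 1 f (df x).
  by move=> x; rewrite in_itv/=; exact: fd.
have cf : {within `[a, b], continuous f}.
  apply/(continuous_within_itvP _ ab); split.
  + by move=> x /fd'; exact: is_derive_continuous.
  + exact: cvg_at_right_filter.
  + exact: cvg_at_left_filter.
have [c cab fE] := MVT ab fd' cf.
by exists c => //; move: cab; rewrite in_itv.
Qed.

(** The mean value theorem turns the difference quotients at [x0] into values of [d] at nearby
    points. It supplies the derivative where two formulas meet: the vertex of the even profile,
    [flat] at 0, the squared positive part at 0. *)
Lemma is_derive_extend f d (x0 : R) : {for x0, continuous f} ->
  (forall x, x != x0 -> is_derive x 1 f (d x)) -> {for x0, continuous d} ->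
  is_derive x0 1 f (d x0).
Proof.
move=> fc fd dc.
suff H : h^-1 *: ((f \o shift x0) h%:A - f x0) @[h --> 0^'] --> d x0.
  have E : 'D_1 f x0 = d x0 by apply: cvg_lim.
  by rewrite -E in H; rewrite -E; constructor => //; apply/cvg_ex; eexists; exact: H.
apply/cvgrPdist_lt => e e0.
have /cvgrPdist_lt/(_ e e0)[r /= r0 Hr] := dc.
exists r => //= h /=; rewrite sub0r normrN => hr h0.
rewrite /= /shift/= scaler1.
have [c cr fE] : exists2 c, `|x0 - c| < r & f (h + x0) - f x0 = d c * h.
  have [hgt|hlt|h00] := ltgtP 0 h; last by rewrite -h00 eqxx in h0.
  - have lt : x0 < h + x0 by rewrite ltrDr.
    have fd' x : x0 < x < h + x0 -> is_derive x 1 f (d x).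
      by move=> /andP[xx _]; apply: fd; rewrite gt_eqF.
    have fch : {for h + x0, continuous f}.
      by apply: is_derive_continuous; apply: fd; rewrite gt_eqF.
    have [c /andP[c1 c2] E] := MVT_oo lt fd' fc fch.
    exists c; last by rewrite E addrK.
    by rewrite distrC gtr0_norm ?subr_gt0// ltrBlDr (lt_le_trans c2)// lerD2r (le_trans _ (ltW hr))// ler_norm.
  - have lt : h + x0 < x0 by rewrite gtrDr.
    have fd' x : h + x0 < x < x0 -> is_derive x 1 f (d x).
      by move=> /andP[_ xx]; apply: fd; rewrite lt_eqF.
    have fch : {for h + x0, continuous f}.
      by apply: is_derive_continuous; apply: fd; rewrite lt_eqF.
    have [c /andP[c1 c2] E] := MVT_oo lt fd' fch fc.
    exists c; last by rewrite -opprB E; ring.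
    rewrite gtr0_norm ?subr_gt0// ltrBlDl -ltrBlDr (le_lt_trans _ c1)//.
    by rewrite addrC lerD2r; rewrite ltr0_norm// in hr; lra.
rewrite fE; have -> : h^-1 *: (d c * h) = d c by rewrite /GRing.scale/=; field.
exact: Hr.
Qed.

Local Notation lam := (@lebesgue_measure R).

Lemma continuous_itv_integrable h (a b : R) :
  {in `[a, b], forall x, {for x, continuous h}} ->
  lam.-integrable `[a, b] (EFin \o h).
Proof.
move=> hc; apply: continuous_compact_integrable; first exact: segment_compact.
by apply: continuous_in_subspaceT => x; rewrite inE => /hc.
Qed.

Lemma is_derive_primitive h (a t : R) :
  (forall x, a <= x -> {for x, continuous h}) -> a < t ->
  is_derive t 1 (fun t => \int[lam]_(s in `[a, t]) h s) (h t).
Proof.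
move=> hc at_.
have tu : t < t + 1 by rewrite ltrDl.
have ih : lam.-integrable `[a, t + 1] (EFin \o h).
  by apply: continuous_itv_integrable => x; rewrite in_itv/= => /andP[/hc].
have [D E] := continuous_FTC1_closed tu ih at_ (hc _ (ltW at_)).
by apply: DeriveDef => //; rewrite -derive1E.
Qed.

Lemma primitive_cvg0 h (a : R) :
  (forall x, a <= x -> {for x, continuous h}) ->
  (fun t => \int[lam]_(s in `[a, t]) h s) x @[x --> a] --> (0 : R).
Proof.
move=> hc; have ab : a < a + 1 by rewrite ltrDl.
apply: (parameterized_integral_cvg_left ab).
by apply: continuous_itv_integrable => x; rewrite in_itv/= => /andP[/hc].
Qed.

(** [k] need not be integrable near 0, so no single lower limit of integration serves all [y]. [G y]
    is the integral from 1 to [y], written as a difference of two integrals from a limit below both;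
    [GE] shows that any smaller limit gives the same value. *)
Lemma primitive_pos k : (forall x, 0 < x -> {for x, continuous k}) ->
  exists G : R -> R, forall y : R, 0 < y -> is_derive y 1 G (k y).
Proof.
move=> kc.
pose I a b := \int[lam]_(s in `[a, b]) k s.
have I_split a b c : 0 < a -> a <= b -> b <= c -> I a c = I a b + I b c.
  move=> a0 ab bc; have ac : lam.-integrable `[a, c] (EFin \o k).
    by apply: continuous_itv_integrable => x; rewrite in_itv/= => /andP[/(lt_le_trans a0)/kc].
  have bcE : I b c = \int[lam]_(s in `]b, c]) k s.
    rewrite /I Rintegral_itv_obnd_cbnd//; apply: integrableS ac => //.
    by apply: subset_itv; rewrite bnd_simp.
  by rewrite bcE /I -(@Rintegral_itvB R k (BLeft a) (BRight c) b) ?bnd_simp// addrC subrK.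
pose G y := I (Num.min y 1 / 2) y - I (Num.min y 1 / 2) 1.
have GE a y : 0 < a -> a < Num.min y 1 / 2 -> G y = I a y - I a 1.
  move=> a0; set b := Num.min y 1 / 2 => ab.
  have b0 := lt_trans a0 ab.
  have m0 : 0 < Num.min y 1 by rewrite -(@pmulr_lgt0 _ 2^-1).
  have bm : b <= Num.min y 1 by rewrite /b ler_pdivrMr// ler_pMr// ler1n.
  have [bY b1] : b <= y /\ b <= 1.
    by split; apply: (le_trans bm); rewrite ge_min lexx ?orbT.
  rewrite /G -/b (I_split a b y)// ?ltW// (I_split a b 1)// ?ltW//; ring.
exists G => y y0.
(* A quarter, against the half in [G], leaves room: this one lower limit serves all [z] near [y], so
   [G] can be differentiated at [y]. *)
pose a := Num.min y 1 / 4.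
have m0 : 0 < Num.min y 1 by rewrite lt_min y0 ltr01.
have a0 : 0 < a by rewrite divr_gt0.
have ay : a < y.
  by apply: (@lt_le_trans _ _ (Num.min y 1)); rewrite ?ge_min ?lexx// ltr_pdivrMr// ltr_pMr// ltr1n.
have H : is_derive y 1 (fun t => I a t - I a 1) (k y).
  rewrite -[k y]subr0; apply: is_deriveB.
  by apply: is_derive_primitive => // x ax; apply: kc; exact: lt_le_trans ax.
apply: (near_eq_is_derive _ H).
near=> z; symmetry; apply: GE => //.
have az : 2 * a < z.
  near: z; apply: near_gt; rewrite /a.
  have : Num.min y 1 <= y by rewrite ge_min lexx.
  by lra.
rewrite /a in az *.
rewrite ltr_pdivlMr// lt_min; apply/andP; split; first by rewrite mulrC.
have : Num.min y 1 <= 1 by rewrite ge_min lexx orbT.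
by lra.
Unshelve. all: by end_near. Qed.

End OneVariable.

(** * The Keller-Osserman functions *)

(** At [x = 0] the left side vanishes through the factor [x], whatever the power of 0 is by
    convention, and the right side because [p - 1] is not 0. *)
Lemma powR_sub2 {R : realType} (p x : R) : 1 < p -> 0 <= x -> x `^ (p - 2) * x = x `^ (p - 1).
Proof.
move=> p1; rewrite le_eqVlt => /predU1P[<-|x0].
  by rewrite mulr0 powR0// subr_eq0 gt_eqF.
rewrite -[X in _ * X](powRr1 (ltW x0)) -powRD ?(gt_eqF x0) ?implybT//.
by congr (_ `^ _); ring.
Qed.

Section KellerOsserman.
Context {R : realType}.
Implicit Types (f l : R -> R).

Lemma is_derive_lt f df (a : R) : (forall x : R, a < x -> is_derive x 1 f (df x)) ->
  (forall x : R, a < x -> 0 < df x) -> forall x y : R, a < x -> x < y -> f x < f y.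
Proof.
move=> fd df0 x y ax xy.
have fd' z : x < z < y -> is_derive z 1 f (df z).
  by move=> /andP[xz _]; apply: fd; exact: lt_trans xz.
have [c /andP[xc _] E] := MVT_oo xy fd' (is_derive_continuous (fd _ ax))
  (is_derive_continuous (fd _ (lt_trans ax xy))).
by rewrite -subr_gt0 E mulr_gt0 ?subr_gt0// df0// (lt_trans ax).
Qed.

Lemma is_derive_le f df (a : R) : (forall x : R, a < x -> is_derive x 1 f (df x)) ->
  (forall x : R, a < x -> 0 <= df x) -> forall x y : R, a < x -> x <= y -> f x <= f y.
Proof.
move=> fd df0 x y ax; rewrite le_eqVlt => /predU1P[->//|xy].
have fd' z : x < z < y -> is_derive z 1 f (df z).
  by move=> /andP[xz _]; apply: fd; exact: lt_trans xz.
have [c /andP[xc _] E] := MVT_oo xy fd' (is_derive_continuous (fd _ ax))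
  (is_derive_continuous (fd _ (lt_trans ax xy))).
by rewrite -subr_ge0 E mulr_ge0 ?subr_ge0 ?(ltW xy)// df0// (lt_trans ax).
Qed.

Lemma near_pos_eq_continuous (f g : R -> R) (x : R) : 0 < x ->
  (forall y : R, 0 < y -> f y = g y) -> {for x, continuous f} -> {for x, continuous g}.
Proof.
move=> x0 fg fc; rewrite /prop_for/continuous_at -fg//.
apply: cvg_trans fc; apply: near_eq_cvg; near=> y; apply: fg.
by near: y; exact: near_gt.
Unshelve. all: by end_near. Qed.

Lemma continuous_clamp0 f (a : R) : (forall x : R, 0 < x -> {for x, continuous f}) ->
  f x @[x --> 0^'+] --> a ->
  continuous (fun x : R => if x <= 0 then a else f x).
Proof.
move=> fc f0; set g := (fun x : R => _).
suff H : forall x : R, {for x, continuous g} by move=> x; exact: H.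
move=> x.
have [x0|x0|->] := ltgtP x 0.
- have gx : g x = a by rewrite /g ltW.
  rewrite /prop_for /continuous_at gx; apply/cvgrPdist_lt => e e0; near=> y.
  rewrite /g ifT ?subrr ?normr0//; apply: ltW.
  by near: y; exact: near_lt.
- have fg y : 0 < y -> f y = g y by move=> y0; rewrite /g leNgt y0.
  exact: (near_pos_eq_continuous x0 fg (fc _ x0)).
- rewrite /prop_for /continuous_at {2}/g lexx; apply/cvgrPdist_lt => e e0.
  move/cvgrPdist_lt : f0 => /(_ e e0)[d /= d0 H].
  exists d => //= y /=; rewrite sub0r normrN => yd.
  rewrite /g; case: (leP y 0) => y0; first by rewrite subrr normr0.
  by apply: H => //=; rewrite sub0r normrN.
Unshelve. all: by end_near. Qed.

Lemma within_ge0_continuous f : {within `[0, +oo[, continuous f} ->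
  (forall x : R, 0 < x -> {for x, continuous f}) /\ f x @[x --> 0^'+] --> f 0.
Proof.
move=> /continuous_within_itvcyP[fc f0]; split => // x x0.
by apply: fc; rewrite in_itv/= x0.
Qed.

Lemma within_ge0_continuous_max f : {within `[0, +oo[, continuous f} ->
  continuous (fun x : R => f (Num.max x 0)).
Proof.
move=> /within_ge0_continuous[fc f0].
rewrite (_ : (fun x => _) = fun x : R => if x <= 0 then f 0 else f x).
  exact: continuous_clamp0.
by apply/funext => x; case: (leP x 0).
Qed.

Section Kernel.
Variables (p : R) (f l : R -> R).
Hypothesis p1 : 1 < p.
Hypothesis cf : {within `[0, +oo[, continuous f}.
Hypothesis f_gt0 : forall t : R, 0 < t -> 0 < f t.
Hypothesis cl : {within `[0, +oo[, continuous l}.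
Hypothesis l_gt0 : forall t : R, 0 < t -> 0 < l t.
Hypothesis lo : (fun t : R => t `^ (p - 1) / l t) x @[x --> 0^'+] --> 0.

(** Extensions of the integrands to the whole line: [f] and [l] are controlled on the half-line
    only, and the assumed limit 0 at 0 is what makes [k0] continuous. *)
Let fmax (x : R) := f (Num.max x 0).
Let k (t : R) := t `^ (p - 1) / l t.
Let k0 (t : R) := if t <= 0 then 0 else k t.

Let F := KO_F f.
Let K := KO_K p l.

Lemma KO_FE (y : R) : F y = \int[lebesgue_measure]_(s in `[0, y]) fmax s.
Proof.
rewrite /F /KO_F; apply: eq_Rintegral => x; rewrite inE/= in_itv/= => /andP[x0 _].
by rewrite /fmax max_l.
Qed.

Lemma KO_KE (t : R) : K t = (p - 1) * \int[lebesgue_measure]_(s in `[0, t]) k0 s.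
Proof.
rewrite /K /KO_K; congr (_ * _); apply: eq_Rintegral => x.
rewrite inE/= in_itv/= => /andP[x0 _]; rewrite /k0 le_eqVlt ltNge x0 orbF.
by case: eqP => [->|//]; rewrite powR0 ?mul0r// subr_eq0 gt_eqF.
Qed.

Let k_continuous (x : R) : 0 < x -> {for x, continuous k}.
Proof.
move=> x0; apply: cvgM.
  exact: (is_derive_continuous (is_derive1_powR _ x0)).
apply: cvgV; first by rewrite gt_eqF// l_gt0.
by have [lc _] := within_ge0_continuous cl; exact: lc.
Qed.

Let k0_continuous : continuous k0.
Proof. exact: (@continuous_clamp0 k 0 k_continuous lo). Qed.

Lemma KO_F_derive (y : R) : 0 < y -> is_derive y 1 F (f y).
Proof.
move=> y0; have fy : fmax y = f y by rewrite /fmax max_l ?ltW.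
have fc x : 0 <= x -> {for x, continuous fmax}.
  by move=> _; exact: within_ge0_continuous_max.
have := is_derive_primitive fc y0; rewrite fy.
by rewrite (_ : (fun _ => _) = F)//; apply/funext => ?; rewrite KO_FE.
Qed.

Lemma KO_F_cvg0 : F x @[x --> 0] --> (0 : R).
Proof.
have fc x : 0 <= x -> {for x, continuous fmax}.
  by move=> _; exact: within_ge0_continuous_max.
have := primitive_cvg0 fc.
by rewrite (_ : (fun _ => _) = F)//; apply/funext => ?; rewrite KO_FE.
Qed.

Lemma KO_K_derive (t : R) : 0 < t -> is_derive t 1 K ((p - 1) * (t `^ (p - 1) / l t)).
Proof.
move=> t0; have kt : k0 t = t `^ (p - 1) / l t by rewrite /k0 leNgt t0.
have kc x : 0 <= x -> {for x, continuous k0} by move=> _; exact: k0_continuous.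
have := is_deriveZ (p - 1) (is_derive_primitive kc t0); rewrite kt.
by rewrite (_ : _ \*: _ = K)//; apply/funext => ?; rewrite KO_KE.
Qed.

Lemma KO_K_cvg0 : K x @[x --> 0] --> (0 : R).
Proof.
have kc x : 0 <= x -> {for x, continuous k0} by move=> _; exact: k0_continuous.
have := @cvgM _ _ _ (nbhs_filter _) _ _ _ _ (cvg_cst (p - 1)) (primitive_cvg0 kc).
rewrite mulr0 => /(_ (nbhs_filter _)).
by rewrite (_ : _ \* _ = K)//; apply/funext => ?; exact/esym/KO_KE.
Qed.

Lemma KO_K0 : K 0 = 0.
Proof. by rewrite /K /KO_K set_itv1 Rintegral_set1 mulr0. Qed.

Let k_gt0 t : 0 < t -> 0 < (p - 1) * (t `^ (p - 1) / l t).
Proof. by move=> t0; rewrite mulr_gt0 ?subr_gt0// divr_gt0 ?l_gt0// powR_gt0. Qed.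

Lemma KO_K_ge0 (t : R) : 0 <= K t.
Proof.
rewrite KO_KE; apply: mulr_ge0; first by rewrite subr_ge0 ltW.
apply: Rintegral_ge0 => x _; rewrite /k0; case: (leP (x : R) 0) => // x0.
by apply: divr_ge0; [exact: powR_ge0|exact/ltW/l_gt0].
Qed.

Lemma KO_K_lt x (y : R) : 0 <= x -> x < y -> K x < K y.
Proof.
rewrite le_eqVlt => /predU1P[<- y0|x0 xy].
  rewrite KO_K0; apply: (@le_lt_trans _ _ (K (y / 2))); first exact: KO_K_ge0.
  apply: (is_derive_lt KO_K_derive k_gt0); first by rewrite divr_gt0.
  by rewrite ltr_pdivrMr// ltr_pMr// ltr1n.
exact: (is_derive_lt KO_K_derive k_gt0).
Qed.

Lemma KO_K_inj x (y : R) : 0 <= x -> 0 <= y -> K x = K y -> x = y.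
Proof.
move=> x0 y0 E; have [xy|yx|//] := ltgtP x y.
- by have := KO_K_lt x0 xy; rewrite E ltxx.
- by have := KO_K_lt y0 yx; rewrite E ltxx.
Qed.

Lemma KO_F_lt x (y : R) : 0 < x -> x < y -> F x < F y.
Proof. exact: (is_derive_lt KO_F_derive). Qed.

Lemma KO_F_gt0 (y : R) : 0 < y -> 0 < F y.
Proof.
move=> y0; apply: (@le_lt_trans _ _ (F (y / 2))).
  apply: Rintegral_ge0 => x; rewrite /= in_itv/= le_eqVlt => /andP[/predU1P[<- _|x0 _]].
    have [_ f0] := within_ge0_continuous cf.
    (* [0 <= f 0]: by continuity a negative value would persist at small positive points, where [f]
       is positive. *)
    rewrite leNgt; apply/negP => fneg.
    have /cvgrPdist_lt/(_ (- f 0)) := f0; rewrite oppr_gt0 => /(_ fneg) H.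
    have [z [z0]] : exists z, 0 < z /\ `|f 0 - f z| < - f 0.
      by near (0 : R)^'+ => z; exists z; split; near: z; [exact: nbhs_right_gt|exact: H].
    rewrite ltr_norml => /andP[+ _]; have := f_gt0 z0; lra.
  by apply/ltW/f_gt0.
apply: KO_F_lt; first by rewrite divr_gt0.
by rewrite ltr_pdivrMr// ltr_pMr// ltr1n.
Unshelve. all: by end_near. Qed.

Lemma KO_KinvK (t : R) : 0 <= t -> KO_Kinv p l (K t) = t.
Proof.
move=> t0; rewrite /KO_Kinv pinvKV//; last by rewrite inE/= in_itv/= t0.
by move=> x y; rewrite !inE/= !in_itv/= !andbT; exact: KO_K_inj.
Qed.

Section Growth.
Variables (B1 B2 mu : R).
Hypotheses (B1_gt0 : 0 < B1) (B2_gt0 : 0 < B2) (mu01 : 0 <= mu < 1).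
Hypothesis l_le : forall t : R, 0 <= t -> l t <= B1 + B2 * t `^ mu.

(** For $x>1$ the growth bound gives $l(x)\le(B_1+B_2)x^\mu$, and $\mu<1<p$, so $K'(x)\ge c/x$ with
    $c=(p-1)/(B_1+B_2)$: [K] outgrows $c\ln x$. *)
Lemma KO_K_unbounded (M : R) : exists2 t : R, 0 < t & M < K t.
Proof.
have /andP[mu0 mu1] := mu01.
pose c := (p - 1) / (B1 + B2).
have B0 : 0 < B1 + B2 by rewrite addr_gt0.
have c0 : 0 < c by rewrite divr_gt0 ?subr_gt0.
have Dd (x : R) : 1 < x -> is_derive x 1 (fun x : R => K x - c * ln x)
    ((p - 1) * (x `^ (p - 1) / l x) - c * x^-1).
  move=> x1; have x0 : 0 < x := lt_trans ltr01 x1.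
  apply: is_deriveB; first exact: KO_K_derive.
  by apply: is_deriveZ; exact: is_derive1_ln.
have Dp (x : R) : 1 < x -> 0 <= (p - 1) * (x `^ (p - 1) / l x) - c * x^-1.
  move=> x1; have x0 : 0 < x := lt_trans ltr01 x1.
  rewrite subr_ge0 /c -!mulrA; apply: ler_wpM2l; first by rewrite subr_ge0 ltW.
  rewrite -invfM ler_pdivlMr ?l_gt0// ler_pdivrMl ?mulr_gt0//.
  apply: (le_trans (l_le (ltW x0))).
  apply: (@le_trans _ _ ((B1 + B2) * x `^ mu)).
    rewrite mulrDl lerD2r; apply: ler_peMr; first exact: ltW.
    rewrite -(@powRr0 _ x).
    by apply: ler_powR => //; exact: ltW.
  rewrite -mulrA; apply: ler_wpM2l; first exact: ltW.
  rewrite -[X in X * x `^ (p - 1)](powRr1 (ltW x0)) -powRD; last by rewrite (gt_eqF x0) implybT.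
  apply: ler_powR; first exact: ltW.
  by rewrite subrKC (ltW (lt_trans mu1 p1)).
pose y := `|(M - K 2 + c * ln 2) / c| + 1.
have y0 : 0 < y by rewrite ltr_pwDr.
exists (2 * expR y); first by rewrite mulr_gt0 ?expR_gt0.
have /(_ 2 (2 * expR y)) := is_derive_le Dd Dp.
have e1 : 1 <= expR y by rewrite -expR0 ler_expR ltW.
move=> /(_ _ _)H.
have {}H := H (ltr1n _ 2) (ler_peMr (ler0n _ 2) e1).
rewrite lnM ?posrE ?expR_gt0// expRK in H.
have : (M - K 2 + c * ln 2) / c < y by rewrite (le_lt_trans (ler_norm _))// ltrDl.
rewrite ltr_pdivrMr// => H2.
have c2 : 0 <= c * ln 2 by rewrite mulr_ge0 ?ltW// ln_gt0// ltr1n.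
by nra.
Qed.

Lemma KO_K_surj (y : R) : 0 < y -> exists2 t : R, 0 < t & K t = y.
Proof.
move=> y0; have [t t0 yt] := KO_K_unbounded y.
have [s s0 [sy st]] : exists2 s : R, 0 < s & K s < y /\ s < t.
  have /cvgrPdist_lt/(_ y y0)[d /= d0 H] := KO_K_cvg0.
  exists (Num.min (d / 2) (t / 2)); first by rewrite lt_min !divr_gt0.
  split.
    set s := Num.min _ _.
    have s0 : 0 < s by rewrite lt_min !divr_gt0.
    have sd : s <= d / 2 by rewrite ge_min lexx.
    have := H s; rewrite /= !sub0r !normrN !ger0_norm ?KO_K_ge0 ?(ltW s0)//.
    by apply; lra.
  by rewrite gt_min; apply/orP; right; lra.
have cK : {within `[s, t], continuous K}.
  apply: continuous_in_subspaceT => x; rewrite inE/= in_itv/= => /andP[sx _].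
  by apply: is_derive_continuous; apply: KO_K_derive; exact: lt_le_trans sx.
have [|x] := IVT (ltW st) cK (v := y).
  by rewrite ge_min (ltW sy)/= le_max (ltW yt) orbT.
by rewrite in_itv/= => /andP[sx _] Kx; exists x => //; exact: lt_le_trans sx.
Qed.

(* [w' = KO_speed w] is the first integral of [(w'^(p-1))' = f(w) l(w')]. *)
Definition KO_speed y := KO_Kinv p l (F y).
Let g := KO_speed.

Lemma KO_speedP (y : R) : 0 < y -> 0 < g y /\ K (g y) = F y.
Proof.
move=> y0; have [t t0 tE] := KO_K_surj (KO_F_gt0 y0).
by rewrite /g /KO_speed -tE KO_KinvK// ltW.
Qed.

Lemma KO_speed_gt0 (y : R) : 0 < y -> 0 < g y.
Proof. by move=> /KO_speedP[]. Qed.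

(** Implicit differentiation of $K(g(y))=F(y)$. *)
Lemma KO_speed_derive (y : R) : 0 < y ->
  is_derive y 1 g (f y * l (g y) / ((p - 1) * g y `^ (p - 1))).
Proof.
move=> y0; have [g0 Kg] := KO_speedP y0.
have Kd := KO_K_derive g0.
have kn0 := k_gt0 g0.
have : is_derive (K (g y)) 1 (KO_Kinv p l) ((p - 1) * (g y `^ (p - 1) / l (g y)))^-1.
  apply: is_derive_inverse => //; last by rewrite gt_eqF.
  - by near=> z; apply: KO_KinvK; apply: ltW; near: z; exact: near_gt.
  - near=> z; apply: is_derive_continuous; apply: KO_K_derive.
    by near: z; exact: near_gt.
rewrite Kg => Kid.
have := is_derive1_comp Kid (KO_F_derive y0).
rewrite (_ : _ * f y = f y * l (g y) / ((p - 1) * g y `^ (p - 1)))//.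
have lg := l_gt0 g0. have pg : 0 < g y `^ (p - 1) by rewrite powR_gt0.
have p10 : p - 1 != 0 by rewrite subr_eq0 gt_eqF.
by field; rewrite p10 !gt_eqF.
Unshelve. all: by end_near. Qed.

Lemma KO_speed_lt x (y : R) : 0 < x -> x < y -> g x < g y.
Proof.
apply: (is_derive_lt KO_speed_derive) => z z0.
by rewrite divr_gt0 ?mulr_gt0 ?subr_gt0 ?powR_gt0 ?KO_speed_gt0 ?f_gt0 ?l_gt0 ?KO_speed_gt0.
Qed.

(** Since [g] is increasing, this is $g(0+)=0$. It lets a profile start at height 0 with zero slope,
    and makes the slope of dilated barriers small. *)
Lemma KO_speed_small (e : R) : 0 < e -> exists2 y : R, 0 < y & g y < e.
Proof.
move=> e0.
have Ke : 0 < K e by rewrite -KO_K0 KO_K_lt.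
have /cvgrPdist_lt/(_ _ Ke)[d /= d0 H] := KO_F_cvg0.
have d2 : 0 < d / 2 by rewrite divr_gt0.
exists (d / 2) => //; have [gy Kg] := KO_speedP d2.
rewrite ltNge; apply/negP => eg.
have KeF : K e <= F (d / 2).
  by rewrite -Kg; move: eg; rewrite le_eqVlt => /predU1P[->//|eg]; apply/ltW/KO_K_lt => //; exact: ltW.
have : K e > F (d / 2).
  have := H (d / 2); rewrite /= !sub0r !normrN (gtr0_norm d2) gtr0_norm ?KO_F_gt0//.
  by apply; lra.
by rewrite ltNge KeF.
Qed.

End Growth.
End Kernel.
End KellerOsserman.

(** * Inversion of a primitive of the reciprocal of the speed *)

Section Inverse.
Context {R : realType}.
Variables (g dg : R -> R).
Hypothesis g_gt0 : forall y : R, 0 < y -> 0 < g y.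
Hypothesis g_der : forall y : R, 0 < y -> is_derive y 1 g (dg y).
Variable G : R -> R.
Hypothesis G_der : forall y : R, 0 < y -> is_derive y 1 G (g y)^-1.

Let gV_gt0 (y : R) : 0 < y -> 0 < (g y)^-1.
Proof. by move=> /g_gt0; rewrite invr_gt0. Qed.

Lemma primitive_lt (x y : R) : 0 < x -> x < y -> G x < G y.
Proof. exact: (is_derive_lt G_der gV_gt0). Qed.

Lemma primitive_le (x y : R) : 0 < x -> x <= y -> G x <= G y.
Proof. by move=> x0; rewrite le_eqVlt => /predU1P[->//|/(primitive_lt x0)/ltW]. Qed.

Lemma primitive_lt_inv (x y : R) : 0 < y -> G x < G y -> x < y.
Proof. by move=> y0; apply: contraTT; rewrite -!leNgt; exact: primitive_le. Qed.

Lemma primitive_inj (x y : R) : 0 < x -> 0 < y -> G x = G y -> x = y.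
Proof.
move=> x0 y0 E; have [xy|yx|//] := ltgtP x y.
- by have := primitive_lt x0 xy; rewrite E ltxx.
- by have := primitive_lt y0 yx; rewrite E ltxx.
Qed.

(** The range of [G] is an interval that may be bounded on either side. Only values at points [G y]
    with [y > 0] matter; the default 0 elsewhere carries no meaning. *)
Definition primitive_inv : R -> R := 'pinv_(fun=> 0) `]0, +oo[ G.
Let w := primitive_inv.

Lemma primitive_invK (y : R) : 0 < y -> w (G y) = y.
Proof.
move=> y0; rewrite /w /primitive_inv pinvKV//; last by rewrite inE/= in_itv/= y0.
by move=> x z; rewrite !inE/= !in_itv/= !andbT; exact: primitive_inj.
Qed.

Lemma primitive_IVT (a b x : R) : 0 < a -> a <= b -> G a <= x <= G b ->
  exists2 y : R, a <= y <= b & G y = x.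
Proof.
move=> a0 ab /andP[ax xb].
have cG : {within `[a, b], continuous G}.
  apply: continuous_in_subspaceT => z; rewrite inE/= in_itv/= => /andP[az _].
  by apply: is_derive_continuous; apply: G_der; exact: lt_le_trans az.
have [|y] := IVT ab cG (v := x).
  by rewrite ge_min ax/= le_max xb orbT.
by rewrite in_itv/= => yab Gy; exists y.
Qed.

Lemma primitive_inv_derive (y : R) : 0 < y -> is_derive (G y) 1 w (g y).
Proof.
move=> y0; rewrite -[g y]invrK; apply: is_derive_inverse.
- by near=> z; apply: primitive_invK; near: z; exact: near_gt.
- near=> z; apply: is_derive_continuous; apply: G_der; near: z; exact: near_gt.
- exact: G_der.
- by rewrite gt_eqF// gV_gt0.
Unshelve. all: by end_near. Qed.

Lemma speed_inv_derive (y : R) : 0 < y ->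
  is_derive (G y) 1 (g \o w) (dg y * g y).
Proof.
move=> y0; have := g_der y0; rewrite -{1}(primitive_invK y0) => gd.
exact: (is_derive1_comp gd (primitive_inv_derive y0)).
Qed.

Lemma flux_inv_derive (p y : R) : 0 < y ->
  is_derive (G y) 1 (fun x => g (w x) `^ (p - 1))
    ((p - 1) * g y `^ (p - 1 - 1) * (dg y * g y)).
Proof.
move=> y0; have := is_derive1_powR (p - 1) (g_gt0 y0).
rewrite -{1}(primitive_invK y0) => pd.
exact: (is_derive1_comp pd (speed_inv_derive y0)).
Qed.

(** [G] is increasing and the integral of $1/g$ over $[b,y]$ is $G(y)-G(b)$, so both sides say that
    these integrals stay bounded. *)
Lemma L1_primitive_bounded :
  L1_at_pinfty (fun y => (g y)^-1) <-> exists M, forall y : R, 0 < y -> G y <= M.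
Proof.
have gVc (x : R) : 0 < x -> {for x, continuous (fun y : R => (g y)^-1)}.
  move=> x0; apply: cvgV; first by rewrite gt_eqF// g_gt0.
  exact: (is_derive_continuous (g_der x0)).
split=> [[a ia]|[M GM]].
(* The given half-line may start at a negative [a], whereas [g] is known on the positive half-line
   only. *)
- pose b := Num.max a 1.
  have b0 : 0 < b by rewrite lt_max ltr01 orbT.
  have ib : lebesgue_measure.-integrable `[b, +oo[ (EFin \o fun y => (g y)^-1).
    by apply: integrableS ia => //; apply: subset_itvr; rewrite bnd_simp le_max lexx.
  have ifin : (\int[lebesgue_measure]_(y in `[b, +oo[) ((g y)^-1)%:E)%E \is a fin_num.
    exact: (integrable_fin_num _ ib).
  exists (G b + fine (\int[lebesgue_measure]_(y in `[b, +oo[) ((g y)^-1)%:E)) => y y0.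
  have int0 c : (0 <= \int[lebesgue_measure]_(y in [set` Interval (BLeft b) c]) ((g y)^-1)%:E)%E.
    apply: integral_ge0 => z; rewrite /= itv_boundlr/= bnd_simp => /andP[bz _].
    by rewrite lee_fin ltW// gV_gt0// (lt_le_trans b0).
  have [yb|by_] := leP y b.
    by rewrite (le_trans (primitive_le y0 yb))// lerDl fine_ge0// int0.
  have E : (\int[lebesgue_measure]_(x in `[b, y]) ((g x)^-1)%:E = (G y)%:E - (G b)%:E)%E.
    apply: continuous_FTC2 => //.
    - apply: continuous_in_subspaceT => z; rewrite inE/= in_itv/= => /andP[bz _].
      by apply: gVc; exact: lt_le_trans bz.
    - split.
      + move=> z; rewrite in_itv/= => /andP[bz _].
        by have [] := G_der (lt_trans b0 bz).
      + by apply: cvg_at_right_filter; apply: is_derive_continuous; exact: G_der.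
      + by apply: cvg_at_left_filter; apply: is_derive_continuous; exact: G_der.
    - move=> z; rewrite in_itv/= => /andP[bz _]; rewrite derive1E.
      by have [_ ->] := G_der (lt_trans b0 bz).
  rewrite -lerBlDl -lee_fin fineK// EFinB -E.
  apply: ge0_subset_integral => //.
  + by apply: measurable_int ib.
  + move=> z; rewrite /= in_itv/= andbT => bz.
    by rewrite lee_fin ltW// gV_gt0// (lt_le_trans b0).
  + by apply: subset_itvl.
- exists 1.
  (* Freezing [G] below 1 gives a function monotone on the whole line, whose limit at infinity is
     its supremum. *)
  pose H (x : R) := G (Num.max x 1).
  have m1 (x : R) : 0 < Num.max x 1 by rewrite lt_max ltr01 orbT.
  have Hnd : {homo H : x y / x <= y}.
    move=> x y xy; apply: primitive_le => //.
    by rewrite ge_max !le_max xy lexx orbT.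
  have Hb : has_ubound (range H) by exists M => _ [x _ <-]; exact: GM.
  have Hc := nondecreasing_cvgr Hnd Hb.
  have Gc : G x @[x --> +oo] --> sup (range H).
    apply: cvg_trans Hc; apply: near_eq_cvg.
    have : \forall x \near +oo, (1 : R) <= x by exact: nbhs_pinfty_ge.
    by apply: filterS => x x1; rewrite /H max_l.
  have E : (\int[lebesgue_measure]_(x in `[1%R, +oo[) ((g x)^-1)%:E =
            (sup (range H))%:E - (G 1)%:E)%E.
    apply: ge0_continuous_FTC2y => //.
    - by move=> x x1; rewrite ltW// gV_gt0// (lt_le_trans ltr01).
    - apply: continuous_in_subspaceT => z; rewrite inE/= in_itv/= => /andP[bz _].
      by apply: gVc; exact: lt_le_trans bz.
    - by move=> x x1; have [] := G_der (lt_trans ltr01 x1).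
    - by apply: cvg_at_right_filter; apply: is_derive_continuous; exact: G_der.
    - move=> z; rewrite in_itv/= => /andP[bz _]; rewrite derive1E.
      by have [_ ->] := G_der (lt_trans ltr01 bz).
  apply/integrableP; split.
    apply/measurable_EFinP; apply: subspace_continuous_measurable_fun => //.
    apply: continuous_in_subspaceT => z; rewrite inE/= in_itv/= => /andP[bz _].
    by apply: gVc; exact: lt_le_trans bz.
  rewrite (_ : \int[_]_(_ in _) _ = (sup (range H))%:E - (G 1)%:E)%E ?ltry//.
  rewrite -E; apply: eq_integral => x; rewrite inE/= in_itv/= andbT => x1.
  by rewrite /= ger0_norm// ltW// gV_gt0// (lt_le_trans ltr01).
Qed.

End Inverse.

(** * Solutions of the one-dimensional equation on the whole line *)

Section Profile.
Context {R : realType}.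
Variables (p : R) (f l g dg : R -> R).
Hypothesis p1 : 1 < p.
Hypothesis cf : continuous f.
Hypothesis cl : continuous l.
Hypothesis g_gt0 : forall y : R, 0 < y -> 0 < g y.
Hypothesis g_der : forall y : R, 0 < y -> is_derive y 1 g (dg y).
Hypothesis dgE : forall y : R, 0 < y -> dg y = f y * l (g y) / ((p - 1) * g y `^ (p - 1)).
Hypothesis g_lt : forall x y : R, 0 < x -> x < y -> g x < g y.
Hypothesis g_small : forall e : R, 0 < e -> exists2 y : R, 0 < y & g y < e.
Variable G : R -> R.
Hypothesis G_der : forall y : R, 0 < y -> is_derive y 1 G (g y)^-1.

Let w := primitive_inv G.
Let wK (y : R) : 0 < y -> w (G y) = y.
Proof. exact: primitive_invK. Qed.

Lemma flux_derive (y : R) : 0 < y ->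
  is_derive (G y) 1 (fun x => g (w x) `^ (p - 1)) (f y * l (g y)).
Proof.
move=> y0; have := flux_inv_derive g_gt0 g_der G_der p y0; rewrite dgE//.
set a := (X in is_derive _ _ _ X -> _); suff -> : a = f y * l (g y) by [].
have g0 := g_gt0 y0.
rewrite /a (_ : g y `^ (p - 1) = g y * g y `^ (p - 1 - 1)); last first.
  rewrite -[X in X * g y `^ _](powRr1 (ltW g0)) -powRD ?(gt_eqF g0) ?implybT//.
  by congr (_ `^ _); ring.
have pg : 0 < g y `^ (p - 1 - 1) by exact: powR_gt0.
by field; rewrite subr_eq0 !gt_eqF.
Qed.

(** The last clause is the equation $(|W'|^{p-2}W')'=f(W)\,l(|W'|)$. It is the flux that is
    differentiated: at a critical point of [W], the slope [V] itself may have no derivative. *)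
Definition is_profile (W V : R -> R) := [/\ forall x : R, 0 <= W x,
  exists x y, W x != W y,
  forall x : R, is_derive x 1 W (V x),
  continuous V &
  forall x : R, is_derive x 1 (fun x => `|V x| `^ (p - 2) * V x) (f (W x) * l `|V x|)].

(** Case where [G] takes every real value: [w] lives on the whole line and stays positive. *)
Lemma profile_line : (forall x : R, exists2 y : R, 0 < y & G y = x) ->
  is_profile w (g \o w).
Proof.
move=> Gs; split.
- by move=> x; have [y y0 <-] := Gs x; rewrite wK// ltW.
- by exists (G 1), (G 2); rewrite !wK// lt_eqF// ltr1n.
- move=> x; have [y y0 <-] := Gs x; rewrite /= wK//.
  exact: (primitive_inv_derive g_gt0 G_der).
- move=> x; have [y y0 <-] := Gs x.
  exact: (is_derive_continuous (speed_inv_derive g_gt0 g_der G_der y0)).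
- move=> x; have [y y0 <-] := Gs x.
  have := flux_derive y0; rewrite /= wK// (ger0_norm (ltW (g_gt0 y0))).
  rewrite (_ : (fun x => g (w x) `^ (p - 1)) = fun x => `|g (w x)| `^ (p - 2) * g (w x))//.
  apply/funext => z; have [t t0 <-] := Gs z.
  by rewrite wK// (ger0_norm (ltW (g_gt0 t0))) powR_sub2// ltW// g_gt0.
Qed.

Lemma even_derive (P Q : R -> R) : (forall x : R, 0 < x -> is_derive x 1 P (Q x)) ->
  forall x : R, x != 0 -> is_derive x 1 (fun x => P `|x|) (Num.sg x * Q `|x|).
Proof.
move=> PQ x; rewrite neq_lt => /orP[x0|x0].
- have nx0 : 0 < - x by rewrite oppr_gt0.
  have := is_derive1_comp (PQ _ nx0) (is_deriveNid x 1).
  rewrite ltr0_sg// ltr0_norm// mulrC; apply: near_eq_is_derive.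
  by near=> z; rewrite /= ltr0_norm//; near: z; exact: near_lt.
- rewrite gtr0_sg// gtr0_norm// mul1r; apply: near_eq_is_derive (PQ _ x0).
  by near=> z; rewrite gtr0_norm//; near: z; exact: near_gt.
Unshelve. all: by end_near. Qed.

Lemma odd_derive (P Q : R -> R) : (forall x : R, 0 < x -> is_derive x 1 P (Q x)) ->
  forall x : R, x != 0 -> is_derive x 1 (fun x => Num.sg x * P `|x|) (Q `|x|).
Proof.
move=> PQ x x0; have := even_derive PQ x0; move: x0; rewrite neq_lt => /orP[x0|x0].
- rewrite ltr0_sg// mulN1r => /is_deriveN; rewrite opprK.
  apply: near_eq_is_derive; near=> z; rewrite /= ltr0_sg ?mulN1r//.
  by near: z; exact: near_lt.
- rewrite gtr0_sg// mul1r.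
  apply: near_eq_is_derive; near=> z; rewrite /= gtr0_sg ?mul1r//.
  by near: z; exact: near_gt.
Unshelve. all: by end_near. Qed.

(** [m] is the infimum of [G], so $w(x+m)$ and its slope both tend to 0 as $x\to 0^+$. Hence [W],
    [V] and the flux are continuous across 0 in the even continuation. Away from 0 the derivatives
    of [W] and of the flux are known, and they have limits at 0, so the formulas extend to 0 by
    [is_derive_extend]. *)
Lemma profile_even (m : R) :
  (forall y : R, 0 < y -> m < G y) ->
  (forall e : R, 0 < e -> exists2 y : R, 0 < y & G y < m + e) ->
  (forall M : R, exists2 y : R, 0 < y & M < G y) ->
  is_profile (fun x => if x == 0 then 0 else w (`|x| + m))
    (fun x => Num.sg x * g (w (`|x| + m))).
Proof.
move=> mG Gm Gu.
have Gs (x : R) : 0 < x -> exists2 y : R, 0 < y & G y = x + m.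
  move=> x0; have [a a0 Ga] := Gm _ x0; have [b b0 bG] := Gu (x + m).
  have ab : a <= b.
    by apply/ltW/(primitive_lt_inv g_gt0 G_der b0); rewrite (lt_trans Ga)// addrC.
  have [|y /andP[ay _] Gy] := primitive_IVT G_der a0 ab (x := x + m).
    by rewrite (ltW bG) andbT addrC ltW.
  by exists y => //; exact: lt_le_trans ay.
set W := (fun x : R => if _ then _ else _); set V := (fun x : R => _ * _).
have small (y : R) : 0 < y -> exists2 d : R, 0 < d & forall x : R, `|x| < d -> x != 0 ->
    0 < w (`|x| + m) < y.
  move=> y0; exists (G y - m); first by rewrite subr_gt0 mG.
  move=> x; rewrite ltrBrDr => xG x0; have xp : 0 < `|x| by rewrite normr_gt0.
  have [z z0 zE] := Gs _ xp; rewrite -zE wK// z0/=.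
  by rewrite -zE in xG; exact: (primitive_lt_inv g_gt0 G_der y0).
have V0 : V 0 = 0 by rewrite /V sgr0 mul0r.
have W0 : W 0 = 0 by rewrite /W eqxx.
have gw0 (x : R) : x != 0 -> 0 < g (w (`|x| + m)).
  move=> x0; have [|y y0 yE] := Gs `|x|; first by rewrite normr_gt0.
  by rewrite -yE wK// g_gt0.
have Vabs (x : R) : x != 0 -> `|V x| = g (w (`|x| + m)).
  by move=> x0; rewrite /V normrM normr_sg x0 mul1r gtr0_norm// gw0.
have shift_derive (P : R -> R) (d : R -> R) :
    (forall y : R, 0 < y -> is_derive (G y) 1 P (d (w (G y)))) ->
    forall x : R, 0 < x -> is_derive x 1 (fun x => P (x + m)) (d (w (x + m))).
  move=> Pd x x0; have [y y0 yE] := Gs x x0.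
  have := Pd _ y0; rewrite yE => {}Pd.
  have sd : is_derive x 1 (fun x => x + m) 1.
    by rewrite -[X in is_derive _ _ _ X]addr0; apply: is_deriveD.
  have := @is_derive1_comp _ P (fun x => x + m) x _ _ Pd sd; rewrite mulr1; exact.
have Wd (x : R) : x != 0 -> is_derive x 1 W (V x).
  move=> x0.
  have wd (z : R) : 0 < z -> is_derive z 1 (fun x => w (x + m)) (g (w (z + m))).
    apply: (@shift_derive w g) => y y0; rewrite wK//.
    exact: (primitive_inv_derive g_gt0 G_der).
  have := @even_derive (fun x => w (x + m)) (fun x => g (w (x + m))) wd x x0.
  apply: near_eq_is_derive.
  have : \forall z \near x, z != 0.
    move: (x0); rewrite neq_lt => /orP[/near_lt|/near_gt]; apply: filterS => z z0.
      by rewrite lt_eqF.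
    by rewrite gt_eqF.
  by apply: filterS => z z0; rewrite /W (negPf z0).
have Vd (x : R) : x != 0 -> exists d, is_derive x 1 V d.
  have gwd (z : R) : 0 < z -> is_derive z 1 (fun x => g (w (x + m)))
      (dg (w (z + m)) * g (w (z + m))).
    apply: (@shift_derive (g \o w) (fun y => dg y * g y)) => y y0; rewrite wK//.
    exact: (speed_inv_derive g_gt0 g_der G_der).
  move=> x0; exists (dg (w (`|x| + m)) * g (w (`|x| + m))).
  exact: (@odd_derive (fun x => g (w (x + m))) (fun x => dg (w (x + m)) * g (w (x + m))) gwd x x0).
have phiE (x : R) : `|V x| `^ (p - 2) * V x = Num.sg x * g (w (`|x| + m)) `^ (p - 1).
  have [->|x0] := eqVneq x 0; first by rewrite V0 sgr0 mul0r mulr0.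
  by rewrite Vabs// -powR_sub2 ?ltW ?gw0// /V; ring.
have phid (x : R) : x != 0 ->
    is_derive x 1 (fun x => `|V x| `^ (p - 2) * V x) (f (W x) * l `|V x|).
  move=> x0; rewrite (_ : (fun x => _) = fun x => Num.sg x * g (w (`|x| + m)) `^ (p - 1)); last first.
    exact/funext.
  rewrite Vabs// /W (negPf x0).
  have fd (z : R) : 0 < z -> is_derive z 1 (fun x => g (w (x + m)) `^ (p - 1))
      (f (w (z + m)) * l (g (w (z + m)))).
    apply: (@shift_derive (fun x => g (w x) `^ (p - 1)) (fun y => f y * l (g y))) => y y0.
    by rewrite wK//; exact: flux_derive.
  exact: (@odd_derive (fun x => g (w (x + m)) `^ (p - 1))
    (fun x => f (w (x + m)) * l (g (w (x + m)))) fd x x0).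
(* Anything that becomes small together with the height of the profile is continuous at 0. *)
have cvg0 (P : R -> R) : (forall e : R, 0 < e -> exists2 y : R, 0 < y &
      forall x : R, x != 0 -> 0 < w (`|x| + m) < y -> `|P x| < e) ->
    P 0 = 0 -> {for 0, continuous P}.
  move=> Pe P0; rewrite /prop_for/continuous_at P0; apply/cvgrPdist_lt => e e0.
  have [y y0 Hy] := Pe _ e0; have [d d0 Hd] := small _ y0.
  exists d => //= x; rewrite /= !sub0r !normrN => xd.
  have [->|x0] := eqVneq x 0; first by rewrite P0 normr0.
  by apply: Hy => //; exact: Hd.
have Vc0 : {for 0, continuous V}.
  apply: cvg0 => // e e0; have [y y0 gy] := g_small e0.
  exists y => // x x0 /andP[w0 wy]; rewrite Vabs//.
  by apply: lt_trans gy; exact: g_lt.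
have Wc0 : {for 0, continuous W}.
  apply: cvg0 => // e e0; exists e => // x x0 /andP[w0 wy].
  by rewrite /W (negPf x0) gtr0_norm.
have phic0 : {for 0, continuous (fun x => `|V x| `^ (p - 2) * V x)}.
  apply: cvg0; last by rewrite V0 mulr0.
  (* The flux has size $g^{p-1}$, so it is below [e] once [g] is below $e^{1/(p-1)}$. *)
  move=> e e0; have [y y0 gy] := g_small (powR_gt0 (p - 1)^-1 e0).
  exists y => // x x0 /andP[w0 wy].
  rewrite phiE normrM normr_sg x0 mul1r ger0_norm ?powR_ge0//.
  have eE : (e `^ (p - 1)^-1) `^ (p - 1) = e.
    by rewrite -powRrM mulVf ?powRr1 ?ltW// subr_eq0 gt_eqF.
  rewrite -eE; apply: gt0_ltr_powR; rewrite ?subr_gt0// ?nnegrE ?powR_ge0//.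
    by rewrite ltW// gw0.
  by apply: lt_trans gy; exact: g_lt.
have Vc : continuous V.
  move=> x; have [->|/Vd[d /is_derive_continuous]//] := eqVneq x 0; exact: Vc0.
split => //.
- move=> x; rewrite /W; case: eqVneq => // x0.
  by have [|y y0 yE] := Gs `|x|; rewrite ?normr_gt0// -yE wK// ltW.
- exists 0, 1; rewrite W0 /W oner_eq0 normr1.
  by have [//|y y0 yE] := Gs 1; rewrite -yE wK// lt_eqF.
- move=> x; have [->|x0] := eqVneq x 0; last exact: Wd.
  exact: is_derive_extend.
- move=> x; have [->|x0] := eqVneq x 0; last exact: phid.
  apply: (is_derive_extend phic0 phid).
  apply: cvgM; first by apply: continuous_comp => //; exact: cf.
  have lc : continuous (fun v : R => l `|v|).
    move=> v; apply: (@continuous_comp _ _ _ (fun v : R => `|v|) l); last exact: cl.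
    exact: norm_continuous.
  by apply: (@continuous_comp _ _ _ V (fun v => l `|v|)); [exact: Vc0|exact: lc].
Qed.

(** If [G] is bounded below, the even profile touches 0 at one point; otherwise [G] is onto and the
    profile stays positive. *)
Lemma profile_exists : (forall M : R, exists2 y : R, 0 < y & M < G y) ->
  exists W V, is_profile W V.
Proof.
move=> Gu.
have [Gb|Gb] := pselect (exists m, forall y : R, 0 < y -> m <= G y).
  pose S := [set G y | y in [set y : R | 0 < y]].
  have Si : has_inf S.
    split; first by exists (G 1), 1 => //=; exact: ltr01.
    by have [m Hm] := Gb; exists m => _ [y y0 <-]; exact: Hm.
  pose m := inf S.
  have mle (y : R) : 0 < y -> m <= G y.
    by move=> y0; apply: ge_inf; [have [] := Si|exists y].
  do 2 eexists; apply: (@profile_even m) => //.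
  - move=> y y0; apply: (@le_lt_trans _ _ (G (y / 2))); first by apply: mle; lra.
    by apply: (primitive_lt g_gt0 G_der); lra.
  - by move=> e e0; have [_ [y y0 <-] H] := inf_adherent e0 Si; exists y.
do 2 eexists; apply: profile_line => x.
have [a a0 Ga] : exists2 a : R, 0 < a & G a < x.
  have /existsNP[a /not_implyP[a0 /negP]] : ~ forall y : R, 0 < y -> x <= G y.
    by move=> H; apply: Gb; exists x.
  by rewrite -ltNge; exists a.
have [b b0 Gb'] := Gu x.
have ab : a <= b by apply/ltW/(primitive_lt_inv g_gt0 G_der b0); exact: lt_trans Ga _.
have [|y /andP[ay _] Gy] := primitive_IVT G_der a0 ab (x := x).
  by rewrite !ltW.
by exists y => //; exact: lt_le_trans ay.
Qed.

End Profile.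

(** * Integration over R^n *)

Section RowVectors.
Context {R : realType}.

Lemma coord_norm_le n (q : 'rV[R]_n) i : `|q 0 i| <= `|q|.
Proof.
rewrite [leRHS]/Num.norm/= mx_normrE; apply/bigmax_geP; right => /=.
by exists (0, i).
Qed.

Lemma row_norm_le n (q : 'rV[R]_n) (c : R) : 0 <= c ->
  (forall i, `|q 0 i| <= c) -> `|q| <= c.
Proof.
move=> c0 H; rewrite [leLHS]/Num.norm/= mx_normrE; apply/bigmax_leP; split => //=.
by move=> [i j] _ /=; rewrite ord1; exact: H.
Qed.

Lemma row_norm_lt n (q : 'rV[R]_n) (c : R) : 0 < c ->
  (forall i, `|q 0 i| < c) -> `|q| < c.
Proof.
move=> c0 H; rewrite [ltLHS]/Num.norm/= mx_normrE; apply/bigmax_ltP; split => //=.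
by move=> [i j] _ /=; rewrite ord1; exact: H.
Qed.

Lemma continuousPe (V : normedModType R) (h : V -> R) (q : V) :
  {for q, continuous h} <->
  forall e : R, 0 < e -> exists2 d : R, 0 < d &
    forall q', `|q - q'| < d -> `|h q - h q'| < e.
Proof.
split=> [/cvgrPdist_lt H e e0|H].
  have /nbhs_normP[d /= d0 Hd] := H e e0.
  by exists d => // q' qq'; exact: Hd.
apply/cvgrPdist_lt => e /H[d d0 Hd]; apply/nbhs_normP; exists d => //=.
Qed.

Lemma is_derive_line (V : normedModType R) (f : V -> R) (q v : V) (s d : R) :
  is_derive (s *: v + q) v f d <-> is_derive s 1 (fun s => f (s *: v + q)) d.
Proof.
have E : (fun h : R => h^-1 *: ((f \o shift (s *: v + q)) (h *: v) - f (s *: v + q)))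
       = (fun h : R => h^-1 *: (((fun s => f (s *: v + q)) \o shift s) (h *: 1) - f (s *: v + q))).
  by apply/funext => h; rewrite /= /shift/= addrA -scalerDl [h *: 1]mulr1.
by split=> -[D <-]; apply: DeriveDef; rewrite /derivable /derive ?E// -E.
Qed.

Lemma is_derive_line0 (V : normedModType R) (f : V -> R) (q v : V) (d : R) :
  is_derive q v f d <-> is_derive (0 : R) 1 (fun s => f (s *: v + q)) d.
Proof. by have := is_derive_line f q v 0 d; rewrite scale0r add0r. Qed.

Definition consr n (x : R) (q : 'rV[R]_n) : 'rV[R]_n.+1 :=
  \row_i (if unlift ord0 i is Some j then q 0 j else x).

Lemma consr0 n x (q : 'rV[R]_n) : consr x q 0 ord0 = x.
Proof. by rewrite mxE unlift_none. Qed.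

Lemma consrS n x (q : 'rV[R]_n) i : consr x q 0 (lift ord0 i) = q 0 i.
Proof. by rewrite mxE liftK. Qed.

Lemma consr_addl n (s x : R) (q : 'rV[R]_n) :
  consr (s + x) q = s *: delta_mx 0 ord0 + consr x q.
Proof.
apply/rowP => i; rewrite !mxE; case: unliftP => [j|] ->; rewrite ?eqxx/=.
  by rewrite mulr0 add0r.
by rewrite mulr1.
Qed.

Lemma consr_addr n (s x : R) (q : 'rV[R]_n) j :
  consr x (s *: delta_mx 0 j + q) = s *: delta_mx 0 (lift ord0 j) + consr x q.
Proof.
apply/rowP => i; rewrite !mxE; rewrite eqxx/=.
case: unliftP => [k|] ->; first by rewrite !mxE eqxx/= (inj_eq lift_inj).
by rewrite (negPf (neq_lift _ _)) mulr0 add0r.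
Qed.

Lemma consr_continuous n (h : 'rV[R]_n.+1 -> R) x :
  continuous h -> continuous (fun q : 'rV[R]_n => h (consr x q)).
Proof.
move=> hc q; apply/continuousPe => e e0.
have /continuousPe/(_ e e0)[d d0 Hd] := hc (consr x q).
exists d => // q' qq'; apply: Hd; apply: row_norm_lt => // i; rewrite !mxE.
case: unliftP => [j _|_]; last by rewrite subrr normr0.
by have := coord_norm_le (q - q') j; rewrite !mxE => /le_lt_trans; exact.
Qed.

Lemma consr_continuousl n (h : 'rV[R]_n.+1 -> R) (q : 'rV[R]_n) :
  continuous h -> continuous (fun x : R => h (consr x q)).
Proof.
move=> hc x; apply/continuousPe => e e0.
have /continuousPe/(_ e e0)[d d0 Hd] := hc (consr x q).
exists d => // x' xx'; apply: Hd; apply: row_norm_lt => // i; rewrite !mxE.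
by case: unliftP => [j _|_]//; rewrite subrr normr0.
Qed.

End RowVectors.

Section TupleIntegral.
Context {R : realType}.
Local Notation T := (measurableTypeR R).
Local Notation lam := (@lebesgue_measure R).

Definition rowt n (v : n.-tuple R) : 'rV[R]_n := \row_i tnth v i.

Lemma rowt_cons n (x : R) (v : n.-tuple T) :
  rowt (tuple_cons (x, v)) = consr x (rowt v).
Proof.
apply/rowP => i; rewrite !mxE; case: unliftP => [j|] ->; last by [].
by rewrite tnthS mxE.
Qed.

Lemma measurable_tuple_box n (A : 'I_n -> set T) :
  (forall i, measurable (A i)) -> measurable [set v : n.-tuple T | forall i, A i (tnth v i)].
Proof.
move=> mA.
rewrite (_ : [set v | _] =
    \bigcap_(i in [set: 'I_n]) [set v | A i (tnth v i)]); last first.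
  by apply/seteqP; split => [v H i _|v H i]; [exact: H|exact: H].
apply: fin_bigcap_measurable => // i _.
have := @measurable_tnth _ T n i measurableT _ (mA i).
by rewrite setTI.
Qed.

(** Measurability on tuples is coordinatewise, while continuity refers to the norm of row vectors.
    Rounding every coordinate down to a multiple of $1/(k+1)$ gives functions that are constant on
    each of countably many boxes and converge to [h] pointwise. *)
Lemma measurable_rowt n (h : 'rV[R]_n -> R) : continuous h ->
  measurable_fun setT (fun v : n.-tuple T => h (rowt v)).
Proof.
move=> hc.
pose a (k : nat) (x : R) : R := (Num.floor (x * k.+1%:R))%:~R / k.+1%:R.
have aP k x : `|x - a k x| <= k.+1%:R^-1.
  have k0 : (0 : R) < k.+1%:R by [].
  have := Num.Theory.floor_itv (x * k.+1%:R) => /andP[f1 f2].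
  rewrite ger0_norm.
    rewrite /a -[x in x - _](mulfK (lt0r_neq0 k0)) -mulrBl ler_pdivrMr// mulVf ?lt0r_neq0//.
    by rewrite lerBlDl; rewrite intrD in f2; exact: ltW.
  by rewrite subr_ge0 /a ler_pdivrMr.
apply: (@measurable_fun_cvg _ _ _ setT (fun k v => h (\row_i a k (tnth v i)))).
  move=> k _ Y mY; rewrite setTI.
  pose Z (z : n.-tuple int) := [set v : n.-tuple T | h (\row_i ((tnth z i)%:~R / k.+1%:R)) \in Y /\
     forall i, [set x : T | Num.floor (x * k.+1%:R) = tnth z i] (tnth v i)].
  rewrite (_ : _ @^-1` Y = \bigcup_z Z z).
    apply: countable_bigcupT_measurable => [|z]; first exact: countableP.
    have [hY|hY] := boolP (h (\row_i ((tnth z i)%:~R / k.+1%:R)) \in Y); last first.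
      by rewrite (_ : Z z = set0)//; apply/seteqP; split => // v [/=]; rewrite (negPf hY).
    rewrite (_ : Z z = [set v | forall i, [set x : T | Num.floor (x * k.+1%:R) = tnth z i] (tnth v i)]); last first.
      by apply/seteqP; split => [v []//|v Hv]; split.
    apply: (@measurable_tuple_box n (fun i => [set x : T | Num.floor (x * k.+1%:R) = tnth z i])) => i.
    rewrite (_ : mkset _ = `[(tnth z i)%:~R / k.+1%:R, ((tnth z i) + 1)%:~R / k.+1%:R[%classic); first exact: measurable_itv.
    apply/seteqP; split=> x /=; rewrite in_itv/= ler_pdivrMr// ltr_pdivlMr//.
      by move=> <-; exact: Num.Theory.floor_itv.
    by move=> ?; exact: Num.Theory.floor_def.
  apply/seteqP; split => [v /= hv|v [z _ [+ zv]]] /=.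
    exists [tuple Num.floor (tnth v i * k.+1%:R) | i < n] => //; split => [|i] /=.
      rewrite inE; move: hv; congr (Y (h _)); apply/rowP => i.
      by rewrite !mxE tnth_mktuple.
    by rewrite tnth_mktuple.
  rewrite inE; congr (Y (h _)); apply/rowP => i.
  by rewrite !mxE /a (zv i).
move=> v _; apply/cvgrPdist_lt => e e0.
have /continuousPe/(_ e e0)[d d0 Hd] := hc (rowt v).
near=> k; apply: Hd; apply: row_norm_lt => // i; rewrite !mxE.
apply: (le_lt_trans (aP _ _)).
by near: k; exact: near_infty_natSinv_lt (PosNum d0).
Unshelve. all: by end_near. Qed.

Lemma integrable_bounded_support d (X : measurableType d)
    (mu : {measure set X -> \bar R}) (D : set X) (h : X -> R) (C : R) :
  measurable D -> (mu D < +oo)%E -> measurable_fun setT h ->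
  (forall x, D x -> `|h x| <= C) -> (forall x, ~ D x -> h x = 0) ->
  mu.-integrable setT (EFin \o h).
Proof.
move=> mD Dfin mh hC h0.
apply/integrableP; split; first exact/measurable_EFinP.
apply: (@le_lt_trans _ _ (\int[mu]_(x in D) `|C|%:E)%E).
  rewrite (_ : (\int[mu]_x `|(EFin \o h) x|)%E = (\int[mu]_(x in D) `|h x|%:E)%E); last first.
    rewrite [RHS]integral_mkcond; apply: eq_integral => x _ /=.
    by rewrite patchE; case: ifPn => //; rewrite notin_setE => /h0 ->; rewrite normr0.
  apply: ge0_le_integral => //.
  - by apply/measurable_EFinP; apply: measurableT_comp => //; exact: measurable_funTS.
  - by move=> x Dx; rewrite lee_fin (le_trans (hC _ Dx))// ler_norm.
by rewrite integral_cst// lte_mul_pinfty// lee_fin.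
Qed.

Definition cube n (r : R) := [set v : n.-tuple T | forall i, `[- r, r]%classic (tnth v i)].

Lemma measurable_cube n r : measurable (@cube n r).
Proof. exact: (@measurable_tuple_box n (fun=> `[- r, r]%classic)). Qed.

Lemma cube_measure n r : (lebesgue_Rn R n (@cube n r) = \prod_(i < n) lam `[(- r)%R, r])%E.
Proof.
have := @tuple_measure_box _ _ _ [the {sigma_finite_measure set _ -> \bar R} of @lebesgue_measure R] n (fun=> `[- r, r]%classic) (fun=> measurable_itv _).
by [].
Qed.

Lemma itv_measure_fin (r : R) : lam `[(- r)%R, r] \is a fin_num.
Proof. by rewrite lebesgue_measure_itv; case: ifP => // _; rewrite -EFinB. Qed.

Lemma cube_measure_fin n r : (lebesgue_Rn R n (@cube n r) < +oo)%E.
Proof.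
have H := itv_measure_fin r.
rewrite cube_measure -(fineK H) (_ : (\prod_(i < n) _)%E = (\prod_(i < n) fine (lam `[- r, r]))%:E).
  exact: ltry.
by rewrite prodEFin.
Qed.

End TupleIntegral.

Section Continuity.
Context {R : realType} {V : normedModType R}.
Implicit Types f g : V -> R.

Lemma ctsD f g : continuous f -> continuous g -> continuous (fun x => f x + g x).
Proof. by move=> fc gc x; exact: (@cvgD _ _ _ _ (nbhs_filter x) _ _ _ _ (fc x) (gc x)). Qed.

Lemma ctsB f g : continuous f -> continuous g -> continuous (fun x => f x - g x).
Proof. by move=> fc gc x; exact: (@cvgB _ _ _ _ (nbhs_filter x) _ _ _ _ (fc x) (gc x)). Qed.

Lemma ctsM f g : continuous f -> continuous g -> continuous (fun x => f x * g x).
Proof. by move=> fc gc x; exact: (@cvgM _ _ _ (nbhs_filter x) _ _ _ _ (fc x) (gc x)). Qed.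

Lemma cts_cst (c : R) : continuous (fun _ : V => c).
Proof. by move=> x; exact: cvg_cst. Qed.

Lemma ctsMl c f : continuous f -> continuous (fun x => c * f x).
Proof. by move=> fc; apply: ctsM => //; exact: cts_cst. Qed.

Lemma cts_sum (I : Type) (s : seq I) (F : I -> V -> R) :
  (forall i, continuous (F i)) -> continuous (fun x => \sum_(i <- s) F i x).
Proof.
move=> Fc; elim: s => [|i s IH].
  by under eq_fun do rewrite big_nil; exact: cts_cst.
by under eq_fun do rewrite big_cons; exact: ctsD.
Qed.

End Continuity.

(** * Fubini and vanishing of integrals of derivatives *)

Section TupleFubini.
Context {R : realType}.
Local Notation T := (measurableTypeR R).
Local Notation lam := (@lebesgue_measure R).

Definition off_ball n (r : R) (h : 'rV[R]_n -> R) := forall q, r < `|q| -> h q = 0.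

Lemma closed_norm_le n (r : R) : closed [set q : 'rV[R]_n | `|q| <= r].
Proof.
apply: (@closed_comp _ _ (fun q : 'rV[R]_n => `|q|) [set x : R | x <= r]).
  by move=> q _; exact: norm_continuous.
exact: closed_le.
Qed.

Lemma ball_bounded n (h : 'rV[R]_n -> R) (r : R) : continuous h ->
  exists2 C : R, 0 <= C & forall q, `|q| <= r -> `|h q| <= C.
Proof.
move=> hc; pose A := [set q : 'rV[R]_n | `|q| <= `|r|].
have cA : compact A.
  apply: bounded_closed_compact; last exact: closed_norm_le.
  exists `|r|; split; first exact: num_real.
  by move=> x rx q /= qr; rewrite (le_trans qr)// ltW.
have A0 : A !=set0 by exists 0; rewrite /A/= normr0.
have cn : {within A, continuous (fun q => `|h q|)}.
  apply: continuous_subspaceT => q.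
  by apply: (@continuous_comp _ _ _ h (fun x : R => `|x|)); [exact: hc|exact: norm_continuous].
have [c _ cmax] := EVT_max_rV A0 cA cn.
exists `|h c| => // q qr; apply: cmax; rewrite inE /A/=.
by rewrite (le_trans qr)// ler_norm.
Qed.

Lemma off_ball_bounded n r (h : 'rV[R]_n -> R) : continuous h -> off_ball r h ->
  exists C, forall q, `|h q| <= C.
Proof.
move=> hc h0; have [C C0 HC] := ball_bounded r hc; exists C => q.
by have [/HC//|rq] := leP `|q| r; rewrite h0 ?normr0.
Qed.

Lemma test_function_off_ball n (rho : 'rV[R]_n -> R) :
  test_function rho -> exists r, off_ball r rho.
Proof.
move=> [_ rK]; have [M [Mr HM]] := compact_bounded rK.
exists (M + 1) => q qM; apply/eqP; apply: contraTT qM => rq; rewrite -leNgt.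
by apply: (HM (M + 1)); [rewrite ltrDl|exact: subset_closure].
Qed.

Lemma rowt_off_cube n r (v : n.-tuple T) : ~ cube r v -> r < `|rowt v|.
Proof.
move=> /existsNP[i /=]; rewrite in_itv/= -ler_norml => /negP; rewrite -ltNge.
by move=> /lt_le_trans; apply; have := coord_norm_le (rowt v) i; rewrite mxE.
Qed.

Lemma integrable_rowt n r (h : 'rV[R]_n -> R) : continuous h -> off_ball r h ->
  (lebesgue_Rn R n).-integrable setT (EFin \o fun v => h (rowt v)).
Proof.
move=> hc h0; have [C hC] := off_ball_bounded hc h0.
apply: (@integrable_bounded_support _ _ _ _ (@cube R n r) _ C).
- exact: measurable_cube.
- exact: cube_measure_fin.
- exact: measurable_rowt.
- by move=> v _; exact: hC.
- by move=> v /rowt_off_cube/h0.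
Qed.

Section Cons.
Variables (n : nat) (r : R) (h : 'rV[R]_n.+1 -> R).
Hypotheses (hc : continuous h) (h0 : off_ball r h).
Let H (z : T * n.-tuple T) := (h (consr z.1 (rowt z.2)))%:E.

Lemma integrable_consr : (lam \x lebesgue_Rn R n)%E.-integrable setT H.
Proof.
have [C hC] := off_ball_bounded hc h0.
have Dfin : ((lam \x lebesgue_Rn R n)%E (`[(- r)%R, r]%classic `*` @cube R n r) < +oo)%E.
  rewrite product_measure1E//; last exact: measurable_cube.
  rewrite lte_mul_pinfty//; last exact: cube_measure_fin.
  exact: itv_measure_fin.
apply: (@integrable_bounded_support R _ _
  [the {measure set (T * n.-tuple T) -> \bar R} of (lam \x lebesgue_Rn R n)%E]
  (`[- r, r]%classic `*` @cube R n r) (fun z => h (consr z.1 (rowt z.2))) C).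
- by apply: measurableX; [exact: measurable_itv|exact: measurable_cube].
- exact: Dfin.
- have := measurableT_comp (measurable_rowt hc) (@measurable_tuple_cons _ T n).
  by apply: eq_measurable_fun => -[x v] _ /=; rewrite rowt_cons.
- by move=> z _; exact: hC.
- move=> [x v] /= xv; apply: h0.
  have [xr|xr] := boolP (x \in `[- r, r]).
    have /rowt_off_cube/lt_le_trans : ~ cube r v by move=> vr; apply: xv.
    apply; apply: row_norm_le => // i; have := coord_norm_le (consr x (rowt v)) (lift ord0 i).
    by rewrite consrS.
  move: xr; rewrite in_itv/= -ler_norml -ltNge => /lt_le_trans; apply.
  by have := coord_norm_le (consr x (rowt v)) ord0; rewrite consr0.
Qed.

Lemma tuple_integral_prod :
  (\int[lebesgue_Rn R n.+1]_v (h (rowt v))%:E = \int[lam \x lebesgue_Rn R n]_z H z)%E.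
Proof.
have E : (fun v : n.+1.-tuple T => (h (rowt v))%:E) \o @tuple_cons _ T n = H.
  by apply/funext => -[x v] /=; rewrite rowt_cons.
have := @integral_pushforward _ _ _ _ R (@tuple_cons _ T n) (@measurable_tuple_cons _ T n)
  (lam \x lebesgue_Rn R n)%E setT (fun v : n.+1.-tuple T => (h (rowt v))%:E).
rewrite preimage_setT E => <- //.
- by apply/measurable_EFinP; exact: measurable_rowt.
- exact: integrable_consr.
Qed.

Lemma tuple_integral_xv : (\int[lebesgue_Rn R n.+1]_v (h (rowt v))%:E =
  \int[lam]_x \int[lebesgue_Rn R n]_v (h (consr x (rowt v)))%:E)%E.
Proof.
rewrite tuple_integral_prod -integral12_prod_meas1//; exact: integrable_consr.
Qed.

Lemma tuple_integral_vx : (\int[lebesgue_Rn R n.+1]_v (h (rowt v))%:E =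
  \int[lebesgue_Rn R n]_v \int[lam]_x (h (consr x (rowt v)))%:E)%E.
Proof.
rewrite tuple_integral_prod -integral21_prod_meas1//; exact: integrable_consr.
Qed.

End Cons.

Lemma integrable_line (h : R -> R) r : continuous h -> (forall x : R, r < `|x| -> h x = 0) ->
  lam.-integrable setT (EFin \o h).
Proof.
move=> hc h0.
have hE : h = h \_ `[- r, r].
  apply/funext => x; rewrite patchE; case: ifPn => //; rewrite notin_setE/= in_itv/= -ler_norml.
  by move=> /negP; rewrite -ltNge => /h0.
rewrite hE -restrict_EFin; apply/integrable_restrict => //=; rewrite setTI.
by apply: continuous_itv_integrable => x _; exact: hc.
Qed.

Lemma integral_derive0 (h dh : R -> R) r : (forall x : R, is_derive x 1 h (dh x)) ->
  continuous dh -> (forall x : R, r < `|x| -> h x = 0) ->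
  (forall x : R, r < `|x| -> dh x = 0) ->
  (\int[lam]_x (dh x)%:E = 0)%E.
Proof.
(* Strictly beyond [r], so that [h] vanishes at both end points. *)
move=> hd dhc h0 dh0; pose s := `|r| + 1.
have rs : r < s by rewrite (le_lt_trans (ler_norm r))// ltrDl.
have s0 : 0 < s by rewrite ltr_wpDl.
have ss : - s < s by lra.
have -> : (\int[lam]_x (dh x)%:E = \int[lam]_(x in `[(- s)%R, s]) (dh x)%:E)%E.
  rewrite [RHS]integral_mkcond; apply: eq_integral => x _.
  rewrite patchE; case: ifPn => //; rewrite notin_setE/= in_itv/= -ler_norml => /negP.
  by rewrite -ltNge => /(lt_trans rs)/dh0 ->.
rewrite (@continuous_FTC2 _ dh h).
- by rewrite !h0 ?normrN ?gtr0_norm// subee.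
- exact: ss.
- exact: continuous_subspaceT.
- split.
  + by move=> z _; have [] := hd z.
  + by apply: cvg_at_right_filter; exact: is_derive_continuous (hd _).
  + by apply: cvg_at_left_filter; exact: is_derive_continuous (hd _).
- by move=> z _; rewrite derive1E; have [_ ->] := hd z.
Qed.

(** Induction on the dimension. The leading coordinate is integrated innermost, where the
    fundamental theorem gives 0; for any other [i] the leading coordinate is frozen and the
    induction hypothesis applies to each slice. *)
Lemma integral_partial0 n (i : 'I_n) (h dh : 'rV[R]_n -> R) r :
  (forall q, is_derive q (delta_mx 0 i) h (dh q)) -> continuous dh ->
  off_ball r h -> off_ball r dh ->
  (\int[lebesgue_Rn R n]_v (dh (rowt v))%:E = 0)%E.
Proof.
elim: n i h dh => [[]//|n IH] i h dh hd dhc h0 dh0.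
have consr_ge x (q : 'rV[R]_n) : `|q| <= `|consr x q|.
  apply: row_norm_le => // j; have := coord_norm_le (consr x q) (lift ord0 j).
  by rewrite consrS.
case: (unliftP ord0 i) hd => [j|] -> hd.
- rewrite (tuple_integral_xv dhc dh0); rewrite (eq_integral (fun=> 0%E)) ?integral0// => x _.
  apply: (IH j (fun q => h (consr x q)) (fun q => dh (consr x q))).
  + move=> q; apply/is_derive_line0.
    rewrite (_ : (fun s => _) = fun s => h (s *: delta_mx 0 (lift ord0 j) + consr x q)); last first.
      by apply/funext => s; rewrite consr_addr.
    by apply/(is_derive_line0 h (consr x q)); exact: hd.
  + exact: consr_continuous.
  + by move=> q rq; apply: h0; exact: lt_le_trans (consr_ge _ _).
  + by move=> q rq; apply: dh0; exact: lt_le_trans (consr_ge _ _).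
- rewrite (tuple_integral_vx dhc dh0); rewrite (eq_integral (fun=> 0%E)) ?integral0// => v _.
  have consr_gex (x : R) : `|x| <= `|consr x (rowt v)|.
    by have := coord_norm_le (consr x (rowt v)) ord0; rewrite consr0.
  apply: (@integral_derive0 (fun x => h (consr x (rowt v))) (fun x => dh (consr x (rowt v))) r).
  + move=> x; have := hd (consr x (rowt v)) => /(is_derive_line0 h).
    rewrite (_ : (fun s => _) = fun s => h (consr (s + x) (rowt v))); last first.
      by apply/funext => s; rewrite consr_addl.
    move=> H; have /(is_derive_line (fun x => h (consr x (rowt v))) x (1 : R) 0) : is_derive (0 : R) 1
        (fun s : R => (fun x => h (consr x (rowt v))) (s *: 1 + x)) (dh (consr x (rowt v))).
      rewrite (_ : (fun s => _) = fun s => h (consr (s + x) (rowt v)))//.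
      by apply/funext => s; rewrite [s *: 1]mulr1.
    by rewrite scale0r add0r.
  + exact: consr_continuousl.
  + by move=> x rx; apply: h0; exact: lt_le_trans (consr_gex _).
  + by move=> x rx; apply: dh0; exact: lt_le_trans (consr_gex _).
Qed.

Lemma continuous_bigprod (V : topologicalType) (I : Type) (s : seq I) (F : I -> V -> R) :
  (forall i, continuous (F i)) -> continuous (fun q => \prod_(i <- s) F i q).
Proof.
move=> Fc; elim: s => [|i s IH].
  by under eq_fun do rewrite big_nil; move=> q; exact: cvg_cst.
by under eq_fun do rewrite big_cons; move=> q; apply: continuousM; [exact: Fc|exact: IH].
Qed.

Lemma tuple_integral_prod_coord n (th : 'I_n -> R -> R) (c : 'I_n -> R) r :
  (forall i, continuous (th i)) -> (forall i (x : R), r < `|x| -> th i x = 0) ->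
  (forall i, (\int[lam]_x (th i x)%:E = (c i)%:E)%E) ->
  (\int[lebesgue_Rn R n]_v (\prod_i th i (rowt v 0 i))%:E = (\prod_i c i)%:E)%E.
Proof.
elim: n th c => [|n IH] th c thc th0 thi.
  rewrite big_ord0; under eq_integral do rewrite big_ord0.
  by rewrite integral_cst//= diracE mem_set// mule1.
have hc : continuous (fun q : 'rV[R]_n.+1 => \prod_i th i (q 0 i)).
  apply: continuous_bigprod => i q.
  apply: (@continuous_comp _ _ _ (fun q : 'rV[R]_n.+1 => q 0 i) (th i)); last exact: thc.
  exact: coord_continuous.
have off k (t : 'I_k -> R -> R) : (forall i (x : R), r < `|x| -> t i x = 0) ->
    off_ball `|r| (fun q : 'rV[R]_k => \prod_i t i (q 0 i)).
  move=> t0 q rq; have [i ri] : exists i, r < `|q 0 i|.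
    apply: contrapT => /forallNP H; move: rq; rewrite ltNge => /negP; apply.
    apply: row_norm_le => // i; rewrite (le_trans _ (ler_norm r))//.
    by rewrite leNgt; apply/negP; exact: H.
  by rewrite (bigD1 i)//= t0// mul0r.
rewrite (tuple_integral_xv hc (off _ _ th0)).
have IHi := IH (fun i => th (lift ord0 i)) (fun i => c (lift ord0 i))
  (fun i => thc _) (fun i => th0 _) (fun i => thi _).
have E (x : T) : (\int[lebesgue_Rn R n]_v (\prod_i th i (consr x (rowt v) 0 i))%:E =
   (\prod_(i < n) c (lift ord0 i))%:E * (th ord0 x)%:E)%E.
  rewrite -IHi -integralZr//; last first.
    apply: (@integrable_rowt _ `|r| (fun q => \prod_i th (lift ord0 i) (q 0 i))).
      apply: continuous_bigprod => i q.
      apply: (@continuous_comp _ _ _ (fun q : 'rV[R]_n => q 0 i) (th _)); last exact: thc.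
      exact: coord_continuous.
    exact: (off _ (fun i => th (lift ord0 i)) (fun i => th0 _)).
  apply: eq_integral => v _; rewrite big_ord_recl consr0 -EFinM mulrC; congr (_ * _)%:E.
  by apply: eq_bigr => i _; rewrite consrS.
under eq_integral do rewrite E.
rewrite integralZl//; last first.
  exact: integrable_line (th0 _).
by rewrite thi -EFinM big_ord_recl mulrC.
Qed.

End TupleFubini.

(** * Extension of weak inequalities to C^1 test functions *)

Section Bump.
Context {R : realType}.
Local Notation T := (measurableTypeR R).
Local Notation lam := (@lebesgue_measure R).

(** $x^{-n}e^{-1/x}$ extended by 0. All powers are kept so that the derivative of a member is a
    combination of members. *)
Definition flat (n : nat) (x : R) : R :=
  if x <= 0 then 0 else x^-1 ^+ n * expR (- x^-1).

Lemma flat_ge0 n x : 0 <= flat n x.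
Proof.
rewrite /flat; case: (leP x 0) => // x0.
by rewrite mulr_ge0 ?expR_ge0// exprn_ge0// invr_ge0 ltW.
Qed.

Lemma flat_gt0 n x : 0 < x -> 0 < flat n x.
Proof.
by move=> x0; rewrite /flat leNgt x0 mulr_gt0 ?expR_gt0// exprn_gt0// invr_gt0.
Qed.

(** From $e^{y/(n+1)}\ge y/(n+1)$ with $y=1/x$, raised to the power $n+1$. The linear bound gives
    continuity at 0 for every [n] at once. *)
Lemma flat_le n x : 0 < x -> flat n x <= (n.+1)%:R ^+ n.+1 * x.
Proof.
move=> x0; rewrite /flat [x <= 0]leNgt x0 /=; set y := x^-1.
have y0 : 0 < y by rewrite invr_gt0.
rewrite -[x in leRHS]invrK -/y ler_pdivlMr// mulrAC -exprSr expRN ler_pdivrMr ?expR_gt0//.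
have n0 : (0 : R) < n.+1%:R by [].
have -> : expR y = expR (y / n.+1%:R) ^+ n.+1.
  by rewrite -expRM_natl mulrC divfK// lt0r_neq0.
rewrite -exprMn; apply: lerXn2r; rewrite ?nnegrE ?mulr_ge0 ?expR_ge0//; first exact: ltW.
by rewrite -ler_pdivrMl// mulrC (le_trans _ (expR_ge1Dx _))// lerDr ler01.
Qed.

(** Away from 0 by the rules of calculus; at 0 because every member of the family is continuous
    there, so that the formula extends. *)
Lemma flat_derive n (x : R) :
  is_derive x 1 (flat n) (flat n.+2 x - n%:R * flat n.+1 x).
Proof.
have pos (y : R) : 0 < y -> is_derive y 1 (flat n) (flat n.+2 y - n%:R * flat n.+1 y).
  move=> y0; have yn : y != 0 by rewrite gt_eqF.
  have Vd : is_derive y 1 (fun y : R => y^-1) (- y ^- 2).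
    by have := is_deriveV yn (is_derive_id y 1); rewrite [_ *: 1]mulr1.
  have ed : is_derive y 1 (fun y => expR (- y^-1)) (expR (- y^-1) * (y ^- 2)).
    have := is_deriveN Vd; rewrite opprK => Nd.
    exact: (@is_derive1_comp _ expR (fun y => - y^-1) y _ _ (is_derive_expR _) Nd).
  have := is_deriveM (is_deriveX n Vd) ed.
  rewrite exprfctE /GRing.scale/=; set d := (X in is_derive _ _ _ X -> _).
  have -> : d = flat n.+2 y - n%:R * flat n.+1 y.
    rewrite /d /flat [y <= 0]leNgt y0/= -[y ^- 2]exprVn; set z := y^-1.
    by case: (n) => [|k]; rewrite ?expr0 /= ?exprS; ring.
  apply: near_eq_is_derive.
  have : \forall z \near y, 0 < z by exact: near_gt.
  by apply: filterS => z z0; rewrite /flat [z <= 0]leNgt z0.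
have f0 m : flat m 0 = 0 by rewrite /flat lexx.
have c0 m : {for 0, continuous (flat m)}.
  rewrite /prop_for/continuous_at f0; apply/cvgrPdist_lt => e e0.
  have c_gt0 : 0 < (m.+1)%:R ^+ m.+1 :> R by rewrite exprn_gt0.
  exists (e / (m.+1)%:R ^+ m.+1); first by rewrite /= divr_gt0.
  move=> y /=; rewrite !sub0r !normrN (ger0_norm (flat_ge0 _ _)) => ye.
  have [y0|y0] := leP y 0; first by rewrite /flat y0.
  apply: (le_lt_trans (flat_le m y0)); rewrite mulrC -ltr_pdivlMr//.
  by rewrite gtr0_norm in ye.
have [x0|x0|->] := ltgtP x 0.
- rewrite /flat (ltW x0) mulr0 subr0.
  apply: near_eq_is_derive (is_derive_cst _ _ _); near=> z.
  rewrite /flat ifT//; apply: ltW; near: z; exact: near_lt.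
- exact: pos.
- apply: (@is_derive_extend _ (flat n) (fun x => flat n.+2 x - n%:R * flat n.+1 x)).
  + exact: c0.
  + move=> y; rewrite neq_lt => /orP[y0|]; last exact: pos.
    rewrite /flat (ltW y0) mulr0 subr0.
    apply: near_eq_is_derive (is_derive_cst _ _ _); near=> z.
    rewrite /flat ifT//; apply: ltW; near: z; exact: near_lt.
  + by apply: cvgB; [exact: c0|apply: cvgM; [exact: cvg_cst|exact: c0]].
Unshelve. all: by end_near. Qed.

(* Closed under differentiation, whence smoothness of its members. *)
Inductive bump_alg : (R -> R) -> Prop :=
| bump_flat n (a b : R) : bump_alg (fun x => flat n (a * x + b))
| bump_cst (c : R) : bump_alg (fun=> c)
| bump_add f g : bump_alg f -> bump_alg g -> bump_alg (fun x => f x + g x)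
| bump_mul f g : bump_alg f -> bump_alg g -> bump_alg (fun x => f x * g x).

Lemma bump_alg_derive f : bump_alg f ->
  exists2 f', bump_alg f' & forall x : R, is_derive x 1 f (f' x).
Proof.
elim=> [n a b|c|{}f g fA [f' fA' fd] gA [g' gA' gd]|{}f g fA [f' fA' fd] gA [g' gA' gd]].
- exists (fun x => (flat n.+2 (a * x + b) + (- n%:R) * flat n.+1 (a * x + b)) * a).
    by do ?[apply: bump_mul|apply: bump_add|apply: bump_flat|apply: bump_cst].
  move=> x; have ad : is_derive x 1 (fun x : R => a * x + b) a.
    have H : is_derive x 1 (a \*: (@id R) + cst b) (a *: 1 + 0) by apply: is_deriveD.
    by rewrite addr0 [a *: 1]mulr1 in H.
  have := @is_derive1_comp _ (flat n) (fun x => a * x + b) x _ _ (flat_derive n _) ad.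
  by rewrite mulNr.
- by exists (fun=> 0); [exact: bump_cst|move=> x; exact: is_derive_cst].
- exists (fun x => f' x + g' x); first exact: bump_add.
  by move=> x; exact: is_deriveD.
- exists (fun x => f x * g' x + g x * f' x).
    by apply: bump_add; exact: bump_mul.
  by move=> x; exact: is_deriveM.
Qed.

Lemma bump_alg_continuous f : bump_alg f -> continuous f.
Proof. by move=> /bump_alg_derive[f' _ fd] x; exact: is_derive_continuous (fd x). Qed.

Lemma is_derive_prod_coord n (th : 'I_n -> R -> R) (i : 'I_n) (q : 'rV[R]_n) d :
  is_derive (q 0 i) 1 (th i) d ->
  is_derive q (delta_mx 0 i) (fun q => \prod_j th j (q 0 j))
    (d * \prod_(j | j != i) th j (q 0 j)).
Proof.
move=> td; apply/is_derive_line0.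
set P := \prod_(j | j != i) _.
rewrite (_ : (fun s => _) = fun s : R => th i (s + q 0 i) * P); last first.
  apply/funext => s; rewrite (bigD1 i)//= !mxE !eqxx/= mulr1; congr (_ * _).
  by apply: eq_bigr => j ji; rewrite !mxE eqxx/= (negPf ji) mulr0 add0r.
have sd : is_derive (0 : R) 1 (fun s : R => s + q 0 i) 1.
  by rewrite -[X in is_derive _ _ _ X]addr0; exact: is_deriveD.
have td' : is_derive ((fun s : R => s + q 0 i) 0) 1 (th i) d by rewrite add0r.
have := @is_derive1_comp _ (th i) _ 0 _ _ td' sd; rewrite mulr1 => td1.
have := is_deriveZ P td1; rewrite [P *: d]mulrC.
by rewrite (_ : _ \*: _ = fun s : R => th i (s + q 0 i) * P)//; apply/funext => s; rewrite mulrC.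
Qed.

Lemma prod_coord_continuous n (th : 'I_n -> R -> R) : (forall i, continuous (th i)) ->
  continuous (fun q : 'rV[R]_n => \prod_j th j (q 0 j)).
Proof.
move=> thc; apply: continuous_bigprod => i q.
apply: (@continuous_comp _ _ _ (fun q : 'rV[R]_n => q 0 i) (th i)); last exact: thc.
exact: coord_continuous.
Qed.

(** A partial derivative replaces one factor by its derivative, again in [bump_alg]; the class of
    products is stable and induction on [k] closes. *)
Lemma prod_bump_Ck n k (th : 'I_n -> R -> R) : (forall i, bump_alg (th i)) ->
  Ck k (fun q : 'rV[R]_n => \prod_j th j (q 0 j)).
Proof.
elim: k th => [|k IH] th thA; (split; first by
  apply: prod_coord_continuous => i; exact: bump_alg_continuous) => //.
have H i : exists2 th', (forall j, bump_alg (th' j)) & forall q,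
    is_derive q (delta_mx 0 i) (fun q : 'rV[R]_n => \prod_j th j (q 0 j))
     (\prod_j th' j (q 0 j)).
  have [t tA td] := bump_alg_derive (thA i).
  exists (fun j => if j == i then t else th j) => [j|q]; first by case: ifP.
  have := is_derive_prod_coord (td (q 0 i)).
  rewrite [in X in _ -> X](bigD1 i)//= eqxx.
  rewrite (eq_bigr (fun j => (if j == i then t else th j) (q 0 j)))// => j ji.
  by rewrite (negPf ji).
split=> i; have [th' thA' thd] := H i; first by move=> q; have [] := thd q.
rewrite (_ : partial i _ = fun q => \prod_j th' j (q 0 j)); first exact: IH.
by apply/funext => q; have [_] := thd q.
Qed.

(** A bump supported in $[-1,1]$. It is not normalised: the mass of the product kernel is a positive
    constant that divides out of the final inequality. *)
Definition moll (s : R) : R := flat 0 (1 + s) * flat 0 (1 - s).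

Lemma moll_ge0 s : 0 <= moll s.
Proof. by rewrite mulr_ge0 ?flat_ge0. Qed.

Lemma moll_eq0 s : 1 <= `|s| -> moll s = 0.
Proof.
rewrite ler_normr /moll /flat => /orP[s1|s1].
  have E : 1 - s <= 0 by lra.
  by rewrite E mulr0.
have E : 1 + s <= 0 by lra.
by rewrite E mul0r.
Qed.

Lemma moll_affine (a b : R) : bump_alg (fun x => moll (a * x + b)).
Proof.
rewrite (_ : (fun x => _) = fun x => flat 0 (a * x + (1 + b)) * flat 0 ((- a) * x + (1 - b))).
  by apply: bump_mul; exact: bump_flat.
by apply/funext => x; rewrite /moll; congr (flat _ _ * flat _ _); ring.
Qed.

End Bump.

(** * The smoothing kernel and its mass *)

Section Density.
Context {R : realType}.
Local Notation T := (measurableTypeR R).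
Local Notation lam := (@lebesgue_measure R).

Lemma flat0_le (x y : R) : 0 < x -> x <= y -> flat 0 x <= flat 0 y.
Proof.
move=> x0 xy; have y0 := lt_le_trans x0 xy.
rewrite /flat [x <= 0]leNgt [y <= 0]leNgt x0 y0 /= !mul1r ler_expR lerN2.
by rewrite lef_pV2.
Qed.

Lemma itv_measure_gt0 (r : R) : 0 < r -> (0 < lam `[(- r)%R, r])%E.
Proof.
move=> r0; rewrite lebesgue_measure_itv/= lte_fin ifT; last by lra.
by rewrite -EFinD lte_fin; lra.
Qed.

Lemma integral_gt0 d (X : measurableType d) (mu : {measure set X -> \bar R})
    (D : set X) (h : X -> R) (k : R) : measurable D -> (0 < mu D)%E ->
  measurable_fun setT h -> (forall x, 0 <= h x) -> 0 < k -> (forall x, D x -> k <= h x) ->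
  (0 < \int[mu]_x (h x)%:E)%E.
Proof.
move=> mD Dp mh h0 k0 kh; apply: (@lt_le_trans _ _ (k%:E * mu D)%E).
  by rewrite mule_gt0.
rewrite -integral_cst//; apply: (@le_trans _ _ (\int[mu]_(x in D) (h x)%:E)%E).
  apply: ge0_le_integral => //.
  - by move=> x _; rewrite lee_fin ltW.
  - by apply/measurable_EFinP; exact: measurable_funTS.
apply: ge0_subset_integral => //; first exact/measurable_EFinP.
by move=> x _; rewrite lee_fin.
Qed.

Lemma moll_continuous : continuous (@moll R).
Proof.
have H : continuous (fun x : R => moll (1 * x + 0)) := bump_alg_continuous (moll_affine _ _).
by rewrite (_ : (fun x => _) = @moll R) in H => //; apply/funext => x; rewrite mul1r addr0.
Qed.

Lemma moll_derive : exists2 db : R -> R, continuous db &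
  (forall s : R, is_derive s 1 (@moll R) (db s)) /\ (forall s : R, 1 < `|s| -> db s = 0).
Proof.
have [db dA dd] := bump_alg_derive (moll_affine (1 : R) 0).
have E : (fun x => moll (1 * x + 0)) = @moll R.
  by apply/funext => x; rewrite mul1r addr0.
rewrite E in dd; exists db; first exact: bump_alg_continuous.
split=> // s s1; have [_ <-] := dd s.
have H : is_derive s 1 (@moll R) 0.
  apply: near_eq_is_derive (is_derive_cst (0 : R) s 1).
  have : \forall z \near s, 1 < `|z|.
    by move: s1; rewrite ltr_normr => /orP[s1|s1];
      [move/near_gt: s1|have /near_lt : s < -1 by lra]; apply: filterS => z z1;
      rewrite ltr_normr ?z1// ltrNr z1 orbT.
  by apply: filterS => z z1; rewrite moll_eq0// ltW.
by have [_] := H.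
Qed.

(* The integral does not depend on [x]: a difference of two translates is the
   derivative of a compactly supported function. *)
Lemma moll_integral (a : R) : 0 < a -> exists2 c : R, 0 < c &
  forall x : R, (\int[lam]_y (moll (a * (x - y)))%:E = c%:E)%E.
Proof.
move=> a0.
have bc (x : R) : continuous (fun y : R => moll (a * (x - y))).
  move=> y; apply: (@continuous_comp _ _ _ (fun y : R => a * (x - y)) (@moll R)).
    by apply: cvgM; [exact: cvg_cst|apply: cvgB; [exact: cvg_cst|exact: cvg_id]].
  exact: moll_continuous.
have b0 (x y : R) : `|x| + a^-1 < `|y| -> moll (a * (x - y)) = 0.
  move=> xy; apply: moll_eq0; rewrite normrM gtr0_norm// -ler_pdivrMl// mulr1.
  have := ler_normD (y - x) x; rewrite subrK (distrC y x); lra.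
have bi x := integrable_line (bc x) (b0 x).
(* An antiderivative of the bump, constant on each side of $[-1,1]$; the difference of two of its
   translates therefore vanishes far out on both sides. *)
pose Gm (t : R) := \int[lam]_(s in `[(-2 : R), t]) moll s.
have Gd (t : R) : is_derive t 1 Gm (moll t).
  have [t1|t1] := ltP t (- 1).
    rewrite moll_eq0; last by rewrite ler_normr; apply/orP; right; lra.
    apply: near_eq_is_derive (is_derive_cst (0 : R) t 1).
    have : \forall z \near t, z < -1 by exact: near_lt.
    apply: filterS => z z1; rewrite /Gm /=.
    transitivity (\int[lam]_(s in `[(-2 : R), z]) (0 : R)); first by rewrite Rintegral_cst// mul0r.
    apply: eq_Rintegral => s; rewrite inE/= in_itv/= => /andP[_ sz]; rewrite moll_eq0//.
    by rewrite ler_normr; apply/orP; right; lra.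
  apply: is_derive_primitive => [x _|]; first exact: moll_continuous.
  by lra.
have Gcst (s t : R) : s < t -> (forall z : R, s < z < t -> moll z = 0) -> Gm s = Gm t.
  move=> st Z; have Gd' z : s < z < t -> is_derive z 1 Gm (moll z) by move=> _; exact: Gd.
  have [c /Z cst] := MVT_oo st Gd' (is_derive_continuous (Gd _)) (is_derive_continuous (Gd _)).
  by rewrite cst mul0r => /eqP; rewrite subr_eq0 => /eqP.
have Ghigh (s t : R) : 1 < s -> 1 < t -> Gm s = Gm t.
  move=> s1 t1; have [st|st|->//] := ltgtP s t.
    by apply: Gcst => // z /andP[sz _]; rewrite moll_eq0// ler_normr; apply/orP; left; lra.
  by apply/esym/Gcst => // z /andP[sz _]; rewrite moll_eq0// ler_normr; apply/orP; left; lra.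
have Glow (s t : R) : s < -1 -> t < -1 -> Gm s = Gm t.
  move=> s1 t1; have [st|st|->//] := ltgtP s t.
    by apply: Gcst => // z /andP[_ sz]; rewrite moll_eq0// ler_normr; apply/orP; right; lra.
  by apply/esym/Gcst => // z /andP[_ sz]; rewrite moll_eq0// ler_normr; apply/orP; right; lra.
have inv (x : R) : (\int[lam]_y (moll (a * (x - y)))%:E = \int[lam]_y (moll (a * (0 - y)))%:E)%E.
  have : (\int[lam]_y (moll (a * (x - y)) - moll (a * (0 - y)))%:E = 0)%E.
    apply: (@integral_derive0 _ (fun y => - a^-1 * (Gm (a * (x - y)) - Gm (a * (0 - y))))
       (fun y => moll (a * (x - y)) - moll (a * (0 - y))) (`|x| + 2 * a^-1)).
    - move=> y.
      have ld (z : R) : is_derive y 1 (fun y : R => a * (z - y)) (- a).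
        have H : is_derive y 1 (a \*: (cst z - @id R)) (a *: (0 - 1)) by apply: is_deriveZ.
        by rewrite sub0r [a *: -1]mulrN1 in H.
      have d1 (z : R) := @is_derive1_comp _ Gm (fun y => a * (z - y)) y _ _ (Gd _) (ld z).
      have := is_deriveZ (- a^-1) (is_deriveB (d1 x) (d1 0)).
      set d := (X in is_derive _ _ _ X -> _); rewrite (_ : d = moll (a * (x - y)) - moll (a * (0 - y)))//.
      by rewrite /d /GRing.scale/=; field; rewrite gt_eqF.
    - by move=> y; apply: cvgB; exact: bc.
    - move=> y xy; suff -> : Gm (a * (x - y)) = Gm (a * (0 - y)) by rewrite subrr mulr0.
      have aV : 0 < a^-1 by rewrite invr_gt0.
      have := ler_norm x; have := ler_norm (- x); rewrite normrN => x1 x2.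
      move: xy; rewrite ltr_normr => /orP[xy|xy].
        apply: Glow; rewrite mulrC -ltr_pdivlMr// mulN1r; lra.
      by apply: Ghigh; rewrite mulrC -ltr_pdivrMr// mul1r; lra.
    - move=> y xy; have aV : 0 < a^-1 by rewrite invr_gt0.
      rewrite !b0 ?subrr//; first by rewrite normr0; have := normr_ge0 x; lra.
      by lra.
  under eq_integral do rewrite EFinB.
  rewrite (integralB measurableT (bi x) (bi 0))/= => /eqP; rewrite sube_eq ?add0e; last 2 first.
  - exact: (integrable_fin_num measurableT (bi x)).
  - apply: fin_num_adde_defl; exact: (integrable_fin_num measurableT (bi 0)).
  by move=> /eqP.
have ifin := integrable_fin_num measurableT (bi 0).
exists (fine (\int[lam]_y (moll (a * (0 - y)))%:E)); last first.
  by move=> x; rewrite inv fineK.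
apply: fine_gt0; apply/andP; split; last by rewrite ltey_eq ifin.
(* For $|y|\le 1/(2a)$ both arguments $1\pm ay$ are at least 1/2, which bounds the bump below. *)
apply: (@integral_gt0 _ _ lam `[- (2 * a)^-1, (2 * a)^-1] _ (flat 0 (1 / 2) * flat 0 (1 / 2))).
- exact: measurable_itv.
- have aV : 0 < (2 * a)^-1 by rewrite invr_gt0 mulr_gt0.
  exact: itv_measure_gt0.
- exact: continuous_measurable_fun.
- by move=> y; exact: moll_ge0.
- by rewrite mulr_gt0 ?flat_gt0.
- move=> y /=; rewrite in_itv/= -ler_norml => ya; rewrite sub0r mulrN.
  have : `|a * y| <= 1 / 2.
    by rewrite normrM gtr0_norm// -ler_pdivlMl// mul1r -invfM mulrC.
  rewrite ler_norml => /andP[y1 y2]; rewrite /moll.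
  by apply: ler_pM; rewrite ?flat_ge0//; apply: flat0_le; lra.
Qed.

Lemma partial_off_ball n (i : 'I_n) (h : 'rV[R]_n -> R) r : off_ball r h ->
  off_ball r (partial i h).
Proof.
move=> h0 q rq.
have H : is_derive q (delta_mx 0 i) h 0.
  apply: near_eq_is_derive (is_derive_cst (0 : R) q (delta_mx 0 i)).
  have qr : 0 < `|q| - r by rewrite subr_gt0.
  apply/nbhs_normP; exists (`|q| - r) => // q' /= qq'; rewrite h0//.
  by have := lerB_dist q q'; lra.
by have [_] := H.
Qed.

Lemma Ck1_derive n (h : 'rV[R]_n -> R) : Ck 1 h ->
  [/\ continuous h, forall i, continuous (partial i h) &
  forall i q, is_derive q (delta_mx 0 i) h (partial i h q)].
Proof.
move=> [hc [hd hp]]; split => //; first by move=> i; have [] := hp i.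
Qed.

Section Kernel.
Variables (n : nat) (a : R).
Hypothesis a1 : 1 <= a.
Variable db : R -> R.
Hypothesis dbc : continuous db.
Hypothesis dbd : forall s : R, is_derive s 1 (@moll R) (db s).
Hypothesis db0 : forall s : R, 1 < `|s| -> db s = 0.

Let a0 : 0 < a. Proof. exact: lt_le_trans a1. Qed.

Let th (x : R) (s : R) := moll (a * (s - x)).
Definition kern (q y : 'rV[R]_n) := \prod_j moll (a * (q 0 j - y 0 j)).
Definition dkern (i : 'I_n) (q y : 'rV[R]_n) :=
  a * db (a * (q 0 i - y 0 i)) * \prod_(j | j != i) moll (a * (q 0 j - y 0 j)).

Let affd (c b s : R) : is_derive s 1 (fun s : R => c * s + b) c.
Proof.
have H : is_derive s 1 (c \*: (@id R) + cst b) (c *: 1 + 0) by apply: is_deriveD.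
by rewrite addr0 [c *: 1]mulr1 in H.
Qed.

Lemma kern_derivel i (q y : 'rV[R]_n) :
  is_derive q (delta_mx 0 i) (kern ^~ y) (dkern i q y).
Proof.
apply: (@is_derive_prod_coord _ _ (fun j s => moll (a * (s - y 0 j)))).
have H := affd a (- (a * y 0 i)) (q 0 i).
have := @is_derive1_comp _ (@moll R) (fun s => a * s + - (a * y 0 i)) (q 0 i) _ _ (dbd _) H.
rewrite (_ : moll \o _ = fun s => moll (a * (s - y 0 i))); last first.
  by apply/funext => s /=; congr moll; ring.
by rewrite mulrC mulrBr.
Qed.

(** The kernel depends on [q - y], so its derivatives in the two variables are opposite; this is
    what moves a derivative from the kernel onto the function being smoothed. *)
Lemma kern_deriver i (q y : 'rV[R]_n) :
  is_derive y (delta_mx 0 i) (kern q) (- dkern i q y).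
Proof.
rewrite /dkern -mulNr.
apply: (@is_derive_prod_coord _ _ (fun j s => moll (a * (q 0 j - s)))).
have H := affd (- a) (a * q 0 i) (y 0 i).
have := @is_derive1_comp _ (@moll R) (fun s => - a * s + a * q 0 i) (y 0 i) _ _ (dbd _) H.
rewrite (_ : - a * y 0 i + a * q 0 i = a * (q 0 i - y 0 i)); last by ring.
rewrite (_ : moll \o _ = fun s => moll (a * (q 0 i - s))); last first.
  by apply/funext => s /=; congr moll; ring.
by rewrite mulrN [_ * a]mulrC.
Qed.

Lemma kern_ge0 q y : 0 <= kern q y.
Proof. by apply: prodr_ge0 => i _; exact: moll_ge0. Qed.

Lemma far_coord (q y : 'rV[R]_n) : a^-1 < `|q - y| -> exists i, 1 < `|a * (q 0 i - y 0 i)|.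
Proof.
move=> qy; apply: contrapT => /forallNP H; move: qy; rewrite ltNge => /negP; apply.
apply: row_norm_le => [|i]; first by rewrite invr_ge0 ltW.
rewrite !mxE -[a^-1]mulr1 ler_pdivlMl// -(gtr0_norm a0) -normrM leNgt.
exact/negP/H.
Qed.

Lemma kern_far (q y : 'rV[R]_n) : a^-1 < `|q - y| -> kern q y = 0.
Proof.
move=> /far_coord[i qy]; rewrite /kern (bigD1 i)//= moll_eq0 ?mul0r//.
exact: ltW.
Qed.

Lemma dkern_far i (q y : 'rV[R]_n) : a^-1 < `|q - y| -> dkern i q y = 0.
Proof.
move=> /far_coord[j qy]; rewrite /dkern; have [<-|ji] := eqVneq j i.
  by rewrite db0// mulr0 mul0r.
by rewrite (bigD1 j)//= moll_eq0 ?ltW// mul0r mulr0.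
Qed.

Let mollc (c b : R) : continuous (fun s : R => moll (c * s + b)).
Proof. exact: (bump_alg_continuous (moll_affine c b)). Qed.

Let mollcB (x : R) : continuous (fun s : R => moll (a * (x - s))).
Proof.
rewrite (_ : (fun s => _) = fun s => moll (- a * s + a * x)); first exact: mollc.
by apply/funext => s; congr moll; ring.
Qed.

Lemma kern_continuous q : continuous (kern q).
Proof. exact: (@prod_coord_continuous _ _ (fun i s => moll (a * (q 0 i - s)))). Qed.

Let dbcB (x : R) : continuous (fun s : R => a * db (a * (x - s))).
Proof.
move=> s; apply: cvgM; first exact: cvg_cst.
apply: (@continuous_comp _ _ _ (fun y : R => a * (x - y)) db); last exact: dbc.
by apply: cvgM; [exact: cvg_cst|apply: cvgB; [exact: cvg_cst|exact: cvg_id]].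
Qed.

Lemma dkernE i q y : dkern i q y = \prod_j
  (if j == i then a * db (a * (q 0 j - y 0 j)) else moll (a * (q 0 j - y 0 j))).
Proof.
rewrite (bigD1 i)//= eqxx; congr (_ * _); apply: eq_bigr => j ji.
by rewrite (negPf ji).
Qed.

Lemma dkern_continuous i q : continuous (dkern i q).
Proof.
rewrite (_ : dkern i q = fun y => \prod_j (fun j s =>
   if j == i then a * db (a * (q 0 j - s)) else moll (a * (q 0 j - s))) j (y 0 j)).
  apply: (@prod_coord_continuous _ _ (fun j s =>
    if j == i then a * db (a * (q 0 j - s)) else moll (a * (q 0 j - s)))) => j.
  by case: (j == i); [exact: dbcB|exact: mollcB].
by apply/funext => y; exact: dkernE.
Qed.

Lemma kern_bounded : exists2 B : R, 0 < B &
  forall q y, `|kern q y| <= B /\ forall i, `|dkern i q y| <= B.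
Proof.
have bd (h : R -> R) : continuous h -> (forall s : R, 1 < `|s| -> h s = 0) ->
    exists2 B : R, 1 <= B & forall s, `|h s| <= B.
  move=> hc h0.
  have n11 : (-1 : R) <= 1 by lra.
  have cn : {within `[(-1 : R), 1], continuous (fun s => `|h s|)}.
    apply: continuous_subspaceT => s.
    by apply: (@continuous_comp _ _ _ h (fun x : R => `|x|)); [exact: hc|exact: norm_continuous].
  have [c _ cm] := EVT_max n11 cn.
  exists (Num.max 1 `|h c|) => [|s]; first by rewrite le_max lexx.
  have [s1|s1] := leP `|s| 1; last by rewrite h0// normr0 le_max ler01.
  by rewrite le_max cm ?orbT// in_itv/= -ler_norml.
have [B1 B11 HB1] := bd _ moll_continuous (fun s s1 => moll_eq0 (ltW s1)).
have adbc : continuous (fun s => a * db s).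
  by move=> s; apply: cvgM; [exact: cvg_cst|exact: dbc].
have adb0 (s : R) : 1 < `|s| -> a * db s = 0 by move=> s1; rewrite db0// mulr0.
have [B2 B21 HB2] := bd _ adbc adb0.
pose B := Num.max B1 B2.
have BB (t : 'I_n -> R) : (forall j, `|t j| <= B) -> `|\prod_j t j| <= B ^+ n.
  move=> tB; rewrite normr_prod; apply: (@le_trans _ _ (\prod_(j < n) B)).
    by apply: ler_prod => j _; rewrite normr_ge0 tB.
  by rewrite prodr_const card_ord.
exists (B ^+ n); first by rewrite exprn_gt0// lt_max (lt_le_trans ltr01 B11).
move=> q y; split=> [|i]; first by apply: BB => j; rewrite le_max HB1.
rewrite dkernE; apply: BB => j; case: ifP => _; first by rewrite le_max HB2 orbT.
by rewrite le_max HB1.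
Qed.

Lemma measurable_prod_diff (t : 'I_n -> R -> R) : (forall j, continuous (t j)) ->
  measurable_fun setT (fun z : n.-tuple T * n.-tuple T =>
    \prod_j t j (rowt z.1 0 j - rowt z.2 0 j)).
Proof.
move=> tc; apply: measurable_prod => j _.
apply: (@measurableT_comp _ _ _ _ _ _ (t j)); first exact: continuous_measurable_fun.
apply: measurable_funB.
- rewrite (_ : (fun _ => _) = (fun v : n.-tuple T => tnth v j) \o fst); last first.
    by apply/funext => z; rewrite /= mxE.
  by apply: measurableT_comp => //; exact: measurable_tnth.
- rewrite (_ : (fun _ => _) = (fun v : n.-tuple T => tnth v j) \o snd); last first.
    by apply/funext => z; rewrite /= mxE.
  by apply: measurableT_comp => //; exact: measurable_tnth.
Qed.

Lemma measurable_kern : measurable_fun setT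
  (fun z : n.-tuple T * n.-tuple T => kern (rowt z.1) (rowt z.2)).
Proof.
apply: (@measurable_prod_diff (fun _ s => moll (a * s))) => _.
rewrite (_ : (fun s => moll (a * s)) = fun s => moll (a * s + 0)); first exact: mollc.
by apply/funext => z; rewrite addr0.
Qed.

Lemma measurable_dkern i : measurable_fun setT
  (fun z : n.-tuple T * n.-tuple T => dkern i (rowt z.1) (rowt z.2)).
Proof.
rewrite (_ : (fun z => _) = fun z : n.-tuple T * n.-tuple T => \prod_j
  (fun j s => if j == i then a * db (a * s) else moll (a * s)) j (rowt z.1 0 j - rowt z.2 0 j)).
  apply: (@measurable_prod_diff (fun j s => if j == i then a * db (a * s) else moll (a * s))) => j.
  have ac : continuous (fun s : R => a * s) by move=> s; apply: cvgM; [exact: cvg_cst|exact: cvg_id].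
  case: (j == i) => s.
    apply: cvgM; first exact: cvg_cst.
    by apply: (@continuous_comp _ _ _ (fun y : R => a * y) db); [exact: ac|exact: dbc].
  apply: (@continuous_comp _ _ _ (fun y : R => a * y) (@moll R)); first exact: ac.
  exact: moll_continuous.
by apply/funext => z; rewrite dkernE.
Qed.

Lemma kern_test (y : 'rV[R]_n) : test_function (kern ^~ y).
Proof.
split=> [k|].
  apply: (@prod_bump_Ck _ _ k (fun j s => moll (a * (s - y 0 j)))) => j.
  rewrite (_ : (fun s => _) = fun s => moll (a * s + - (a * y 0 j))); first exact: moll_affine.
  by apply/funext => s; rewrite mulrBr.
apply: bounded_closed_compact; last exact: closed_closure.
exists (`|y| + a^-1); split; first exact: num_real.
move=> x rx; rewrite /globally closureEbigcap => q H.
apply: (H [set z : 'rV[R]_n | `|z| <= x]); split.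
  exact: closed_norm_le.
move=> z /= kz; rewrite (le_trans _ (ltW rx))//.
rewrite leNgt; apply: contra kz => yz; rewrite kern_far//.
by have := lerB_dist z y; lra.
Qed.

Lemma kern_integral : exists2 Z : R, 0 < Z &
  forall q : 'rV[R]_n, (\int[lebesgue_Rn R n]_v (kern q (rowt v))%:E = Z%:E)%E.
Proof.
have [c c0 cE] := moll_integral a0.
exists (c ^+ n); first by rewrite exprn_gt0.
move=> q; have -> : c ^+ n = \prod_(i < n) c by rewrite prodr_const card_ord.
apply: (@tuple_integral_prod_coord _ n (fun i s => moll (a * (q 0 i - s))) _ (`|q| + 1)) => //.
move=> i x qx; apply: moll_eq0; rewrite normrM gtr0_norm//.
have : 1 <= `|q 0 i - x|.
  have := coord_norm_le q i; have := ler_normD (x - q 0 i) (q 0 i).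
  by rewrite subrK (distrC x); lra.
by move=> H; rewrite -[1]mulr1; apply: ler_pM.
Qed.

End Kernel.

End Density.

(** * Passage from smooth to $C^1$ test functions *)

Section DensityMain.
Context {R : realType}.
Local Notation T := (measurableTypeR R).
Local Notation lam := (@lebesgue_measure R).

Lemma integral_le0 d (X : measurableType d) (mu : {measure set X -> \bar R})
    (f : X -> \bar R) : (forall x, f x <= 0)%E -> (\int[mu]_x f x <= 0)%E.
Proof.
move=> f0; rewrite (eq_integral (fun x => - (- f x))%E); last by move=> x _; rewrite oppeK.
rewrite integral_ge0N; last by move=> x _; rewrite leeNr oppe0.
by rewrite leeNl oppe0; apply: integral_ge0 => x _; rewrite leeNr oppe0.
Qed.

Lemma uniformly_continuous n r (h : 'rV[R]_n -> R) : continuous h -> off_ball r h ->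
  forall e : R, 0 < e -> exists2 d : R, 0 < d &
    forall q q', `|q - q'| < d -> `|h q - h q'| <= e.
Proof.
move=> hc h0 e e0.
pose K := [set q : 'rV[R]_n | `|q| <= r + 1].
have cK : compact K.
  apply: bounded_closed_compact; last exact: closed_norm_le.
  by exists (r + 1); split; [exact: num_real|move=> x rx q /= /le_trans; apply; exact: ltW].
pose P (d : R) (q : 'rV[R]_n) := forall q', `|q - q'| < d -> `|h q - h q'| <= e.
have nc : near_covering K by apply/compact_near_coveringP.
have H : \forall d \near (0 : R)^'+, K `<=` P d.
  apply: nc => x Kx; have e2 : 0 < e / 2 by rewrite divr_gt0.
  have /continuousPe/(_ _ e2)[d d0 Hd] := hc x.
  have d2 : 0 < d / 2 by rewrite divr_gt0.
  have nx : \forall x' \near x, `|x - x'| < d / 2.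
    by apply/nbhs_normP; exists (d / 2).
  near=> x' d' => q' /= xq'.
  have xx' : `|x - x'| < d / 2 by near: x'; exact: nx.
  have dd' : d' < d / 2 by near: d'; exact: nbhs_right_lt.
  have h1 : `|h x - h x'| < e / 2 by apply: Hd; lra.
  have h2 : `|h x - h q'| < e / 2.
    apply: Hd; have := ler_normD (x - x') (x' - q'); rewrite addrA subrK.
    by move=> H; apply: (le_lt_trans H); lra.
  have := ler_normD (h x' - h x) (h x - h q'); rewrite addrA subrK (distrC (h x') (h x)).
  by lra.
have [d [d0 Hd]] : exists d : R, 0 < d /\ K `<=` P d.
  near (0 : R)^'+ => d; exists d; split; last by near: d.
  by near: d; exact: nbhs_right_gt.
exists (Num.min d 1) => [|q q' qq']; first by rewrite lt_min d0 ltr01.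
have [Kq|Kq] := leP `|q| (r + 1).
  by apply: (Hd _ Kq); rewrite (lt_le_trans qq')// ge_min lexx.
have q1 : `|q - q'| < 1 by rewrite (lt_le_trans qq')// ge_min lexx orbT.
have := lerB_dist q q' => H'.
by rewrite !h0 ?subrr ?normr0 ?(ltW e0)//; lra.
Unshelve. all: by end_near. Qed.

Variables (n : nat) (A : 'I_n -> 'rV[R]_n -> R) (b : 'rV[R]_n -> R).
Hypothesis mA : forall i, measurable_fun setT (fun v : n.-tuple T => A i (rowt v)).
Hypothesis mb : measurable_fun setT (fun v : n.-tuple T => b (rowt v)).
Hypothesis Ab_bounded : forall r : R, exists2 C : R, 0 <= C & forall q, `|q| <= r ->
  (forall i, `|A i q| <= C) /\ `|b q| <= C.

(** The integrand is linear in the test function [z]; the solution enters through the coefficients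
    [A] (its flux) and [b] (the right-hand side), of which only measurability and local boundedness
    are used. *)
Definition weak_form (z : 'rV[R]_n -> R) (q : 'rV[R]_n) : R :=
  \sum_i A i q * partial i z q + b q * z q.

Hypothesis weak : forall rho : 'rV[R]_n -> R, test_function rho ->
  (forall q, 0 <= rho q) -> Rn_integral (weak_form rho) <= 0.

Lemma weak_form_bounded z r : Ck 1 z -> off_ball r z ->
  exists2 C : R, 0 <= C & forall q, `|weak_form z q| <= C.
Proof.
move=> /Ck1_derive[zc pzc zd] z0.
have [C C0 HC] := Ab_bounded r.
have [Cz HCz] := off_ball_bounded zc z0.
have /choice[Cp HCp] i := off_ball_bounded (pzc i) (partial_off_ball i z0).
pose B := \sum_i C * `|Cp i| + C * `|Cz|.
have B0 : 0 <= B.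
  by rewrite addr_ge0// ?mulr_ge0// sumr_ge0// => i _; rewrite mulr_ge0.
exists B => // q; have [qr|qr] := leP `|q| r; last first.
  rewrite /weak_form z0// mulr0 addr0 big1 ?normr0// => i _.
  by rewrite (partial_off_ball i z0)// mulr0.
have [HA Hb] := HC _ qr.
rewrite (le_trans (ler_normD _ _))// lerD//.
  rewrite (le_trans (ler_norm_sum _ _ _))//; apply: ler_sum => i _.
  rewrite normrM; apply: ler_pM => //.
  by rewrite (le_trans (HCp i q))// ler_norm.
by rewrite normrM; apply: ler_pM => //; rewrite (le_trans (HCz q))// ler_norm.
Qed.

Lemma weak_form_off z r : off_ball r z -> off_ball r (weak_form z).
Proof.
move=> z0 q rq; rewrite /weak_form z0// mulr0 addr0 big1// => i _.
by rewrite (partial_off_ball i z0)// mulr0.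
Qed.

Lemma weak_form_measurable z : Ck 1 z ->
  measurable_fun setT (fun v : n.-tuple T => weak_form z (rowt v)).
Proof.
move=> /Ck1_derive[zc pzc zd]; apply: measurable_funD.
  by apply: measurable_sum => i; apply: measurable_funM => //; exact: measurable_rowt.
by apply: measurable_funM => //; exact: measurable_rowt.
Qed.

Lemma weak_form_integrable z r : Ck 1 z -> off_ball r z ->
  (lebesgue_Rn R n).-integrable setT (EFin \o fun v => weak_form z (rowt v)).
Proof.
move=> z1 z0; have [C C0 HC] := weak_form_bounded z1 z0.
apply: (@integrable_bounded_support _ _ _ _ (@cube R n r) _ C).
- exact: measurable_cube.
- exact: cube_measure_fin.
- exact: weak_form_measurable.
- by move=> v _; exact: HC.
- by move=> v /rowt_off_cube; exact: weak_form_off.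
Qed.

Section Approx.
Variables (r : R) (z : 'rV[R]_n -> R).
Hypothesis r_ge0 : 0 <= r.
Hypotheses (z1 : Ck 1 z) (z0 : off_ball r z) (z_ge0 : forall q, 0 <= z q).
Variable a : R.
Hypothesis a1 : 1 <= a.
Variable db : R -> R.
Hypothesis dbc : continuous db.
Hypothesis dbd : forall s : R, is_derive s 1 (@moll R) (db s).
Hypothesis db0 : forall s : R, 1 < `|s| -> db s = 0.

(* The inequality tested with the kernel at [y], weighted by [z y]: integrating
   over [y], an integration by parts moves the derivative back to [z]. *)
Let J (q y : 'rV[R]_n) := z y * (\sum_i A i q * dkern a db i q y + b q * kern a q y).

Lemma J_le0 (y : 'rV[R]_n) : (\int[lebesgue_Rn R n]_v (J (rowt v) y)%:E <= 0)%E.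
Proof.
have t := kern_test a1 y.
have t1 : Ck 1 (kern a ^~ y) by have [] := t; exact.
have k0 : off_ball (`|y| + a^-1) (kern a ^~ y).
  by move=> q qy; apply: kern_far => //; have := lerB_dist q y; lra.
have pE i q : partial i (kern a ^~ y) q = dkern a db i q y.
  by have [_ <-] := kern_derivel a dbd i q y.
have ki := weak_form_integrable t1 k0.
have := weak t (fun q => kern_ge0 a q y); rewrite /Rn_integral /Rintegral => H.
have {}H : (\int[lebesgue_Rn R n]_v (weak_form (kern a ^~ y) (rowt v))%:E <= 0)%E.
  by rewrite -(fineK (integrable_fin_num measurableT ki)) lee_fin.
rewrite (_ : (fun v => _) = fun v => ((z y)%:E * (weak_form (kern a ^~ y) (rowt v))%:E)%E).
  by rewrite integralZl//; apply: mule_ge0_le0; rewrite ?lee_fin.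
apply/funext => v; rewrite -EFinM /J /weak_form; congr (_ * (_ + _))%:E.
by apply: eq_bigr => i _; rewrite pE.
Qed.

Lemma J_integrable : (lebesgue_Rn R n \x lebesgue_Rn R n)%E.-integrable setT
  (fun w => (J (rowt w.1) (rowt w.2))%:E).
Proof.
have [B B0 HB] := @kern_bounded R n a db dbc db0.
have [C C0 HC] := Ab_bounded (r + 1).
have [zc pzc zd] := Ck1_derive z1.
have [D HD] := off_ball_bounded zc z0.
have Dfin : ((lebesgue_Rn R n \x lebesgue_Rn R n)%E
    (@cube R n (r + 1)%R `*` @cube R n r) < +oo)%E.
  rewrite product_measure1E//; try exact: measurable_cube.
  by rewrite lte_mul_pinfty//; [rewrite ge0_fin_numE//; exact: cube_measure_fin|exact: cube_measure_fin].
apply: (@integrable_bounded_support R _ _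
  [the {measure set (n.-tuple T * n.-tuple T) -> \bar R} of (lebesgue_Rn R n \x lebesgue_Rn R n)%E]
  (@cube R n (r + 1) `*` @cube R n r) (fun w => J (rowt w.1) (rowt w.2))
  (D * (\sum_(i < n) C * B + C * B))).
- by apply: measurableX; exact: measurable_cube.
- exact: Dfin.
- apply: measurable_funM.
    by apply: (@measurableT_comp _ _ _ _ _ _ (fun v : n.-tuple T => z (rowt v))) => //; exact: measurable_rowt.
  apply: measurable_funD.
    apply: measurable_sum => i; apply: measurable_funM; last exact: measurable_dkern.
    exact: (@measurableT_comp _ _ _ _ _ _ (fun v : n.-tuple T => A i (rowt v))).
  apply: measurable_funM; last exact: measurable_kern.
  exact: (@measurableT_comp _ _ _ _ _ _ (fun v : n.-tuple T => b (rowt v))).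
- move=> [v w] [/= vr _].
  have vr1 : `|rowt v| <= r + 1.
    apply: row_norm_le => [|i]; first by rewrite addr_ge0.
    by have := vr i; rewrite mxE /= in_itv/= -ler_norml.
  have [HA Hb] := HC _ vr1; have [Hk Hd] := HB (rowt v) (rowt w).
  rewrite /J normrM; apply: ler_pM => //.
  rewrite (le_trans (ler_normD _ _))// lerD//.
    rewrite (le_trans (ler_norm_sum _ _ _))//; apply: ler_sum => i _.
    by rewrite normrM; apply: ler_pM.
  by rewrite normrM; apply: ler_pM.
- move=> [v w] /= vw.
  have [wr|/rowt_off_cube/z0 wr] := pselect (@cube R n r w); last by rewrite /J wr mul0r.
  have vr : ~ @cube R n (r + 1) v by move=> vr; exact: vw.
  have wr1 : `|rowt w| <= r.
    by apply: row_norm_le => // i; have := wr i; rewrite mxE /= in_itv/= -ler_norml.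
  have far : a^-1 < `|rowt v - rowt w|.
    have := rowt_off_cube vr; have := lerB_dist (rowt v) (rowt w).
    have : a^-1 <= 1 by rewrite invf_le1// (lt_le_trans ltr01).
    lra.
  rewrite /J (kern_far a1 far) mulr0 addr0 big1 ?mulr0// => i _.
  by rewrite (dkern_far a1 db0 _ far) mulr0.
Qed.

Let K := weak_form z.

(** The mollification of [z] is never formed, which avoids differentiating under the integral sign:
    testing with each kernel, integrating over its centre and exchanging the integrals has the same
    effect. The error is at most [C * w] for each of the [n] first-order terms and for the
    zero-order one, hence [n.+1]. *)
Lemma weak_form_approx (C w : R) : 0 <= C -> 0 <= w ->
  (forall q, `|q| <= r + 1 -> (forall i, `|A i q| <= C) /\ `|b q| <= C) ->
  (forall q q', `|q - q'| <= a^-1 -> `|z q - z q'| <= w) ->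
  (forall i q q', `|q - q'| <= a^-1 -> `|partial i z q - partial i z q'| <= w) ->
  (\int[lebesgue_Rn R n]_v (K (rowt v))%:E <=
    (C * w *+ n.+1)%:E * lebesgue_Rn R n (@cube R n (r + 1)%R))%E.
Proof.
move=> C0 w0 HC wz wpz.
have [zc pzc zd] := Ck1_derive z1.
have [Z Z0 kZ] := @kern_integral R n a a1.
pose D := @cube R n (r + 1).
have mD : measurable D by exact: measurable_cube.
(* The integrand minus the admissible error, charged only on the cube of radius [r + 1]; times the
   mass [Z] it is dominated by the integral of [J] over the centres. *)
pose E (v : n.-tuple T) := K (rowt v) - (C * w *+ n.+1) * \1_D v.
have main (v : n.-tuple T) :
    ((E v * Z)%:E <= \int[lebesgue_Rn R n]_y (J (rowt v) (rowt y))%:E)%E.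
  set q := rowt v.
  have Ec i : continuous (fun y => partial i z y * kern a q y - z y * dkern a db i q y).
    apply: ctsB; apply: ctsM => //; [exact: kern_continuous|exact: dkern_continuous].
  have ibp i : (\int[lebesgue_Rn R n]_y
      (partial i z (rowt y) * kern a q (rowt y) - z (rowt y) * dkern a db i q (rowt y))%:E = 0)%E.
    apply: (@integral_partial0 _ n i (fun y => z y * kern a q y)
      (fun y => partial i z y * kern a q y - z y * dkern a db i q y) r).
    - move=> y; have := is_deriveM (zd i y) (kern_deriver a dbd i q y).
      set d := (X in is_derive _ _ _ X -> _); rewrite (_ : d = partial i z y * kern a q y - z y * dkern a db i q y)//.
      by rewrite /d /GRing.scale/=; ring.
    - exact: Ec.
    - by move=> y ry; rewrite z0// mul0r.
    - by move=> y ry; rewrite z0// (partial_off_ball i z0)// !mul0r subrr.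
  pose M (y : 'rV[R]_n) := (\sum_i A i q * partial i z y + b q * z y) * kern a q y.
  pose S (y : 'rV[R]_n) := \sum_i A i q * (partial i z y * kern a q y - z y * dkern a db i q y).
  have Mc : continuous M.
    apply: ctsM; last exact: kern_continuous.
    by apply: ctsD; [apply: cts_sum => i|]; exact: ctsMl.
  have M0 : off_ball r M.
    move=> y ry; rewrite /M z0// mulr0 addr0 big1 ?mul0r// => i _.
    by rewrite (partial_off_ball i z0)// mulr0.
  have E0 i : off_ball r (fun y => partial i z y * kern a q y - z y * dkern a db i q y).
    by move=> y ry; rewrite z0// (partial_off_ball i z0)// !mul0r subrr.
  have S0 : (\int[lebesgue_Rn R n]_y (S (rowt y))%:E = 0)%E.
    rewrite /S; under eq_integral do rewrite -sumEFin.
    have AEc i := @ctsMl _ _ (A i q) _ (Ec i).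
    have AE0 i : off_ball r (fun y => A i q * (partial i z y * kern a q y - z y * dkern a db i q y)).
      by move=> y ry; rewrite E0// mulr0.
    rewrite integral_sum//=; last by move=> i; exact: (integrable_rowt (AEc i) (AE0 i)).
    rewrite big1// => i _.
    under eq_integral do rewrite EFinM.
    rewrite integralZl//; last exact: (integrable_rowt (Ec i) (E0 i)).
    by rewrite ibp mule0.
  have Sc : continuous S.
    by apply: cts_sum => i; exact: ctsMl.
  have S0' : off_ball r S.
    by move=> y ry; rewrite /S big1// => i _; rewrite E0// mulr0.
  have JMS y : J q y = M y - S y.
    rewrite /J /M /S mulrDl mulrDr mulr_sumr mulr_suml addrAC -sumrB.
    by congr (_ + _); [apply: eq_bigr => i _|]; ring.
  have -> : (\int[lebesgue_Rn R n]_y (J q (rowt y))%:E = \int[lebesgue_Rn R n]_y (M (rowt y))%:E)%E.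
    under eq_integral do rewrite JMS EFinB.
    rewrite integralB//=; [|exact: (integrable_rowt Mc M0)|exact: (integrable_rowt Sc S0')].
    by rewrite S0 sube0.
  (* On the support of the kernel, [M] and [K q * kern a q] differ by the modulus of continuity. *)
  have ME y : E v * kern a q y <= M y.
    have k0 := kern_ge0 a q y.
    have [qy|qy] := ltP a^-1 `|q - y|; first by rewrite /M (kern_far a1 qy) !mulr0.
    rewrite /M; apply: ler_wpM2r => //; rewrite /E -/q.
    have [qr|qr] := leP `|q| (r + 1).
      have -> : \1_D v = 1 :> R.
        rewrite indicE mem_set// => i /=; rewrite in_itv/= -ler_norml.
        by have := coord_norm_le q i; rewrite mxE => /le_trans; exact.
      have [HA Hb] := HC _ qr.
      have fin (c s s' : R) : `|c| <= C -> `|s - s'| <= w -> c * s - c * s' <= C * w.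
        move=> cC sw; rewrite -mulrBr (le_trans (ler_norm _))// normrM.
        by apply: ler_pM.
      have sumle : \sum_i A i q * partial i z q - \sum_i A i q * partial i z y <= C * w *+ n.
        rewrite -sumrB -[n in leRHS]card_ord -sumr_const; apply: ler_sum => i _.
        by apply: fin; [exact: HA|exact: wpz].
      have ble : b q * z q - b q * z y <= C * w by apply: fin; [|exact: wz].
      rewrite mulr1 mulrSr /K /weak_form.
      move: sumle ble; set s1 := \sum_i _; set s2 := \sum_i _; set t := C * w *+ n.
      by lra.
    (* The kernel has width $1/a\le 1$, so from a point outside radius [r + 1] it does not reach the
       support of [z]. *)
    have ry : r < `|y|.
      have := lerB_dist q (q - y); rewrite subKr.
      have : a^-1 <= 1 by rewrite invf_le1// (lt_le_trans ltr01).
      by lra.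
    have rq : r < `|q| by rewrite (le_lt_trans _ qr)// lerDl.
    rewrite /K (weak_form_off z0 rq) z0// mulr0 addr0 big1 ?sub0r; last first.
      by move=> i _; rewrite (partial_off_ball i z0)// mulr0.
    by rewrite oppr_le0 mulr_ge0// ?mulrn_wge0 ?mulr_ge0// indicE ler0n.
  have k0 : off_ball (`|q| + a^-1) (kern a q).
    move=> y qy; apply: kern_far => //; have := lerB_dist y q; rewrite (distrC y).
    by lra.
  have ki := integrable_rowt (@kern_continuous R n a q) k0.
  rewrite EFinM -(kZ q) -integralZl//; apply: le_integral => //.
  - exact: integrableZl.
  - exact: (integrable_rowt Mc M0).
  - by move=> y _; rewrite -EFinM lee_fin; exact: ME.
have [CK CK0 HCK] := weak_form_bounded z1 z0.
have mE : measurable_fun setT E.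
  apply: measurable_funB; first exact: weak_form_measurable.
  by apply: measurable_funM => //; exact: measurable_indic.
have iK := weak_form_integrable z1 z0.
have i1 : (lebesgue_Rn R n).-integrable setT (EFin \o (fun v => C * w *+ n.+1 * \1_D v)).
  apply: (@integrable_bounded_support _ _ _ _ D _ `|C * w *+ n.+1|) => //.
  - exact: cube_measure_fin.
  - by apply: measurable_funM => //; exact: measurable_indic.
  - by move=> v Dv; rewrite indicE mem_set// mulr1.
  - by move=> v Dv; rewrite indicE memNset// mulr0.
have iE : (lebesgue_Rn R n).-integrable setT (EFin \o E).
  rewrite (_ : EFin \o E = ((fun v => (K (rowt v))%:E) \- (fun v => (C * w *+ n.+1 * \1_D v)%:E))%E).
    exact: integrableB.
  by apply/funext => v; rewrite /E /= EFinB.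
have le0 : (\int[lebesgue_Rn R n]_v (E v * Z)%:E <= 0)%E.
  apply: (@le_trans _ _ (\int[lebesgue_Rn R n]_v \int[lebesgue_Rn R n]_y (J (rowt v) (rowt y))%:E)%E).
    apply: le_integral => //.
    - by under eq_fun do rewrite EFinM; exact: integrableZr.
    - exact: (integrable_fubini_F J_integrable).
  rewrite (Fubini J_integrable)/=.
  by apply: integral_le0 => y; exact: J_le0.
have intE : (\int[lebesgue_Rn R n]_v (E v)%:E = \int[lebesgue_Rn R n]_v (K (rowt v))%:E -
    (C * w *+ n.+1)%:E * lebesgue_Rn R n D)%E.
  rewrite /E; under eq_integral do rewrite EFinB.
  rewrite (integralB measurableT iK i1)/=; congr (_ - _)%E.
  under eq_integral do rewrite EFinM.
  rewrite integralZl//; first by rewrite integral_indic// setIT.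
  apply: (@integrable_bounded_support _ _ _ _ D _ 1) => //.
  - exact: cube_measure_fin.
  - by move=> v Dv; rewrite indicE mem_set// normr1.
  - by move=> v Dv; rewrite indicE memNset.
have fE := integrable_fin_num measurableT iE.
have : (\int[lebesgue_Rn R n]_v (E v)%:E <= 0)%E.
  move: le0; under eq_integral do rewrite EFinM.
  by rewrite integralZr// -(fineK fE) -EFinM !lee_fin pmulr_lle0.
rewrite intE sube_le0//.
Qed.

End Approx.

Lemma weak_form_C1 r z : 0 <= r -> Ck 1 z -> off_ball r z -> (forall q, 0 <= z q) ->
  Rn_integral (weak_form z) <= 0.
Proof.
move=> r0 z1 z0 z_ge0; have [db dbc [dbd db0]] := @moll_derive R.
have [zc pzc zd] := Ck1_derive z1.
have [C C0 HC] := Ab_bounded (r + 1).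
pose c := fine (lebesgue_Rn R n (@cube R n (r + 1))).
have fc : lebesgue_Rn R n (@cube R n (r + 1)) = c%:E.
  by rewrite fineK// ge0_fin_numE// cube_measure_fin.
have c0 : 0 <= c by rewrite -lee_fin -fc.
have iK := weak_form_integrable z1 z0.
have fK := integrable_fin_num measurableT iK.
have KE : (\int[lebesgue_Rn R n]_v (weak_form z (rowt v))%:E)%E = (Rn_integral (weak_form z))%:E.
  by rewrite /Rn_integral /Rintegral fineK.
have main w : 0 < w -> Rn_integral (weak_form z) <= C * w *+ n.+1 * c.
  move=> w0.
  have [d d0 Hd] := uniformly_continuous zc z0 w0.
  have /choice[dp Hdp] : forall i, exists d : R, 0 < d /\
      forall q q', `|q - q'| < d -> `|partial i z q - partial i z q'| <= w.
    move=> i; have [d' d'0 Hd'] := uniformly_continuous (pzc i) (partial_off_ball i z0) w0.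
    by exists d'.
  (* Exceeds the reciprocal of every modulus of continuity, of [z] and of each partial derivative,
     so that the width $1/a$ lies below all of them. *)
  pose a := 1 + d^-1 + \sum_i (dp i)^-1.
  have dV0 : 0 < d^-1 by rewrite invr_gt0.
  have dpV0 i : 0 < (dp i)^-1 by rewrite invr_gt0; have [] := Hdp i.
  have s0 : 0 <= \sum_i (dp i)^-1 by apply: sumr_ge0 => i _; exact: ltW.
  have a1 : 1 <= a by rewrite /a; lra.
  have a_gt0 : 0 < a by exact: lt_le_trans a1.
  have ad : a^-1 < d by rewrite invf_plt ?posrE// /a; lra.
  have adp i : a^-1 < dp i.
    rewrite invf_plt ?posrE//; last by have [] := Hdp i.
    rewrite /a (bigD1 i)//=.
    have : 0 <= \sum_(j | j != i) (dp j)^-1 by apply: sumr_ge0 => j _; exact: ltW.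
    by lra.
  rewrite -lee_fin -KE EFinM -fc.
  apply: (@weak_form_approx r z r0 z1 z0 z_ge0 a a1 db dbc dbd db0 C w C0 (ltW w0) HC).
    by move=> q q' qq'; apply: Hd; exact: le_lt_trans ad.
  by move=> i q q' qq'; have [_] := Hdp i; apply; exact: le_lt_trans (adp i).
rewrite leNgt; apply/negP => I0.
(* A positive value $I$ of the integral is refuted by the tolerance $w=I/B$. *)
pose B := C * n.+1%:R * c + 1.
have B0 : 0 < B by rewrite ltr_wpDl// !mulr_ge0.
have := main (Rn_integral (weak_form z) / B) (divr_gt0 I0 B0).
rewrite -mulr_natr leNgt => /negP; apply.
rewrite (_ : C * _ * _ * c = Rn_integral (weak_form z) * (C * n.+1%:R * c / B)); last by ring.
by rewrite gtr_pMr// ltr_pdivrMr// mul1r /B ltrDl.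
Qed.

End DensityMain.

(** * Functions with an explicit gradient *)

Section GradientCalculus.
Context {R : realType} {n : nat}.
Implicit Types (B : set 'rV[R]_n) (g h : 'rV[R]_n -> R) (dg dh : 'I_n -> 'rV[R]_n -> R).

(** The gradient is an explicit datum, so that sums, products and compositions are computed
    algebraically and [partial] is met only at the end. *)
Definition C1on B g dg := forall q, B q -> {for q, continuous g} /\
  forall i, is_derive q (delta_mx 0 i) g (dg i q) /\ {for q, continuous (dg i)}.

Lemma forD (V : normedModType R) (f g : V -> R) (q : V) :
  {for q, continuous f} -> {for q, continuous g} -> {for q, continuous (fun x => f x + g x)}.
Proof. move=> fc gc; exact: (@cvgD _ _ _ _ (nbhs_filter q) _ _ _ _ fc gc). Qed.

Lemma forM (V : normedModType R) (f g : V -> R) (q : V) :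
  {for q, continuous f} -> {for q, continuous g} -> {for q, continuous (fun x => f x * g x)}.
Proof. move=> fc gc; exact: (@cvgM _ _ _ (nbhs_filter q) _ _ _ _ fc gc). Qed.

Lemma for_comp (V : normedModType R) (f : V -> R) (phi : R -> R) (q : V) :
  {for q, continuous f} -> {for f q, continuous phi} -> {for q, continuous (fun x => phi (f x))}.
Proof. by move=> fc pc; apply: (@continuous_comp _ _ _ f phi). Qed.

Lemma for_sum (V : normedModType R) (I : Type) (s : seq I) (F : I -> V -> R) (q : V) :
  (forall i, {for q, continuous (F i)}) -> {for q, continuous (fun x => \sum_(i <- s) F i x)}.
Proof.
move=> Fc; elim: s => [|i s IH].
  by rewrite (_ : (fun x => _) = fun=> 0); [exact: cts_cst|apply/funext => x; rewrite big_nil].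
rewrite (_ : (fun x => _) = fun x => F i x + \sum_(j <- s) F j x); first exact: forD.
by apply/funext => x; rewrite big_cons.
Qed.

Lemma is_derive_comp1 (V : normedModType R) (f : V -> R) (phi : R -> R) (q v : V) (d d' : R) :
  is_derive q v f d -> is_derive (f q) 1 phi d' ->
  is_derive q v (fun x => phi (f x)) (d' * d).
Proof.
move=> /is_derive_line0 fd pd; apply/is_derive_line0.
have pd' : is_derive ((fun s : R => f (s *: v + q)) 0) 1 phi d' by rewrite scale0r add0r.
exact: (@is_derive1_comp _ phi (fun s => f (s *: v + q)) 0 _ _ pd' fd).
Qed.

Lemma C1on_cst B (c : R) : C1on B (fun=> c) (fun _ _ => 0).
Proof.
move=> q _; split => [|i]; first exact: cts_cst.
by split; [exact: is_derive_cst|exact: cts_cst].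
Qed.

Lemma is_derive_coord (q v : 'rV[R]_n) (i : 'I_n) :
  is_derive q v (fun q : 'rV[R]_n => q 0 i) (v 0 i).
Proof.
apply/is_derive_line0; rewrite (_ : (fun s => _) = fun s : R => v 0 i * s + q 0 i); last first.
  by apply/funext => s; rewrite !mxE mulrC.
have H : is_derive (0 : R) 1 (v 0 i \*: (@id R) + cst (q 0 i)) (v 0 i *: 1 + 0) by apply: is_deriveD.
by rewrite addr0 [v 0 i *: 1]mulr1 in H.
Qed.

Lemma C1on_coord B k : C1on B (fun q => q 0 k) (fun i _ => (i == k)%:R).
Proof.
move=> q _; split => [|i]; first exact: coord_continuous.
split; last exact: cts_cst.
by have := is_derive_coord q (delta_mx 0 i) k; rewrite mxE eqxx/= eq_sym.
Qed.

Lemma C1on_ext B g h dg dh : (forall q, g q = h q) ->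
  (forall i q, dg i q = dh i q) -> C1on B g dg -> C1on B h dh.
Proof.
move=> gh dgh; rewrite (_ : h = g); last exact/esym/funext.
by rewrite (_ : dh = dg)//; apply/funext => i; apply/funext => q.
Qed.

Lemma C1on_add B g h dg dh : C1on B g dg -> C1on B h dh ->
  C1on B (fun q => g q + h q) (fun i q => dg i q + dh i q).
Proof.
move=> Hg Hh q Bq; have [gc gd] := Hg q Bq; have [hc hd] := Hh q Bq.
split=> [|i]; first exact: forD.
have [gdi gci] := gd i; have [hdi hci] := hd i.
by split; [exact: is_deriveD|exact: forD].
Qed.

Lemma C1on_mul B g h dg dh : C1on B g dg -> C1on B h dh ->
  C1on B (fun q => g q * h q) (fun i q => g q * dh i q + h q * dg i q).
Proof.
move=> Hg Hh q Bq; have [gc gd] := Hg q Bq; have [hc hd] := Hh q Bq.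
split=> [|i]; first exact: forM.
have [gdi gci] := gd i; have [hdi hci] := hd i.
by split; [exact: is_deriveM|apply: forD; exact: forM].
Qed.

Lemma C1on_scale B c g dg : C1on B g dg -> C1on B (fun q => c * g q) (fun i q => c * dg i q).
Proof.
move=> Hg q Bq; have [gc gd] := Hg q Bq.
split=> [|i]; first by apply: forM => //; exact: cts_cst.
have [gdi gci] := gd i; split; first exact: is_deriveZ.
by apply: forM => //; exact: cts_cst.
Qed.

Lemma C1on_sum B (I : Type) (s : seq I) (F : I -> 'rV[R]_n -> R) dF :
  (forall k, C1on B (F k) (dF k)) ->
  C1on B (fun q => \sum_(k <- s) F k q) (fun i q => \sum_(k <- s) dF k i q).
Proof.
move=> HF; elim: s => [|k s IH].
  rewrite (_ : (fun q => _) = fun=> 0); last by apply/funext => q; rewrite big_nil.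
  have -> : (fun (i : 'I_n) (q : 'rV[R]_n) => \sum_(k <- [::]) dF k i q) = (fun _ _ => 0).
    by apply/funext => i; apply/funext => q; rewrite big_nil.
  exact: C1on_cst.
rewrite (_ : (fun q => _) = fun q => F k q + \sum_(k <- s) F k q); last first.
  by apply/funext => q; rewrite big_cons.
have -> : (fun (i : 'I_n) (q : 'rV[R]_n) => \sum_(k <- k :: s) dF k i q) =
    (fun i q => dF k i q + \sum_(k <- s) dF k i q).
  by apply/funext => i; apply/funext => q; rewrite big_cons.
exact: C1on_add.
Qed.

Lemma C1on_comp B g dg (phi dphi : R -> R) : C1on B g dg ->
  (forall q, B q -> is_derive (g q) 1 phi (dphi (g q)) /\ {for g q, continuous dphi}) ->
  C1on B (fun q => phi (g q)) (fun i q => dphi (g q) * dg i q).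
Proof.
move=> Hg Hphi q Bq; have [gc gd] := Hg q Bq; have [pd pc] := Hphi q Bq.
split=> [|i]; first by apply: for_comp => //; exact: is_derive_continuous pd.
have [gdi gci] := gd i.
by split; [exact: is_derive_comp1|apply: forM => //; exact: for_comp].
Qed.

Lemma C1on_partial B g dg q i : C1on B g dg -> B q -> partial i g q = dg i q.
Proof. by move=> Hg Bq; have [_ /(_ i)[[_ <-]]] := Hg q Bq. Qed.

Lemma C1on_Ck1 g : Ck 1 g -> C1on setT g (fun i => partial i g).
Proof.
move=> /Ck1_derive[gc pc gd] q _; split=> [|i]; first exact: gc.
by split; [exact: gd|exact: pc].
Qed.

Lemma C1onT_Ck1 g dg : C1on setT g dg -> Ck 1 g.
Proof.
move=> Hg; have gc : continuous g by move=> q; have [] := Hg q I.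
split=> //; split=> [i q|i]; first by have [_ /(_ i)[[]]] := Hg q I.
split=> //; rewrite (_ : partial i g = dg i).
  by move=> q; have [_ /(_ i)[]] := Hg q I.
by apply/funext => q; exact: (C1on_partial i Hg).
Qed.

Lemma C1on_sub B B' g dg : B' `<=` B -> C1on B g dg -> C1on B' g dg.
Proof. by move=> BB Hg q /BB; exact: Hg. Qed.

(** The open sets inside radius [d] and outside radius [d'] cover the space; the function is $C^1$
    on the first and 0 on the second. It turns local formulas into global ones. *)
Lemma C1on_glue (q0 : 'rV[R]_n) (d d' : R) g dg : d' < d ->
  C1on [set q | `|q - q0| < d] g dg ->
  (forall q, d' < `|q - q0| -> g q = 0 /\ forall i, dg i q = 0) -> C1on setT g dg.
Proof.
move=> dd Hg g0 q _; have [qd|qd] := ltP `|q - q0| d; first exact: Hg.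
have qd' : d' < `|q - q0| := lt_le_trans dd qd.
have qq : 0 < `|q - q0| - d' by rewrite subr_gt0.
have nz z : `|q - z| < `|q - q0| - d' -> d' < `|z - q0|.
  by have := ler_normD (q - z) (z - q0); rewrite addrA subrK; lra.
have zc (h : 'rV[R]_n -> R) : (forall z, d' < `|z - q0| -> h z = 0) -> {for q, continuous h}.
  move=> h0; apply/continuousPe => e e0; exists (`|q - q0| - d') => // z /nz dz.
  by rewrite !h0// subrr normr0.
split=> [|i]; first by apply: zc => z /g0[].
split; last by apply: zc => z /g0[].
have [_ ->] := g0 _ qd'; apply: near_eq_is_derive (is_derive_cst (0 : R) q _).
by apply/nbhs_normP; exists (`|q - q0| - d') => // z /= /nz/g0[->].
Qed.

Lemma C1on_ball_if (q0 : 'rV[R]_n) (d : R) g dg : C1on [set q | `|q - q0| < d] g dg ->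
  C1on [set q | `|q - q0| < d] (fun q => if `|q - q0| < d then g q else 0)
    (fun i q => if `|q - q0| < d then dg i q else 0).
Proof.
move=> Hg q /= qd; have [gc gd] := Hg q qd.
have near_in : \forall z \near q, `|z - q0| < d.
  apply/nbhs_normP; exists (d - `|q - q0|) => /=; first by rewrite subr_gt0.
  by move=> z /=; have := ler_normD (z - q) (q - q0); rewrite addrA subrK (distrC z q); lra.
have cif (h : 'rV[R]_n -> R) : {for q, continuous h} ->
    {for q, continuous (fun q : 'rV[R]_n => if `|q - q0| < d then h q else 0)}.
  move=> /continuousPe hc; apply/continuousPe => e /hc[d1 d10 Hd1].
  exists (Num.min d1 (d - `|q - q0|)); first by rewrite lt_min d10 subr_gt0.
  move=> z; rewrite lt_min => /andP[/Hd1 hz qz].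
  by rewrite qd ifT//; have := ler_normD (z - q) (q - q0); rewrite addrA subrK (distrC z q); lra.
split=> [|i]; first exact: cif.
have [gdi gci] := gd i; split; last exact: cif.
rewrite qd; apply: near_eq_is_derive gdi.
by apply: filterS near_in => z ->.
Qed.

Lemma max0_continuous : continuous (fun x : R => Num.max x 0).
Proof.
move=> x; apply/continuousPe => e e0; exists e => // y xy.
by rewrite (le_lt_trans _ xy)//; case: (leP x 0); case: (leP y 0) => ? ?;
  rewrite ler_norml; have := ler_norm (x - y); have := ler_norm (y - x);
  rewrite (distrC y x); lra.
Qed.

(** Squaring makes the positive part $C^1$ across 0, hence usable in a test function. *)
Lemma sqr_pos_derive (x : R) : is_derive x 1 (fun x => Num.max x 0 ^+ 2) (2 * Num.max x 0).
Proof.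
have c1 : continuous (fun x : R => Num.max x 0 ^+ 2).
  rewrite (_ : (fun x => _) = fun x : R => Num.max x 0 * Num.max x 0).
    by apply: ctsM; exact: max0_continuous.
  by apply/funext => y; rewrite expr2.
have c2 : continuous (fun x : R => 2 * Num.max x 0) by apply: ctsMl; exact: max0_continuous.
have H (y : R) : y != 0 -> is_derive y 1 (fun x => Num.max x 0 ^+ 2) (2 * Num.max y 0).
  rewrite neq_lt => /orP[y0|y0].
    rewrite max_r ?ltW// mulr0; apply: near_eq_is_derive (is_derive_cst (0 : R) y _).
    by have := near_lt y0; apply: filterS => z z0; rewrite max_r ?ltW// expr0n.
  rewrite max_l ?ltW//.
  have D : is_derive y 1 ((@id R) ^+ 2) ((2%:R * y ^+ 1) *: 1) by apply: is_deriveX.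
  rewrite expr1 [_ *: 1]mulr1 in D; apply: near_eq_is_derive D.
  by have := near_gt y0; apply: filterS => z z0; rewrite max_l ?ltW.
have [->|x0] := eqVneq x 0; last exact: H.
exact: (is_derive_extend (c1 0) H (c2 0)).
Qed.

End GradientCalculus.

(** * Horizontal fields and the comparison principle *)

Section HeisenbergFields.
Context {R : realType} {m : nat}.
Local Notation N := (m + m + 1)%N.
Local Notation H := (heis R m).

Lemma idx_xx (j k : 'I_m) : (idx_x j == idx_x k) = (j == k).
Proof. by rewrite /idx_x !(inj_eq (@lshift_inj _ _)). Qed.

Lemma idx_yy (j k : 'I_m) : (idx_y j == idx_y k) = (j == k).
Proof. by rewrite /idx_y (inj_eq (@lshift_inj _ _)) (inj_eq (@rshift_inj _ _)). Qed.

Lemma idx_yx (j k : 'I_m) : (idx_y j == idx_x k) = false.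
Proof. by rewrite /idx_x /idx_y (inj_eq (@lshift_inj _ _)) eq_rlshift. Qed.

Lemma idx_xy (j k : 'I_m) : (idx_x j == idx_y k) = false.
Proof. by rewrite eq_sym idx_yx. Qed.

Lemma idx_tx (k : 'I_m) : (idx_t m == idx_x k) = false.
Proof. by rewrite /idx_x /idx_t eq_rlshift. Qed.

Lemma idx_ty (k : 'I_m) : (idx_t m == idx_y k) = false.
Proof. by rewrite /idx_y /idx_t eq_rlshift. Qed.

Lemma idx_xt (k : 'I_m) : (idx_x k == idx_t m) = false.
Proof. by rewrite eq_sym idx_tx. Qed.

Lemma idx_yt (k : 'I_m) : (idx_y k == idx_t m) = false.
Proof. by rewrite eq_sym idx_ty. Qed.

Definition liftX (j : 'I_m) (dg : 'I_N -> H -> R) (q : H) : R :=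
  dg (idx_x j) q + 2 * q 0 (idx_y j) * dg (idx_t m) q.

Definition liftY (j : 'I_m) (dg : 'I_N -> H -> R) (q : H) : R :=
  dg (idx_y j) q - 2 * q 0 (idx_x j) * dg (idx_t m) q.

(* Euclidean components of the horizontal field [\sum_j a_j X_j + b_j Y_j] at q. *)
Definition vfield (a b : 'I_m -> H -> R) (i : 'I_N) (q : H) : R :=
  match fintype.split i with
  | inl k => match fintype.split k with inl j => a j q | inr j => b j q end
  | inr _ => \sum_j (2 * q 0 (idx_y j) * a j q - 2 * q 0 (idx_x j) * b j q)
  end.

Lemma vfield_x a b j q : vfield a b (idx_x j) q = a j q.
Proof.
rewrite /vfield (_ : fintype.split _ = inl (lshift m j)); last exact: (unsplitK (inl _)).
by rewrite (_ : fintype.split _ = inl j)//; exact: (unsplitK (inl _)).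
Qed.

Lemma vfield_y a b j q : vfield a b (idx_y j) q = b j q.
Proof.
rewrite /vfield (_ : fintype.split _ = inl (rshift m j)); last exact: (unsplitK (inl _)).
by rewrite (_ : fintype.split _ = inr j)//; exact: (unsplitK (inr _)).
Qed.

Lemma vfield_t a b q : vfield a b (idx_t m) q =
  \sum_j (2 * q 0 (idx_y j) * a j q - 2 * q 0 (idx_x j) * b j q).
Proof.
rewrite /vfield (_ : fintype.split _ = inr ord0)//; exact: (unsplitK (inr _)).
Qed.

Lemma sum_heis (F : 'I_N -> R) :
  \sum_i F i = \sum_j (F (idx_x j) + F (idx_y j)) + F (idx_t m).
Proof. by rewrite !big_split_ord /= big_ord1 big_split. Qed.

(** Duality of horizontal fields and gradients: it makes the weak inequality on the Heisenberg group
    an instance of the Euclidean [weak_form]. *)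
Lemma sum_vfield a b (c : 'I_N -> H -> R) q :
  \sum_i vfield a b i q * c i q = \sum_j (a j q * liftX j c q + b j q * liftY j c q).
Proof.
rewrite sum_heis vfield_t mulr_suml -big_split/=; apply: eq_bigr => j _.
by rewrite vfield_x vfield_y /liftX /liftY; ring.
Qed.

Lemma vfX_lift j u q : vfX j u q = liftX j (fun i => partial i u) q.
Proof. by []. Qed.

Lemma vfY_lift j u q : vfY j u q = liftY j (fun i => partial i u) q.
Proof. by []. Qed.

Definition gradsq (dg : 'I_N -> H -> R) q := \sum_j (liftX j dg q ^+ 2 + liftY j dg q ^+ 2).

Lemma gradsq_ge0 dg q : 0 <= gradsq dg q.
Proof. by apply: sumr_ge0 => j _; rewrite addr_ge0 ?sqr_ge0. Qed.

Lemma hgrad_normE u q : hgrad_norm u q = Num.sqrt (gradsq (fun i => partial i u) q).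
Proof. by congr Num.sqrt; apply: eq_bigr => j _; rewrite !expr2. Qed.

Lemma lift_continuous (dg : 'I_N -> H -> R) q : (forall i, {for q, continuous (dg i)}) ->
  forall j, {for q, continuous (liftX j dg)} /\ {for q, continuous (liftY j dg)}.
Proof.
move=> dgc j.
have c2 k : {for q, continuous (fun q : H => 2 * q 0 k)}.
  by apply: forM; [exact: cts_cst|exact: coord_continuous].
split; first by apply: forD => //; apply: forM.
apply: forD => //.
have : {for q, continuous (fun q : H => -1 * ((2 * q 0 (idx_x j)) * dg (idx_t m) q))}.
  by apply: forM; [exact: cts_cst|exact: forM].
by rewrite (_ : (fun _ => _) = fun q : H => - (2 * q 0 (idx_x j) * dg (idx_t m) q))//;
  apply/funext => z; rewrite mulN1r.
Qed.

Lemma gradsq_continuous (dg : 'I_N -> H -> R) q : (forall i, {for q, continuous (dg i)}) ->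
  {for q, continuous (gradsq dg)}.
Proof.
move=> /lift_continuous c; apply: for_sum => j; have [cx cy] := c j.
by apply: forD; rewrite /expr2; exact: forM.
Qed.

Lemma lift_le_grad dg q j : `|liftX j dg q| <= Num.sqrt (gradsq dg q) /\
  `|liftY j dg q| <= Num.sqrt (gradsq dg q).
Proof.
have sq (x : R) : x ^+ 2 <= gradsq dg q -> `|x| <= Num.sqrt (gradsq dg q).
  by move=> xg; rewrite -sqrtr_sqr ler_wsqrtr.
have sums : 0 <= \sum_(k | k != j) (liftX k dg q ^+ 2 + liftY k dg q ^+ 2).
  by apply: sumr_ge0 => k _; rewrite addr_ge0 ?sqr_ge0.
split; apply: sq; rewrite /gradsq (bigD1 j)//=.
  by have := sqr_ge0 (liftY j dg q); lra.
by have := sqr_ge0 (liftX j dg q); lra.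
Qed.

Section Weak.
Variables (p : R) (f l : R -> R) (u : H -> R).
Hypothesis p1 : 1 < p.
Hypothesis sol : weak_solution p f l u.
Let b q := f (u q) * l (hgrad_norm u q).
Hypothesis bc : continuous b.

Let u1 : Ck 1 u. Proof. by case: sol. Qed.
Let du := fun i => partial i u.
Let duc i : continuous (du i). Proof. by have [_ pc _] := Ck1_derive u1; exact: pc. Qed.

Let fluxX j q := hgrad_norm u q `^ (p - 2) * vfX j u q.
Let fluxY j q := hgrad_norm u q `^ (p - 2) * vfY j u q.

Lemma hgrad_norm_continuous : continuous (hgrad_norm u).
Proof.
rewrite (_ : hgrad_norm u = fun q => Num.sqrt (gradsq du q)).
  move=> q; apply: (@for_comp _ _ (gradsq du)); last exact: sqrt_continuous.
  by apply: gradsq_continuous => i; exact: duc.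
by apply/funext => q; rewrite hgrad_normE.
Qed.

Lemma vfX_continuous j : continuous (vfX j u).
Proof. by move=> q; have [|c _] := @lift_continuous du q _ j => // i; exact: duc. Qed.

Lemma vfY_continuous j : continuous (vfY j u).
Proof. by move=> q; have [|_ c] := @lift_continuous du q _ j => // i; exact: duc. Qed.

Lemma flux_measurable j :
  measurable_fun setT (fun v : N.-tuple (measurableTypeR R) => fluxX j (rowt v)) /\
  measurable_fun setT (fun v : N.-tuple (measurableTypeR R) => fluxY j (rowt v)).
Proof.
have mg : measurable_fun setT (fun v : N.-tuple (measurableTypeR R) =>
    hgrad_norm u (rowt v) `^ (p - 2)).
  apply: (@measurableT_comp _ _ _ _ _ _ (fun x : R => x `^ (p - 2))); first exact: measurable_powR.
  exact: measurable_rowt hgrad_norm_continuous.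
split; apply: measurable_funM => //; apply: measurable_rowt.
  exact: vfX_continuous.
exact: vfY_continuous.
Qed.

(** Bounds the flux where the gradient is small, although for $p<2$ the factor $g^{p-2}$ alone is
    unbounded there. *)
Lemma flux_le (x g : R) : `|x| <= g -> `|g `^ (p - 2) * x| <= g `^ (p - 1).
Proof.
move=> xg; have g0 : 0 <= g := le_trans (normr_ge0 _) xg.
by rewrite normrM ger0_norm ?powR_ge0// -powR_sub2// ler_wpM2l// powR_ge0.
Qed.

Lemma flux_bounded (r : R) : exists2 C : R, 0 <= C & forall q, `|q| <= r ->
  (forall i, `|vfield fluxX fluxY i q| <= C) /\ `|b q| <= C.
Proof.
have [Cb Cb0 HCb] := ball_bounded r bc.
have [Cg Cg0 HCg] := ball_bounded r hgrad_norm_continuous.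
pose D := Cg `^ (p - 1).
have D0 : 0 <= D by exact: powR_ge0.
pose C := Cb + D + 2 * `|r| * D *+ (m + m).
have rD : 0 <= 2 * `|r| * D by rewrite !mulr_ge0.
have C0 : 0 <= C by rewrite !addr_ge0// mulrn_wge0.
exists C => // q qr.
have fl j : `|fluxX j q| <= D /\ `|fluxY j q| <= D.
  have gD : hgrad_norm u q `^ (p - 1) <= D.
    apply: ge0_ler_powR; rewrite ?nnegrE ?sqrtr_ge0//; first by rewrite subr_ge0 ltW.
    by rewrite (le_trans (ler_norm _))// HCg.
  have [lx ly] := lift_le_grad du q j; rewrite -hgrad_normE in lx ly.
  by split; apply: (le_trans (flux_le _)) gD.
have CD : D <= C by rewrite /C; have := mulrn_wge0 (m + m) rD; lra.
split=> [i|]; last first.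
  by rewrite (le_trans (HCb _ qr))// /C; have := mulrn_wge0 (m + m) rD; lra.
rewrite /vfield; case: fintype.split => [k|_].
  by case: fintype.split => j; rewrite (le_trans _ CD)//; have [] := fl j.
rewrite (le_trans (ler_norm_sum _ _ _))//.
apply: (@le_trans _ _ (\sum_(j < m) (2 * `|r| * D *+ 2))); last first.
  by rewrite sumr_const card_ord -mulrnA /C mul2n addnn; lra.
apply: ler_sum => j _; have [fx fy] := fl j.
have qk k : `|q 0 k| <= `|r| by rewrite (le_trans (coord_norm_le q k))// (le_trans qr)// ler_norm.
have qb k (y : R) : `|y| <= D -> `|2 * q 0 k * y| <= 2 * `|r| * D.
  move=> yD; rewrite -!mulrA normrM (@ger0_norm _ 2)// normrM ler_wpM2l//.
  by apply: ler_pM => //; exact: qk.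
by rewrite (le_trans (ler_normB _ _))// mulr2n; apply: lerD; exact: qb.
Qed.

Lemma weak_form_grad (c z : H -> R) q : weak_form (vfield fluxX fluxY) c z q =
  hgrad_norm u q `^ (p - 2) * hgrad_dot u z q + c q * z q.
Proof.
rewrite /weak_form (sum_vfield _ _ (fun i => partial i z)) /hgrad_dot mulr_sumr; congr (_ + _).
by apply: eq_bigr => j _; rewrite vfX_lift vfY_lift /fluxX /fluxY -!vfX_lift -!vfY_lift; ring.
Qed.

Lemma vfield_measurable i :
  measurable_fun setT (fun v : N.-tuple (measurableTypeR R) => vfield fluxX fluxY i (rowt v)).
Proof.
rewrite /vfield; case: fintype.split => [k|_].
  by case: fintype.split => j; have [] := flux_measurable j.
apply: measurable_sum => j; have [fx fy] := flux_measurable j.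
have mc k : measurable_fun setT (fun v : N.-tuple (measurableTypeR R) => 2 * rowt v 0 k).
  apply: (measurable_rowt (h := fun q : H => 2 * q 0 k)).
  by apply: ctsMl; exact: coord_continuous.
by apply: measurable_funB; exact: measurable_funM.
Qed.

Lemma heis_weak_C1 (z : H -> R) r : 0 <= r -> Ck 1 z -> off_ball r z -> (forall q, 0 <= z q) ->
  Rn_integral (weak_form (vfield fluxX fluxY) b z) <= 0.
Proof.
have mb : measurable_fun setT (fun v : N.-tuple (measurableTypeR R) => b (rowt v)).
  exact: measurable_rowt.
have bd := flux_bounded.
apply: weak_form_C1 => // [i|rho [rC rK] rho0].
  exact: vfield_measurable.
have [_ /(_ rho (conj rC rK) rho0)] := sol.
have r1 : Ck 1 rho by exact: rC.
have [r' ro] := test_function_off_ball (conj rC rK).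
have bd0 (s : R) : exists2 C : R, 0 <= C & forall q, `|q| <= s ->
  (forall i, `|vfield fluxX fluxY i q| <= C) /\ `|0 : R| <= C.
  have [C C0 HC] := bd s; exists C => // q /HC[]; rewrite normr0; split => //.
have bd1 (s : R) : exists2 C : R, 0 <= C & forall q, `|q| <= s ->
  (forall i : 'I_N, `|0 : R| <= C) /\ `|b q| <= C.
  by have [C C0 HC] := bd s; exists C => // q /HC[]; rewrite normr0; split.
have m0 : measurable_fun setT (fun v : N.-tuple (measurableTypeR R) => (0 : R)) by exact: measurable_cst.
(* The definition compares two separate integrals. They can be merged once each integrand is
   integrable, which follows by switching off the other coefficient. *)
have i1 := @weak_form_integrable R N (vfield fluxX fluxY) (fun=> 0) vfield_measurable
  m0 bd0 _ _ r1 ro.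
have i2 := @weak_form_integrable R N (fun _ _ => 0) b (fun=> m0) mb bd1 _ _ r1 ro.
have E1 v : weak_form (vfield fluxX fluxY) (fun=> 0) rho (rowt v) =
    hgrad_norm u (rowt v) `^ (p - 2) * hgrad_dot u rho (rowt v).
  by rewrite weak_form_grad mul0r addr0.
have E2 v : weak_form (fun (_ : 'I_N) _ => 0) b rho (rowt v) = b (rowt v) * rho (rowt v).
  by rewrite /weak_form big1 ?add0r// => i _; rewrite mul0r.
have -> : Rn_integral (weak_form (vfield fluxX fluxY) b rho) =
  Rn_integral (weak_form (vfield fluxX fluxY) (fun=> 0) rho) +
  Rn_integral (weak_form (fun (_ : 'I_N) _ => 0) b rho).
  rewrite -RintegralD//; congr Rintegral; apply/funext => v.
  by rewrite E1 E2 weak_form_grad.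
have -> : Rn_integral (weak_form (vfield fluxX fluxY) (fun=> 0) rho) =
    Rn_integral (fun q => hgrad_norm u q `^ (p - 2) * hgrad_dot u rho q).
  by congr Rintegral; apply/funext => v; rewrite E1.
have -> : Rn_integral (weak_form (fun (_ : 'I_N) _ => 0) b rho) =
    Rn_integral (fun q => b q * rho q).
  by congr Rintegral; apply/funext => v; rewrite E2.
rewrite /b; lra.
Qed.

Lemma weak_solution_C1 (z : H -> R) r : 0 <= r -> Ck 1 z -> off_ball r z -> (forall q, 0 <= z q) ->
  let I q := hgrad_norm u q `^ (p - 2) * hgrad_dot u z q + f (u q) * l (hgrad_norm u q) * z q in
  (lebesgue_Rn R N).-integrable setT (EFin \o fun v => I (rowt v)) /\ Rn_integral I <= 0.
Proof.
move=> r0 z1 zr z0 I.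
have E : weak_form (vfield fluxX fluxY) b z = I.
  by apply/funext => q; rewrite weak_form_grad.
have mb : measurable_fun setT (fun v : N.-tuple (measurableTypeR R) => b (rowt v)).
  exact: measurable_rowt.
have := heis_weak_C1 r0 z1 zr z0.
have := @weak_form_integrable R N (vfield fluxX fluxY) b vfield_measurable mb flux_bounded _ _ z1 zr.
by rewrite E.
Qed.

End Weak.
End HeisenbergFields.

(** * Horizontal divergence and comparison at a maximum point *)

Section Viscosity.
Context {R : realType} {m : nat}.
Local Notation N := (m + m + 1)%N.
Local Notation H := (heis R m).

Section Divergence.
Variables (a b : 'I_m -> H -> R) (da db : 'I_m -> 'I_N -> H -> R).

Definition hdiv (q : H) := \sum_j (liftX j (da j) q + liftY j (db j) q).

Let dvfield (i k : 'I_N) (q : H) : R :=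
  vfield (fun j => da j k) (fun j => db j k) i q +
  match fintype.split i with
  | inl _ => 0
  | inr _ => \sum_j (2 * (k == idx_y j)%:R * a j q - 2 * (k == idx_x j)%:R * b j q)
  end.

Lemma vfield_C1on B i : (forall j, C1on B (a j) (da j)) -> (forall j, C1on B (b j) (db j)) ->
  C1on B (vfield a b i) (dvfield i).
Proof.
move=> aB bB; rewrite /vfield /dvfield /vfield.
case: fintype.split => [k|_].
  have E0 (h : 'I_N -> H -> R) : (fun k q => h k q + 0) = h.
    by apply/funext => x; apply/funext => q; rewrite addr0.
  by case: fintype.split => j; rewrite E0.
have cc (h : H -> R) dh k c : C1on B h dh ->
    C1on B (fun q => c * (q 0 k * h q)) (fun i q => c * (q 0 k * dh i q + h q * (i == k)%:R)).
  by move=> hB; apply: C1on_scale; apply: C1on_mul => //; exact: C1on_coord.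
have D j : C1on B (fun q => 2 * (q 0 (idx_y j) * a j q) + (- 2) * (q 0 (idx_x j) * b j q)) _ :=
  C1on_add (cc _ _ (idx_y j) 2 (aB j)) (cc _ _ (idx_x j) (- 2) (bB j)).
have S := C1on_sum (index_enum 'I_m) D.
rewrite (_ : (fun q => _) = fun q : H => \sum_j (2 * (q 0 (idx_y j) * a j q) + (- 2) * (q 0 (idx_x j) * b j q))).
  rewrite (_ : (fun k q => _) = fun k (q : H) => \sum_j (2 * (q 0 (idx_y j) * da j k q + a j q * (k == idx_y j)%:R) +
     (- 2) * (q 0 (idx_x j) * db j k q + b j q * (k == idx_x j)%:R))); first exact: S.
  apply/funext => k; apply/funext => q; rewrite -big_split/=; apply: eq_bigr => j _; ring.
by apply/funext => q; apply: eq_bigr => j _; ring.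
Qed.

(** The $\partial_t$ component of a horizontal field has coefficients $2y_j$ and $-2x_j$,
    independent of $t$, so differentiating them contributes nothing to the Euclidean divergence. *)
Lemma hdivE q : \sum_i dvfield i i q = hdiv q.
Proof.
rewrite big_split/= [X in _ + X](_ : _ = 0) ?addr0; last first.
  rewrite sum_heis /hdiv.
  have sx j : fintype.split (idx_x j) = inl (lshift m j) by exact: (unsplitK (inl _)).
  have sy j : fintype.split (idx_y j) = inl (rshift m j) by exact: (unsplitK (inl _)).
  have st : fintype.split (idx_t m) = inr ord0 by exact: (unsplitK (inr _)).
  rewrite big1 ?add0r; last by move=> j _; rewrite sx sy addr0.
  rewrite st big1// => j _.
  have tl k : (idx_t m == lshift 1 k) = false.
    by apply/negP => /eqP/(congr1 (@fintype.split _ _)); rewrite st (unsplitK (inl k)).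
  by rewrite !tl !mulr0 !mul0r subrr.
rewrite sum_heis vfield_t -big_split/=; apply: eq_bigr => j _.
by rewrite vfield_x vfield_y /liftX /liftY; ring.
Qed.

(** The field is $C^1$ only on a ball around the support of [z]; its products with [z] are glued
    with 0 before integrating. *)
Lemma hdiv_parts (q0 : H) (d d' : R) z dz :
  d' < d -> 0 < d ->
  (forall j, C1on [set q | `|q - q0| < d] (a j) (da j)) ->
  (forall j, C1on [set q | `|q - q0| < d] (b j) (db j)) ->
  C1on setT z dz -> (forall q, d' < `|q - q0| -> z q = 0 /\ forall i, dz i q = 0) ->
  let I q := \sum_j (a j q * liftX j dz q + b j q * liftY j dz q) + hdiv q * z q in
  (lebesgue_Rn R N).-integrable setT (EFin \o fun v => I (rowt v)) /\ Rn_integral I = 0.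
Proof.
move=> dd d0 aB bB zC z0 I.
pose dh i k q := vfield a b i q * dz k q + z q * dvfield i k q.
have hC i : C1on setT (fun q => vfield a b i q * z q) (dh i).
  apply: (C1on_glue (q0 := q0) dd).
    by apply: C1on_mul; [exact: vfield_C1on|exact: C1on_sub zC].
  by move=> q /z0[z0q dz0]; rewrite z0q mulr0; split=> // k; rewrite /dh dz0 z0q mulr0 mul0r addr0.
have IE q : I q = \sum_i dh i i q.
  by rewrite /dh big_split/= -mulr_sumr hdivE sum_vfield mulrC.
have far q : `|q0| + d < `|q| -> d' < `|q - q0|.
  by have := lerB_dist q q0; lra.
have dhc i : continuous (dh i i) by move=> q; have [_ /(_ i)[]] := hC i q Logic.I.
have dho i : off_ball (`|q0| + d) (dh i i).
  by move=> q /far/z0[z0q dz0]; rewrite /dh z0q dz0 mulr0 mul0r addr0.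
have ii i := integrable_rowt (dhc i) (dho i).
have EI : EFin \o (fun v => I (rowt v)) =
    (fun v : N.-tuple (measurableTypeR R) => \sum_(i < N) (dh i i (rowt v))%:E)%E.
  by apply/funext => v; rewrite /= IE sumEFin.
split; first by rewrite EI; apply: integrable_sum => // i _; exact: ii.
rewrite /Rn_integral /Rintegral.
rewrite (_ : (fun v => _) = EFin \o (fun v => I (rowt v)))// EI integral_sum//.
rewrite big1// => i _; apply: (@integral_partial0 _ _ i (fun q => vfield a b i q * z q) _ (`|q0| + d)) => //.
  by move=> q; have [_ /(_ i)[]] := hC i q Logic.I.
by move=> q /far/z0[-> _]; rewrite mulr0.
Qed.

End Divergence.

(** Cauchy-Schwarz, from the sum of the squares of $C\,\xi-A\,\eta$ for vectors of lengths $A$ and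
    $C$; when $AC=0$ every summand vanishes. *)
Lemma lift_cauchy (dg dh : 'I_N -> H -> R) q :
  \sum_j (liftX j dg q * liftX j dh q + liftY j dg q * liftY j dh q) <=
  Num.sqrt (gradsq dg q) * Num.sqrt (gradsq dh q).
Proof.
set s := \sum_j _; set A := Num.sqrt (gradsq dg q); set C := Num.sqrt (gradsq dh q).
have A0 : 0 <= A by exact: sqrtr_ge0. have C0 : 0 <= C by exact: sqrtr_ge0.
have A2 : A ^+ 2 = gradsq dg q by rewrite sqr_sqrtr// gradsq_ge0.
have C2 : C ^+ 2 = gradsq dh q by rewrite sqr_sqrtr// gradsq_ge0.
have sq : 0 <= \sum_j ((C * liftX j dg q - A * liftX j dh q) ^+ 2 +
    (C * liftY j dg q - A * liftY j dh q) ^+ 2).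
  by apply: sumr_ge0 => j _; rewrite addr_ge0 ?sqr_ge0.
have E : \sum_j ((C * liftX j dg q - A * liftX j dh q) ^+ 2 +
    (C * liftY j dg q - A * liftY j dh q) ^+ 2) =
    C ^+ 2 * gradsq dg q + A ^+ 2 * gradsq dh q - 2 * A * C * s.
  by rewrite /gradsq /s !mulr_sumr -big_split/= -sumrB; apply: eq_bigr => j _; ring.
rewrite E -A2 -C2 in sq.
have key : 0 <= A * C * (A * C - s) by lra.
have [ac|ac] := ltP 0 (A * C); first by move: key; rewrite (pmulr_rge0 _ ac) subr_ge0.
have AC0 : A * C = 0 by apply/le_anti; rewrite ac mulr_ge0.
rewrite AC0 /s big1// => j _.
have [ax ay] := lift_le_grad dg q j; have [cx cy] := lift_le_grad dh q j.
move/eqP: AC0; rewrite mulf_eq0 => /orP[]/eqP AC0.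
  move: ax ay; rewrite -/A AC0 !normr_le0 => /eqP -> /eqP ->; lra.
move: cx cy; rewrite -/C AC0 !normr_le0 => /eqP -> /eqP ->; lra.
Qed.

(** Monotonicity of $\xi\mapsto|\xi|^{p-2}\xi$: by Cauchy-Schwarz the sum is at least
    $(A^{p-1}-C^{p-1})(A-C)$. *)
Lemma flux_monotone (p : R) (dg dh : 'I_N -> H -> R) q (A C : R) : 1 < p ->
  A = Num.sqrt (gradsq dg q) -> C = Num.sqrt (gradsq dh q) ->
  0 <= \sum_j ((A `^ (p - 2) * liftX j dg q - C `^ (p - 2) * liftX j dh q) * (liftX j dg q - liftX j dh q)
    + (A `^ (p - 2) * liftY j dg q - C `^ (p - 2) * liftY j dh q) * (liftY j dg q - liftY j dh q)).
Proof.
move=> p1 AE CE; have cs := lift_cauchy dg dh q; rewrite -AE -CE in cs.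
have A0 : 0 <= A by rewrite AE sqrtr_ge0.
have C0 : 0 <= C by rewrite CE sqrtr_ge0.
have A2 : A ^+ 2 = gradsq dg q by rewrite AE sqr_sqrtr// gradsq_ge0.
have C2 : C ^+ 2 = gradsq dh q by rewrite CE sqr_sqrtr// gradsq_ge0.
set s := \sum_j _ in cs *; set t := \sum_j _.
have -> : t = A `^ (p - 2) * gradsq dg q + C `^ (p - 2) * gradsq dh q -
    (A `^ (p - 2) + C `^ (p - 2)) * s.
  by rewrite /t /gradsq /s !mulr_sumr -big_split/= -sumrB; apply: eq_bigr => j _; ring.
rewrite -A2 -C2.
have sle : (A `^ (p - 2) + C `^ (p - 2)) * s <= (A `^ (p - 2) + C `^ (p - 2)) * (A * C).
  by rewrite ler_wpM2l// addr_ge0// powR_ge0.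
suff : 0 <= (A `^ (p - 1) - C `^ (p - 1)) * (A - C) by rewrite -!powR_sub2//; lra.
have mono (x y : R) : 0 <= x -> x <= y -> x `^ (p - 1) <= y `^ (p - 1).
  move=> x0 xy; apply: ge0_ler_powR => //; rewrite ?nnegrE//; last exact: le_trans xy.
  by rewrite subr_ge0 ltW.
case: (lerP A C) => [ac|/ltW ac]; first by rewrite mulr_le0// subr_le0// mono.
by rewrite mulr_ge0// subr_ge0// mono.
Qed.

Lemma integral_continuous_gt0 n (z : 'rV[R]_n -> R) (q : 'rV[R]_n) r : continuous z -> off_ball r z ->
  (forall q, 0 <= z q) -> 0 < z q -> 0 < Rn_integral z.
Proof.
move=> zc zr z0 zq.
have z2 : 0 < z q / 2 by rewrite divr_gt0.
have /continuousPe/(_ _ z2)[d d0 Hd] := zc q.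
pose A (i : 'I_n) : set (measurableTypeR R) := `[q 0 i - d / 2, q 0 i + d / 2]%classic.
have mA i : measurable (A i) by exact: measurable_itv.
have mD := measurable_tuple_box mA.
have D0 : (0 < lebesgue_Rn R n [set v | forall i, A i (tnth v i)])%E.
  have -> : (lebesgue_Rn R n [set v | forall i, A i (tnth v i)] =
      \prod_(i < n) @lebesgue_measure R (A i))%E.
    exact: (@tuple_measure_box _ _ _ [the {sigma_finite_measure set _ -> \bar R} of @lebesgue_measure R] n A mA).
  rewrite (_ : (\prod_(i < n) _)%E = (\prod_(i < n) d%:E)%E).
    by rewrite prodEFin lte_fin prodr_gt0.
  apply: eq_bigr => i _; rewrite lebesgue_measure_itv/= lte_fin ifT; last by lra.
  by rewrite -EFinD; congr EFin; lra.
have fin : (\int[lebesgue_Rn R n]_v (z (rowt v))%:E)%E \is a fin_num.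
  by apply: integrable_fin_num => //; exact: integrable_rowt zc zr.
rewrite /Rn_integral /Rintegral -lte_fin fineK//.
apply: (@integral_gt0 _ _ _ _ _ _ (z q / 2) mD D0 (measurable_rowt zc)) => //.
move=> v vA; have : `|z q - z (rowt v)| < z q / 2.
  apply: Hd; apply: (@le_lt_trans _ _ (d / 2)); last by lra.
  apply: row_norm_le => [|i]; first by lra.
  by have := vA i; rewrite /A/= !mxE in_itv/= ler_norml; lra.
by move=> /ltr_normlP[]; lra.
Qed.

Section Comparison.
Variables (p : R) (f l : R -> R) (u : H -> R).
Hypothesis p1 : 1 < p.
Hypothesis sol : weak_solution p f l u.
Let rhs q := f (u q) * l (hgrad_norm u q).
Hypothesis rhs_continuous : continuous rhs.

Variables (q0 : H) (d : R) (w : H -> R) (dw : 'I_N -> H -> R).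
Variables (a b : 'I_m -> H -> R) (da db : 'I_m -> 'I_N -> H -> R).
Let B := [set q : H | `|q - q0| < d].
Hypothesis d0 : 0 < d.
Hypothesis wC : C1on B w dw.
Hypothesis aC : forall j, C1on B (a j) (da j).
Hypothesis bC : forall j, C1on B (b j) (db j).
Hypothesis aE : forall j q, B q -> a j q = Num.sqrt (gradsq dw q) `^ (p - 2) * liftX j dw q.
Hypothesis bE : forall j q, B q -> b j q = Num.sqrt (gradsq dw q) `^ (p - 2) * liftY j dw q.
Hypothesis wmax : forall q, B q -> q <> q0 -> u q - w q < u q0 - w q0.

(** If the conclusion fails, [rhs] exceeds the divergence by [e] on a whole ball, by continuity.
    Testing the inequality for [u] and the divergence identity for [w] with the same [z] and
    subtracting leaves the integral of (flux of [u] minus flux of [w]) paired with the gradient of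
    [z], plus at least [e] times the integral of [z], and this is at most 0. The gradient of [z] is
    a non-negative multiple of that of [u - w], so the first part is non-negative by monotonicity,
    while the second is positive. *)
Lemma viscosity : rhs q0 <= hdiv da db q0.
Proof.
rewrite leNgt; apply/negP => lt_rhs; pose du i := partial i u.
have u1 : Ck 1 u by case: sol.
have uC : C1on setT u du := C1on_Ck1 u1.
have Bq0 : B q0 by rewrite /B/= subrr normr0.
pose e := (rhs q0 - hdiv da db q0) / 2.
have e0 : 0 < e by rewrite divr_gt0// subr_gt0.
have gc : {for q0, continuous (fun q => rhs q + -1 * hdiv da db q)}.
  apply: forD; first exact: rhs_continuous.
  apply: forM; first exact: cts_cst.
  apply: for_sum => j.
  have ca i : {for q0, continuous (da j i)} by have [_ /(_ i)[]] := aC j Bq0.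
  have cb i : {for q0, continuous (db j i)} by have [_ /(_ i)[]] := bC j Bq0.
  by apply: forD; [have [] := lift_continuous ca j|have [] := lift_continuous cb j].
have /continuousPe/(_ e e0)[r1 r10 Hr1] := gc.
(* The half keeps the closed ball of radius [r] inside [B], where [w] is defined as a $C^1$
   function. *)
pose r := Num.min r1 (d / 2).
have r0 : 0 < r by rewrite lt_min r10 divr_gt0.
have d_gt0 : 0 < d by exact: d0.
have dd2 : d / 2 < d by lra.
have rd : r < d by rewrite gt_min dd2 orbT.
have near_rhs q : `|q - q0| < r -> hdiv da db q + e <= rhs q.
  move=> qr; have : `|q0 - q| < r1.
    by rewrite distrC (lt_le_trans qr)// ge_min lexx.
  by move=> /Hr1/ltr_normlP[_ +]; rewrite /e; lra.
pose M := u q0 - w q0.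
(* By strictness of the maximum and compactness of the shell, [u - w] stays below [M] by a fixed gap
   there; the positive part of [u - w - M + eta] then vanishes on the shell and can be cut off. *)
have [eta eta0 Heta] : exists2 eta : R, 0 < eta &
    forall q, r / 2 < `|q - q0| < r -> u q - w q <= M - eta.
  pose K := [set q : H | r / 2 <= `|q - q0| <= r].
  have KB : K `<=` B by move=> q /= /andP[_ qr]; rewrite /B/= (le_lt_trans qr).
  have distc : continuous (fun q : H => `|q - q0|).
    move=> q; apply/continuousPe => x x0; exists x => // z qz.
    by rewrite (le_lt_trans (ler_dist_dist _ _))// opprB addrA subrK.
  have cK : compact K.
    apply: bounded_closed_compact.
      exists (`|q0| + r); split; first exact: num_real.
      move=> x rx q /= /andP[_ qr]; rewrite (le_trans _ (ltW rx))//.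
      by have := lerB_dist q q0; lra.
    rewrite (_ : K = [set q | r / 2 <= `|q - q0|] `&` [set q | `|q - q0| <= r]); last first.
      by apply/seteqP; split=> [q /= /andP[]|q /= [q1 q2]] //; apply/andP; split.
    apply: closedI.
      by apply: (@closed_comp _ _ (fun q : H => `|q - q0|) [set x : R | r / 2 <= x]) => [q _|];
        [exact: distc|exact: closed_ge].
    by apply: (@closed_comp _ _ (fun q : H => `|q - q0|) [set x : R | x <= r]) => [q _|];
      [exact: distc|exact: closed_le].
  have [[k Kk]|K0] := pselect (K !=set0); last first.
    by exists 1 => // q /andP[q1 q2]; exfalso; apply: K0; exists q; rewrite /K/= !ltW.
  have uwc : {within K, continuous (fun q => u q + -1 * w q)}.
    apply: continuous_in_subspaceT => q; rewrite inE => /KB Bq.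
    have [wc _] := wC Bq; have [uc _] := uC q Logic.I.
    suff : {for q, continuous (fun q : H => u q + -1 * w q)} by [].
    by apply: forD => //; apply: forM => //; exact: cts_cst.
  have [c /[!inE] Kc cmax] := EVT_max_rV (ex_intro _ k Kk) cK uwc.
  have cq0 : c <> q0.
    by move=> cq; move: Kc; rewrite cq /K/= subrr normr0; lra.
  exists (M - (u c - w c)); first by rewrite subr_gt0; apply: wmax => //; exact: KB.
  move=> q /andP[q1 q2]; have : q \in K by rewrite inE /K/= !ltW.
  by move=> /cmax; lra.
pose s (q : H) := u q + (-1 * w q + (eta - M)).
pose ds i (q : H) := du i q + (-1 * dw i q + 0).
have sC : C1on B s ds.
  apply: C1on_add; first exact: C1on_sub uC.
  by apply: C1on_add; [exact: C1on_scale|exact: C1on_cst].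
pose z (q : H) := if `|q - q0| < r then Num.max (s q) 0 ^+ 2 else 0.
pose dz i (q : H) := if `|q - q0| < r then 2 * Num.max (s q) 0 * ds i q else 0.
have s0 q : r / 2 < `|q - q0| < r -> Num.max (s q) 0 = 0.
  by move=> /Heta sq; rewrite max_r// /s; lra.
have z_far q : r / 2 < `|q - q0| -> z q = 0 /\ forall i, dz i q = 0.
  move=> q1; rewrite /z /dz; case: ifPn => // q2.
  by rewrite s0 ?q1// expr0n; split=> // i; rewrite mulr0 mul0r.
have r2 : r / 2 < r by lra.
have zC : C1on setT z dz.
  have sqC : C1on [set q : H | `|q - q0| < r] (fun q => Num.max (s q) 0 ^+ 2)
      (fun i q => 2 * Num.max (s q) 0 * ds i q).
    apply: (@C1on_comp _ _ _ s ds (fun x => Num.max x 0 ^+ 2) (fun x => 2 * Num.max x 0)).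
      by apply: C1on_sub sC => q /= qr; exact: lt_trans rd.
    move=> q _; split; first exact: sqr_pos_derive.
    by apply: ctsMl; exact: max0_continuous.
  exact: (C1on_glue r2 (C1on_ball_if sqC) z_far).
have z1 : Ck 1 z := C1onT_Ck1 zC.
have zge q : 0 <= z q by rewrite /z; case: ifPn => // _; exact: sqr_ge0.
have zoff : off_ball (`|q0| + r) z.
  by move=> q qr; have [] := z_far q _ => //; have := lerB_dist q q0; lra.
have ro0 : 0 <= `|q0| + r by rewrite addr_ge0// ltW.
have [i1 le1] := weak_solution_C1 p1 sol rhs_continuous ro0 z1 zoff zge.
have rd2 : r / 2 < d by lra.
have [i2 eq2] := hdiv_parts rd2 d0 aC bC zC z_far.
have zc : continuous z by case: z1.
have : 0 < Rn_integral z.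
  apply: (integral_continuous_gt0 (q := q0) zc zoff zge).
  by rewrite /z subrr normr0 r0 max_l ?exprn_gt0//; rewrite /s /M; lra.
have iz := integrable_rowt zc zoff.
suff : e * Rn_integral z <= 0 by rewrite pmulr_rle0// leNgt => /negP.
rewrite /Rn_integral -RintegralZl//.
apply: le_trans le1; rewrite -[leRHS]subr0 -eq2 /Rn_integral -RintegralB//.
apply: le_Rintegral => //.
- apply: (@integrable_rowt _ _ (`|q0| + r) (fun q => e * z q)) => [|q /zoff ->]; last by rewrite mulr0.
  by apply: ctsMl; exact: zc.
- exact: (integrableB measurableT i1 i2).
move=> v _; set q : H := \row_i tnth v i.
have [qr|qr] := ltP `|q - q0| r; last first.
  have [z0 dz0] : z q = 0 /\ forall i, dz i q = 0 by apply: z_far; lra.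
  have dzp i : partial i z q = 0 by rewrite (C1on_partial i zC).
  rewrite z0 /hgrad_dot !mulr0 !addr0 !big1 ?mulr0 ?subrr// => j _.
    by rewrite /liftX /liftY !dz0; ring.
  by rewrite /vfX /vfY !dzp; ring.
have Bq : B q by rewrite /B/= (lt_trans qr).
pose c := 2 * Num.max (s q) 0.
have c0 : 0 <= c by rewrite mulr_ge0// le_max lexx orbT.
have lx j : liftX j dz q = c * (liftX j du q - liftX j dw q).
  by rewrite /liftX /dz qr /ds -/c; ring.
have ly j : liftY j dz q = c * (liftY j du q - liftY j dw q).
  by rewrite /liftY /dz qr /ds -/c; ring.
have -> : hgrad_dot u z q = \sum_j (liftX j du q * liftX j dz q + liftY j du q * liftY j dz q).
  apply: eq_bigr => j _; rewrite !vfX_lift !vfY_lift /liftX /liftY.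
  by rewrite !(C1on_partial _ zC).
have mono := flux_monotone p1 (erefl (Num.sqrt (gradsq du q))) (erefl (Num.sqrt (gradsq dw q))).
have ez := near_rhs q qr.
rewrite hgrad_normE -/(rhs q).
have : 0 <= (rhs q - hdiv da db q - e) * z q by rewrite mulr_ge0//; lra.
have := mulr_ge0 c0 mono.
rewrite -hgrad_normE => m1 m2.
(* The flux of [w] against the gradient of [z] equals that of [u] minus the monotone quantity, so
   the difference of the two integrands keeps only non-negative terms. *)
have -> : \sum_j (a j q * liftX j dz q + b j q * liftY j dz q) =
  hgrad_norm u q `^ (p - 2) * (\sum_j (liftX j du q * liftX j dz q + liftY j du q * liftY j dz q)) -
  c * (\sum_j ((hgrad_norm u q `^ (p - 2) * liftX j du q - Num.sqrt (gradsq dw q) `^ (p - 2) * liftX j dw q) * (liftX j du q - liftX j dw q)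
    + (hgrad_norm u q `^ (p - 2) * liftY j du q - Num.sqrt (gradsq dw q) `^ (p - 2) * liftY j dw q) * (liftY j du q - liftY j dw q))).
  rewrite !mulr_sumr -sumrB; apply: eq_bigr => j _.
  by rewrite aE// bE// lx ly; ring.
rewrite /hgrad_norm in m1 m2 *; lra.
Qed.

End Comparison.
End Viscosity.

(** * Existence *)

Section ProfileSolution.
Context {R : realType} {m : nat}.
Local Notation N := (m + m + 1)%N.
Local Notation H := (heis R m).
Variables (p : R) (f l W V : R -> R) (j0 : 'I_m).
Hypothesis WV : is_profile p f l W V.
Hypothesis rhs_continuous : continuous (fun x => f (W x) * l `|V x|).

Let u (q : H) := W (q 0 (idx_x j0)).
Let x0 := idx_x j0.

Let uC : C1on setT u (fun i q => V (q 0 x0) * (i == x0)%:R).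
Proof.
have [_ _ Wd Vc _] := WV.
apply: (C1on_comp (C1on_coord x0)) => q _; split; [exact: Wd|exact: Vc].
Qed.

Let vfXu j q : vfX j u q = (j == j0)%:R * V (q 0 x0).
Proof. by rewrite vfX_lift /liftX !(C1on_partial _ uC)// idx_xx idx_tx /=; ring. Qed.

Let vfYu j q : vfY j u q = 0.
Proof. by rewrite vfY_lift /liftY !(C1on_partial _ uC)// idx_yx idx_tx /=; ring. Qed.

Let hgrad_dotu v q : hgrad_dot u v q = V (q 0 x0) * vfX j0 v q.
Proof.
rewrite /hgrad_dot (bigD1 j0)//= big1 ?addr0.
  by rewrite vfXu vfYu eqxx /=; ring.
by move=> j /negPf jj; rewrite vfXu vfYu jj /=; ring.
Qed.

Let hgrad_normu q : hgrad_norm u q = `|V (q 0 x0)|.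
Proof. by rewrite /hgrad_norm hgrad_dotu vfXu eqxx mul1r -expr2 sqrtr_sqr. Qed.

(** [u] depends on one horizontal coordinate, so its flux has the single component [phi] along
    $X_{j_0}$, whose divergence is the right-hand side by the profile equation. Integration by parts
    gives equality. *)
Lemma profile_weak_solution : weak_solution p f l u.
Proof.
split; first exact: C1onT_Ck1 uC.
move=> z [zk zK] z_ge0; have [_ _ _ Vc phid] := WV.
have z1 : Ck 1 z by exact: zk.
have [r zr] := test_function_off_ball (conj zk zK).
pose phi x := `|V x| `^ (p - 2) * V x.
pose dphi x := f (W x) * l `|V x|.
pose a (j : 'I_m) (q : H) := (j == j0)%:R * phi (q 0 x0).
pose da (j : 'I_m) (i : 'I_N) (q : H) := (j == j0)%:R * (dphi (q 0 x0) * (i == x0)%:R).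
have r0 : 0 < `|r| + 1 by rewrite ltr_wpDl.
have rr : `|r| < `|r| + 1 by rewrite ltrDl.
have aC j : C1on [set q : H | `|q - 0| < `|r| + 1] (a j) (da j).
  apply: C1on_scale; apply: (C1on_comp (C1on_coord x0)) => q _; split; first exact: phid.
  exact: rhs_continuous.
have bC (j : 'I_m) : C1on [set q : H | `|q - 0| < `|r| + 1] (fun=> 0) (fun _ _ => 0).
  exact: C1on_cst.
have zC := C1on_Ck1 z1.
have zfar q : `|r| < `|q - 0| -> z q = 0 /\ forall i, partial i z q = 0.
  rewrite subr0 => /(le_lt_trans (ler_norm r)) rq; split=> [|i]; first exact: zr.
  exact: (partial_off_ball i zr).
have [iI eI] := hdiv_parts rr r0 aC bC zC zfar.
have divE q : hdiv da (fun _ _ _ => 0) q = dphi (q 0 x0).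
  rewrite /hdiv (bigD1 j0)//= big1 ?addr0; last first.
    by move=> j /negPf jj; rewrite /liftX /liftY /da jj /=; ring.
  by rewrite /liftX /liftY /da !eqxx idx_tx /=; ring.
have zc : continuous z by case: z1.
have i2 : (lebesgue_Rn R N).-integrable setT (EFin \o fun v => (fun q : H => dphi (q 0 x0) * z q) (rowt v)).
  apply: (@integrable_rowt _ _ r (fun q : H => dphi (q 0 x0) * z q)) => [|q /zr ->]; last by rewrite mulr0.
  apply: ctsM => // q; apply: (@for_comp _ _ (fun q : H => q 0 x0) dphi).
    exact: coord_continuous.
  exact: rhs_continuous.
have -> : Rn_integral (fun q => f (u q) * l (hgrad_norm u q) * z q) =
    Rn_integral (fun q => dphi (q 0 x0) * z q).
  by congr Rn_integral; apply/funext => q; rewrite hgrad_normu.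
have -> : Rn_integral (fun q => hgrad_norm u q `^ (p - 2) * hgrad_dot u z q) =
    Rn_integral (fun q => (\sum_j (a j q * liftX j (fun i => partial i z) q + 0 * liftY j (fun i => partial i z) q)
      + hdiv da (fun _ _ _ => 0) q * z q) - dphi (q 0 x0) * z q).
  congr Rn_integral; apply/funext => q; rewrite divE addrK hgrad_normu hgrad_dotu.
  rewrite (bigD1 j0)//= big1 ?addr0; last by move=> j /negPf jj; rewrite /a jj /=; ring.
  by rewrite /a eqxx /phi vfX_lift /= mul0r addr0 mul1r mulrA.
move: eI; rewrite /Rn_integral => eI; rewrite RintegralB// eI sub0r opprK//.
Qed.

End ProfileSolution.

Section Existence.
Context {R : realType}.
Variables (m : nat) (p : R) (f l : R -> R) (B1 B2 mu : R).
Hypothesis m_gt0 : (1 <= m)%N.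
Hypothesis p1 : 1 < p.
Hypothesis cf : {within `[0, +oo[, continuous f}.
Hypothesis f_gt0 : forall t : R, 0 < t -> 0 < f t.
Hypothesis cl : {within `[0, +oo[, continuous l}.
Hypothesis l_gt0 : forall t : R, 0 < t -> 0 < l t.
Hypothesis lo : (fun t : R => t `^ (p - 1) / l t) x @[x --> 0^'+] --> 0.
Hypotheses (B1_gt0 : 0 < B1) (B2_gt0 : 0 < B2) (mu01 : 0 <= mu < 1).
Hypothesis l_le : forall t : R, 0 <= t -> l t <= B1 + B2 * t `^ mu.

Lemma exists_solution : ~ L1_at_pinfty (fun t => (KO_speed p f l t)^-1) ->
  exists u : heis R m -> R, [/\ forall q, 0 <= u q,
    ~ (exists c : R, forall q, u q = c) & weak_solution p f l u].
Proof.
pose g := KO_speed p f l.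
pose dg (y : R) := f y * l (g y) / ((p - 1) * g y `^ (p - 1)).
have g_gt0 (y : R) : 0 < y -> 0 < g y by exact: (KO_speed_gt0 p1 cf f_gt0 cl l_gt0 lo B1_gt0 B2_gt0 mu01 l_le).
have g_der (y : R) : 0 < y -> is_derive y 1 g (dg y).
  exact: (KO_speed_derive p1 cf f_gt0 cl l_gt0 lo B1_gt0 B2_gt0 mu01 l_le).
have [G G_der] : exists G : R -> R, forall y : R, 0 < y -> is_derive y 1 G (g y)^-1.
  apply: primitive_pos => x x0; apply: cvgV; first by rewrite gt_eqF// g_gt0.
  exact: is_derive_continuous (g_der _ x0).
move=> nL1.
have Gu (M : R) : exists2 y : R, 0 < y & M < G y.
  apply: contrapT => H; apply: nL1; apply/(L1_primitive_bounded g_gt0 g_der G_der).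
  by exists M => y y0; rewrite leNgt; apply/negP => My; apply: H; exists y.
(* Constant extensions to the left of 0, since the profiles are built from functions continuous on
   the whole line; nothing changes at the non-negative heights and speeds that occur. *)
pose fm (x : R) := f (Num.max x 0); pose lm (x : R) := l (Num.max x 0).
have fmE (x : R) : 0 <= x -> fm x = f x by move=> x0; rewrite /fm max_l.
have lmE (x : R) : 0 <= x -> lm x = l x by move=> x0; rewrite /lm max_l.
have fmc : continuous fm by exact: within_ge0_continuous_max.
have lmc : continuous lm by exact: within_ge0_continuous_max.
have dgE (y : R) : 0 < y -> dg y = fm y * lm (g y) / ((p - 1) * g y `^ (p - 1)).
  by move=> y0; rewrite fmE ?lmE// ltW// g_gt0.
have g_lt (x y : R) : 0 < x -> x < y -> g x < g y.
  exact: (KO_speed_lt p1 cf f_gt0 cl l_gt0 lo B1_gt0 B2_gt0 mu01 l_le).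
have g_small (e : R) : 0 < e -> exists2 y : R, 0 < y & g y < e.
  exact: (KO_speed_small p1 cf f_gt0 cl l_gt0 lo B1_gt0 B2_gt0 mu01 l_le).
have [W [V [W0 Wn Wd Vc phid]]] := profile_exists p1 fmc lmc g_gt0 g_der dgE g_lt g_small G_der Gu.
have rhsE x : f (W x) * l `|V x| = fm (W x) * lm `|V x| by rewrite fmE// lmE.
have WV : is_profile p f l W V by split=> // x; rewrite rhsE.
have rhsc : continuous (fun x => f (W x) * l `|V x|).
  rewrite (funext rhsE); apply: ctsM => x.
    by apply: (@for_comp _ _ W fm); [exact: is_derive_continuous (Wd x)|exact: fmc].
  apply: (@for_comp _ _ (fun x => `|V x|) lm); last exact: lmc.
  by apply: (@continuous_comp _ _ _ V (fun x : R => `|x|)); [exact: Vc|exact: norm_continuous].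
pose j0 := Ordinal m_gt0.
exists (fun q => W (q 0 (idx_x j0))); split=> //; last exact: profile_weak_solution WV rhsc.
move=> [c Wc]; have [x [y /eqP]] := Wn; apply.
have := Wc (\row_i x); have := Wc (\row_i y); rewrite !mxE => -> ->//.
Qed.

End Existence.

(** * The gauge *)

Section Gauge.
Context {R : realType} {m : nat}.
Local Notation N := (m + m + 1)%N.
Local Notation H := (heis R m).
Implicit Types (c q : H) (i : 'I_N) (j k : 'I_m).

Definition relx c k q : R := q 0 (idx_x k) - c 0 (idx_x k).
Definition rely c k q : R := q 0 (idx_y k) - c 0 (idx_y k).

(* Components of [c^-1 o q]: [relx], [rely] and, for the centre, [relt]. *)
Definition relt c q : R := q 0 (idx_t m) - c 0 (idx_t m) -
  2 * \sum_k (c 0 (idx_y k) * q 0 (idx_x k) - c 0 (idx_x k) * q 0 (idx_y k)).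
(** Squared horizontal distance; its zero set is the vertical axis through [c]. *)
Definition relsq c q : R := \sum_k (relx c k q ^+ 2 + rely c k q ^+ 2).
(** Fourth power of the gauge of $c^{-1}\circ q$. Unlike the gauge it is a polynomial, hence smooth
    at the centre too. *)
Definition gauge4 c q : R := relsq c q ^+ 2 + relt c q ^+ 2.

Definition drelx k i (q : H) : R := (i == idx_x k)%:R.
Definition drely k i (q : H) : R := (i == idx_y k)%:R.
Definition drelt c i (q : H) : R := (i == idx_t m)%:R -
  2 * \sum_k (c 0 (idx_y k) * (i == idx_x k)%:R - c 0 (idx_x k) * (i == idx_y k)%:R).
Definition drelsq c i q : R := \sum_k (2 * relx c k q * drelx k i q + 2 * rely c k q * drely k i q).
Definition dgauge4 c i q : R := 2 * relsq c q * drelsq c i q + 2 * relt c q * drelt c i q.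

Definition gaugeX c j q : R := 4 * (relsq c q * relx c j q + relt c q * rely c j q).
Definition gaugeY c j q : R := 4 * (relsq c q * rely c j q - relt c q * relx c j q).
Definition dgaugeX c j i q : R := 4 * (relsq c q * drelx j i q + relx c j q * drelsq c i q +
  relt c q * drely j i q + rely c j q * drelt c i q).
Definition dgaugeY c j i q : R := 4 * (relsq c q * drely j i q + rely c j q * drelsq c i q -
  relt c q * drelx j i q - relx c j q * drelt c i q).

Lemma relx_C1 B c k : C1on B (relx c k) (drelx k).
Proof.
have D := C1on_add (C1on_coord (B := B) (idx_x k)) (C1on_cst (B := B) (- c 0 (idx_x k))).
apply: C1on_ext D => //.
by move=> i q; rewrite addr0.
Qed.

Lemma rely_C1 B c k : C1on B (rely c k) (drely k).
Proof.
have D := C1on_add (C1on_coord (B := B) (idx_y k)) (C1on_cst (B := B) (- c 0 (idx_y k))).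
apply: C1on_ext D => //.
by move=> i q; rewrite addr0.
Qed.

Lemma relt_C1 B c : C1on B (relt c) (drelt c).
Proof.
have D k := C1on_add (C1on_scale (c 0 (idx_y k)) (C1on_coord (B := B) (idx_x k)))
  (C1on_scale (- c 0 (idx_x k)) (C1on_coord (idx_y k))).
have E := C1on_add (C1on_coord (B := B) (idx_t m)) (C1on_add (C1on_cst (B := B) (- c 0 (idx_t m)))
  (C1on_scale (- 2) (C1on_sum (index_enum 'I_m) D))).
apply: C1on_ext E => [q|i q].
  rewrite /relt mulNr addrA; congr (_ - 2 * _).
  by apply: eq_bigr => k _; rewrite mulNr.
rewrite /drelt mulNr add0r; congr (_ - 2 * _).
by apply: eq_bigr => k _; rewrite mulNr.
Qed.

Lemma relsq_C1 B c : C1on B (relsq c) (drelsq c).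
Proof.
have D k := C1on_add (C1on_mul (relx_C1 (B := B) c k) (relx_C1 c k))
  (C1on_mul (rely_C1 (B := B) c k) (rely_C1 c k)).
apply: C1on_ext (C1on_sum (index_enum 'I_m) D) => [q|i q]; apply: eq_bigr => k _; ring.
Qed.

Lemma gauge4_C1 B c : C1on B (gauge4 c) (dgauge4 c).
Proof.
apply: C1on_ext (C1on_add (C1on_mul (relsq_C1 (B := B) c) (relsq_C1 c))
  (C1on_mul (relt_C1 c) (relt_C1 c))) => [q|i q]; rewrite /gauge4 /dgauge4; ring.
Qed.

Lemma gaugeX_C1 B c j : C1on B (gaugeX c j) (dgaugeX c j).
Proof.
apply: C1on_ext (C1on_scale 4 (C1on_add (C1on_mul (relsq_C1 (B := B) c) (relx_C1 c j))
  (C1on_mul (relt_C1 c) (rely_C1 c j)))) => [q|i q]; rewrite /gaugeX /dgaugeX; ring.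
Qed.

Lemma gaugeY_C1 B c j : C1on B (gaugeY c j) (dgaugeY c j).
Proof.
apply: C1on_ext (C1on_scale 4 (C1on_add (C1on_mul (relsq_C1 (B := B) c) (rely_C1 c j))
  (C1on_scale (-1) (C1on_mul (relt_C1 c) (relx_C1 c j))))) => [q|i q]; rewrite /gaugeY /dgaugeY; ring.
Qed.

Let sum_delta (F : 'I_m -> R) j : \sum_k F k * (j == k)%:R = F j.
Proof.
rewrite (bigD1 j)//= eqxx mulr1 big1 ?addr0// => k /negPf kj.
by rewrite eq_sym kj mulr0.
Qed.

Let drelsqx c j q : drelsq c (idx_x j) q = 2 * relx c j q.
Proof.
rewrite -(sum_delta (fun k => 2 * relx c k q)); apply: eq_bigr => k _.
by rewrite /drelx /drely idx_xx idx_xy mulr0 addr0.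
Qed.

Let drelsqy c j q : drelsq c (idx_y j) q = 2 * rely c j q.
Proof.
rewrite -(sum_delta (fun k => 2 * rely c k q)); apply: eq_bigr => k _.
by rewrite /drelx /drely idx_yx idx_yy mulr0 add0r.
Qed.

Let drelsqt c q : drelsq c (idx_t m) q = 0.
Proof. by apply: big1 => k _; rewrite /drelx /drely idx_tx idx_ty !mulr0 addr0. Qed.

Let dreltx c j q : drelt c (idx_x j) q = - 2 * c 0 (idx_y j).
Proof.
rewrite /drelt idx_xt sub0r mulNr; congr (- (2 * _)).
rewrite -[RHS](sum_delta (fun k => c 0 (idx_y k))); apply: eq_bigr => k _.
by rewrite idx_xx idx_xy mulr0 subr0.
Qed.

Let drelty c j q : drelt c (idx_y j) q = 2 * c 0 (idx_x j).
Proof.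
rewrite /drelt idx_yt sub0r -mulrN; congr (2 * _); rewrite -sumrN.
rewrite -[RHS](sum_delta (fun k => c 0 (idx_x k))); apply: eq_bigr => k _.
by rewrite idx_yx idx_yy mulr0 sub0r opprK.
Qed.

Let dreltt c q : drelt c (idx_t m) q = 1.
Proof.
rewrite /drelt eqxx big1 ?mulr0 ?subr0// => k _.
by rewrite idx_tx idx_ty !mulr0 subr0.
Qed.

Lemma liftX_relsq c j q : liftX j (drelsq c) q = 2 * relx c j q.
Proof. by rewrite /liftX drelsqx drelsqt mulr0 addr0. Qed.

Lemma liftY_relsq c j q : liftY j (drelsq c) q = 2 * rely c j q.
Proof. by rewrite /liftY drelsqy drelsqt mulr0 subr0. Qed.

Lemma liftX_relt c j q : liftX j (drelt c) q = 2 * rely c j q.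
Proof. by rewrite /liftX dreltx dreltt /rely; ring. Qed.

Lemma liftY_relt c j q : liftY j (drelt c) q = - 2 * relx c j q.
Proof. by rewrite /liftY drelty dreltt /relx; ring. Qed.

Let liftX_relx j q : liftX j (drelx j) q = 1.
Proof. by rewrite /liftX /drelx eqxx idx_tx mulr0 addr0. Qed.

Let liftY_relx j q : liftY j (drelx j) q = 0.
Proof. by rewrite /liftY /drelx idx_yx idx_tx mulr0 subr0. Qed.

Let liftX_rely j q : liftX j (drely j) q = 0.
Proof. by rewrite /liftX /drely idx_xy idx_ty mulr0 addr0. Qed.

Let liftY_rely j q : liftY j (drely j) q = 1.
Proof. by rewrite /liftY /drely eqxx idx_ty mulr0 subr0. Qed.

Lemma liftX_gauge4 c j q : liftX j (dgauge4 c) q = gaugeX c j q.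
Proof.
have -> : liftX j (dgauge4 c) q = 2 * relsq c q * liftX j (drelsq c) q +
  2 * relt c q * liftX j (drelt c) q by rewrite /liftX /dgauge4; ring.
by rewrite liftX_relsq liftX_relt /gaugeX; ring.
Qed.

Lemma liftY_gauge4 c j q : liftY j (dgauge4 c) q = gaugeY c j q.
Proof.
have -> : liftY j (dgauge4 c) q = 2 * relsq c q * liftY j (drelsq c) q +
  2 * relt c q * liftY j (drelt c) q by rewrite /liftY /dgauge4; ring.
by rewrite liftY_relsq liftY_relt /gaugeY; ring.
Qed.

(** The mixed terms of the two squares cancel. For the gauge $\rho$ itself this reads
    $|\nabla\rho|^2=|z|^2/\rho^2\le 1$, with $|z|^2$ standing for [relsq]. *)
Lemma gauge_gradsq c q :
  \sum_j (gaugeX c j q ^+ 2 + gaugeY c j q ^+ 2) = 16 * gauge4 c q * relsq c q.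
Proof.
rewrite /relsq mulr_sumr; apply: eq_bigr => j _.
by rewrite /gaugeX /gaugeY /gauge4; ring.
Qed.

Lemma gauge_relsq c q :
  \sum_j (gaugeX c j q * liftX j (drelsq c) q + gaugeY c j q * liftY j (drelsq c) q) =
  8 * relsq c q ^+ 2.
Proof.
rewrite [in RHS]expr2 mulrA {2}/relsq mulr_sumr; apply: eq_bigr => j _.
by rewrite liftX_relsq liftY_relsq /gaugeX /gaugeY; ring.
Qed.

(** The sub-Laplacian of the fourth power of the gauge; the constant is $4(Q'+2)$ with $Q'=2m+2$ the
    homogeneous dimension. *)
Lemma gauge_laplacian c q :
  hdiv (dgaugeX c) (dgaugeY c) q = 8 * (m%:R + 2) * relsq c q.
Proof.
have E j : liftX j (dgaugeX c j) q + liftY j (dgaugeY c j) q =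
    8 * relsq c q + 16 * (relx c j q ^+ 2 + rely c j q ^+ 2).
  have -> : liftX j (dgaugeX c j) q = 4 * (relsq c q * liftX j (drelx j) q +
    relx c j q * liftX j (drelsq c) q + relt c q * liftX j (drely j) q +
    rely c j q * liftX j (drelt c) q) by rewrite /liftX /dgaugeX; ring.
  have -> : liftY j (dgaugeY c j) q = 4 * (relsq c q * liftY j (drely j) q +
    rely c j q * liftY j (drelsq c) q - relt c q * liftY j (drelx j) q -
    relx c j q * liftY j (drelt c) q) by rewrite /liftY /dgaugeY; ring.
  rewrite liftX_relx liftX_relsq liftX_rely liftX_relt liftY_rely liftY_relsq liftY_relx liftY_relt.
  ring.
rewrite /hdiv (eq_bigr _ (fun j _ => E j)) big_split/= -!mulr_sumr -/(relsq c q).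
by rewrite sumr_const card_ord -mulr_natr; ring.
Qed.

(** Half the differential of the identity [gauge_gradsq]. *)
Lemma dgauge_gradsq c i q :
  \sum_j (gaugeX c j q * dgaugeX c j i q + gaugeY c j q * dgaugeY c j i q) =
  8 * (gauge4 c q * drelsq c i q + relsq c q * dgauge4 c i q).
Proof.
pose s := relsq c q; pose t := relt c q; pose ds := drelsq c i q; pose dt := drelt c i q.
have E j : gaugeX c j q * dgaugeX c j i q + gaugeY c j q * dgaugeY c j i q =
    8 * (s ^+ 2 + t ^+ 2) * (2 * relx c j q * drelx j i q + 2 * rely c j q * drely j i q) +
    16 * (s * ds + t * dt) * (relx c j q ^+ 2 + rely c j q ^+ 2).
  by rewrite /gaugeX /gaugeY /dgaugeX /dgaugeY -/s -/t -/ds -/dt; ring.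
rewrite (eq_bigr _ (fun j _ => E j)) big_split/= -!mulr_sumr -/(relsq c q) -/(drelsq c i q).
by rewrite /gauge4 /dgauge4 -/s -/t -/ds -/dt; ring.
Qed.

Lemma relx_id c k : relx c k c = 0. Proof. exact: subrr. Qed.
Lemma rely_id c k : rely c k c = 0. Proof. exact: subrr. Qed.

Lemma relsq_id c : relsq c c = 0.
Proof. by apply: big1 => k _; rewrite relx_id rely_id expr0n addr0. Qed.

Lemma relt_id c : relt c c = 0.
Proof.
rewrite /relt subrr sub0r big1 ?mulr0 ?oppr0// => k _.
by rewrite mulrC subrr.
Qed.

Lemma gauge4_id c : gauge4 c c = 0.
Proof. by rewrite /gauge4 relsq_id relt_id expr0n addr0. Qed.

Lemma gaugeX_id c j : gaugeX c j c = 0.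
Proof. by rewrite /gaugeX relx_id rely_id !mulr0 addr0 mulr0. Qed.

Lemma gaugeY_id c j : gaugeY c j c = 0.
Proof. by rewrite /gaugeY relx_id rely_id !mulr0 subr0 mulr0. Qed.

Lemma dgaugeX_id c j i : dgaugeX c j i c = 0.
Proof. by rewrite /dgaugeX relsq_id relx_id relt_id rely_id; ring. Qed.

Lemma dgaugeY_id c j i : dgaugeY c j i c = 0.
Proof. by rewrite /dgaugeY relsq_id relx_id relt_id rely_id; ring. Qed.

Lemma relsq_ge0 c q : 0 <= relsq c q.
Proof. by apply: sumr_ge0 => k _; rewrite addr_ge0 ?sqr_ge0. Qed.

Lemma gauge4_ge0 c q : 0 <= gauge4 c q.
Proof. by rewrite addr_ge0 ?sqr_ge0. Qed.

Lemma relx_le c k q : `|relx c k q| <= Num.sqrt (relsq c q) /\ `|rely c k q| <= Num.sqrt (relsq c q).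
Proof.
have sums : 0 <= \sum_(j | j != k) (relx c j q ^+ 2 + rely c j q ^+ 2).
  by apply: sumr_ge0 => j _; rewrite addr_ge0 ?sqr_ge0.
by split; rewrite -sqrtr_sqr ler_wsqrtr// /relsq (bigD1 k)//=;
  [have := sqr_ge0 (rely c k q)|have := sqr_ge0 (relx c k q)]; lra.
Qed.

Lemma gauge4_eq0 c q : gauge4 c q = 0 -> q = c.
Proof.
move=> /eqP; rewrite paddr_eq0 ?sqr_ge0// !sqrf_eq0 => /andP[/eqP s0 /eqP t0].
have xc k : q 0 (idx_x k) = c 0 (idx_x k) /\ q 0 (idx_y k) = c 0 (idx_y k).
  have [] := relx_le c k q; rewrite s0 sqrtr0 !normr_le0 !subr_eq0.
  by move=> /eqP -> /eqP ->.
have tc : q 0 (idx_t m) = c 0 (idx_t m).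
  move: t0; rewrite /relt big1 ?mulr0 ?subr0; first by move/eqP; rewrite subr_eq0 => /eqP.
  by move=> k _; have [-> ->] := xc k; rewrite mulrC subrr.
apply/rowP => i; case: (split_ordP i) => k ->.
  by case: (split_ordP k) => k' ->; have [] := xc k'.
by rewrite ord1.
Qed.

End Gauge.

(** * Functions of the gauge near an off-axis maximum *)

Section RadialComparison.
Context {R : realType} {m : nat}.
Local Notation N := (m + m + 1)%N.
Local Notation H := (heis R m).
Variables (p : R) (f l : R -> R) (u : H -> R).
Hypothesis p1 : 1 < p.
Hypothesis sol : weak_solution p f l u.
Hypothesis rhs_continuous : continuous (fun q => f (u q) * l (hgrad_norm u q)).
Variables (c q0 : H) (beta b1 b2 : R -> R) (d : R).
Hypothesis d0 : 0 < d.
Hypothesis beta_derive : forall q, `|q - q0| < d ->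
  [/\ is_derive (gauge4 c q) 1 beta (b1 (gauge4 c q)),
      is_derive (gauge4 c q) 1 b1 (b2 (gauge4 c q)) & {for gauge4 c q, continuous b2}].
Hypothesis beta_max : forall q, `|q - q0| < d ->
  u q - beta (gauge4 c q) <= u q0 - beta (gauge4 c q0).
Hypothesis off_axis : 0 < relsq c q0.
Hypothesis b1_gt0 : 0 < b1 (gauge4 c q0).

Let B (r : R) := [set q : H | `|q - q0| < r].
(* The term [gauge4 q0] makes the maximum of [u - w] strict without changing
   the derivatives of [w] up to order two at [q0]. *)
Let w q := beta (gauge4 c q) + gauge4 q0 q.
Let dw (i : 'I_N) q := b1 (gauge4 c q) * dgauge4 c i q + dgauge4 q0 i q.
Let AX j q := b1 (gauge4 c q) * gaugeX c j q + gaugeX q0 j q.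
Let AY j q := b1 (gauge4 c q) * gaugeY c j q + gaugeY q0 j q.
Let dAX (j : 'I_m) (i : 'I_N) q := b1 (gauge4 c q) * dgaugeX c j i q +
  gaugeX c j q * (b2 (gauge4 c q) * dgauge4 c i q) + dgaugeX q0 j i q.
Let dAY (j : 'I_m) (i : 'I_N) q := b1 (gauge4 c q) * dgaugeY c j i q +
  gaugeY c j q * (b2 (gauge4 c q) * dgauge4 c i q) + dgaugeY q0 j i q.
Let E q := \sum_j (AX j q ^+ 2 + AY j q ^+ 2).
Let dE (i : 'I_N) q := \sum_j (2 * AX j q * dAX j i q + 2 * AY j q * dAY j i q).

Let liftX_dw j q : liftX j dw q = AX j q.
Proof. by rewrite /AX -!liftX_gauge4 /liftX /dw; ring. Qed.

Let liftY_dw j q : liftY j dw q = AY j q.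
Proof. by rewrite /AY -!liftY_gauge4 /liftY /dw; ring. Qed.

Let gradsq_dw q : gradsq dw q = E q.
Proof. by apply: eq_bigr => j _; rewrite liftX_dw liftY_dw. Qed.

Let wC : C1on (B d) w dw.
Proof.
apply: C1on_add (gauge4_C1 _); apply: (C1on_comp (dphi := b1) (gauge4_C1 c)) => q /beta_derive[b1d b2d _].
by split=> //; exact: is_derive_continuous b2d.
Qed.

Let b1C : C1on (B d) (fun q => b1 (gauge4 c q)) (fun i q => b2 (gauge4 c q) * dgauge4 c i q).
Proof.
by apply: (C1on_comp (gauge4_C1 c)) => q /beta_derive[_ b2d b2c].
Qed.

Let AXC j : C1on (B d) (AX j) (dAX j).
Proof. exact: C1on_add (C1on_mul b1C (gaugeX_C1 c j)) (gaugeX_C1 q0 j). Qed.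

Let AYC j : C1on (B d) (AY j) (dAY j).
Proof. exact: C1on_add (C1on_mul b1C (gaugeY_C1 c j)) (gaugeY_C1 q0 j). Qed.

Let EC : C1on (B d) E dE.
Proof.
have D j := C1on_add (C1on_mul (AXC j) (AXC j)) (C1on_mul (AYC j) (AYC j)).
by apply: C1on_ext (C1on_sum (index_enum 'I_m) D) => [q|i q]; apply: eq_bigr => j _; ring.
Qed.

Let n0 := gauge4 c q0.
Let s0 := relsq c q0.
Let e0 := b1 n0 ^+ 2 * (16 * n0 * s0).

Let n0_gt0 : 0 < n0.
Proof. by rewrite /n0 /gauge4 ltr_pwDl// ?sqr_ge0// exprn_gt0. Qed.

Let E0 : E q0 = e0.
Proof.
rewrite /e0 -gauge_gradsq mulr_sumr; apply: eq_bigr => j _.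
by rewrite /AX /AY gaugeX_id gaugeY_id; ring.
Qed.

Let e0_gt0 : 0 < e0.
Proof. by rewrite /e0 !mulr_gt0// exprn_gt0. Qed.

Let dE0 i : dE i q0 = 2 * b1 n0 ^+ 2 * (8 * (n0 * drelsq c i q0 + s0 * dgauge4 c i q0)) +
  2 * b1 n0 * b2 n0 * (16 * n0 * s0) * dgauge4 c i q0.
Proof.
rewrite -dgauge_gradsq -gauge_gradsq mulr_sumr [_ * \sum_j _]mulr_sumr mulr_suml -big_split/=.
apply: eq_bigr => j _.
by rewrite /AX /AY /dAX /dAY gaugeX_id gaugeY_id dgaugeX_id dgaugeY_id -/n0; ring.
Qed.

(** [E] is the squared length of the gradient of [w], so that $|\nabla w|^{p-2}=E^s$. *)
Let s := (p - 2) / 2.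

(** $\mathrm{div}(E^s\nabla w)=E^s\Delta w+sE^{s-1}\nabla w\cdot\nabla E$. At [q0] the terms of
    [gauge4 q0] drop out, and what remains reduces to the identities for the gauge. *)
Let radial_div : \sum_j (liftX j (fun i q => E q `^ s * dAX j i q + AX j q * (s * E q `^ (s - 1) * dE i q)) q0 +
    liftY j (fun i q => E q `^ s * dAY j i q + AY j q * (s * E q `^ (s - 1) * dE i q)) q0) =
  e0 `^ s * (s0 * (16 * (p - 1) * n0 * b2 n0 + (12 * (p - 1) + 4 * (m%:R *+ 2 + 1)) * b1 n0)).
Proof.
have lin j : liftX j (fun i q => E q `^ s * dAX j i q + AX j q * (s * E q `^ (s - 1) * dE i q)) q0 +
    liftY j (fun i q => E q `^ s * dAY j i q + AY j q * (s * E q `^ (s - 1) * dE i q)) q0 =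
    e0 `^ s * (liftX j (dAX j) q0 + liftY j (dAY j) q0) +
    s * e0 `^ (s - 1) * (AX j q0 * liftX j dE q0 + AY j q0 * liftY j dE q0).
  by rewrite /liftX /liftY E0; ring.
rewrite (eq_bigr _ (fun j _ => lin j)) big_split/= -!mulr_sumr.
have -> : \sum_j (liftX j (dAX j) q0 + liftY j (dAY j) q0) =
    b1 n0 * hdiv (dgaugeX c) (dgaugeY c) q0 +
    b2 n0 * \sum_j (gaugeX c j q0 ^+ 2 + gaugeY c j q0 ^+ 2).
  rewrite /hdiv !mulr_sumr -big_split/=; apply: eq_bigr => j _.
  rewrite !expr2 -[in X in _ = _ + _ * (_ * X + _)]liftX_gauge4 -[in X in _ = _ + _ * (_ + _ * X)]liftY_gauge4.
  by rewrite /liftX /liftY /dAX /dAY !dgaugeX_id !dgaugeY_id -/n0; ring.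
have -> : \sum_j (AX j q0 * liftX j dE q0 + AY j q0 * liftY j dE q0) =
   16 * b1 n0 ^+ 3 * n0 * (\sum_j (gaugeX c j q0 * liftX j (drelsq c) q0 + gaugeY c j q0 * liftY j (drelsq c) q0))
   + (16 * b1 n0 ^+ 3 * s0 + 2 * b1 n0 ^+ 2 * b2 n0 * (16 * n0 * s0)) *
     \sum_j (gaugeX c j q0 ^+ 2 + gaugeY c j q0 ^+ 2).
  rewrite [X in _ = X + _]mulr_sumr [X in _ = _ + X]mulr_sumr -big_split/=; apply: eq_bigr => j _.
  rewrite !expr2 -[in X in _ = _ + _ * (_ * X + _)]liftX_gauge4 -[in X in _ = _ + _ * (_ + _ * X)]liftY_gauge4.
  by rewrite /liftX /liftY !dE0 /AX /AY gaugeX_id gaugeY_id -/n0; ring.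
rewrite gauge_laplacian gauge_relsq gauge_gradsq -/n0 -/s0.
have -> : e0 `^ s = e0 `^ (s - 1) * e0.
  rewrite -[X in _ * X](powRr1 (ltW e0_gt0)) -powRD ?(gt_eqF e0_gt0) ?implybT//.
  by congr (_ `^ _); ring.
by rewrite /e0 /s; field.
Qed.

(** Off the axis the gradient of [w] at [q0] is not zero, so on a smaller ball [E] is positive and
    $E^s$ is $C^1$ whatever the sign of $p-2$. Only then is the flux of [w] an admissible field for
    [viscosity]. *)
Lemma radial_viscosity : f (u q0) * l (hgrad_norm u q0) <=
  e0 `^ s * (s0 * (16 * (p - 1) * n0 * b2 n0 + (12 * (p - 1) + 4 * (m%:R *+ 2 + 1)) * b1 n0)).
Proof.
have Bq0 : B d q0 by rewrite /B/= subrr normr0.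
have [Ec _] := EC Bq0.
have e2 : 0 < e0 / 2 by rewrite divr_gt0.
have /continuousPe/(_ _ e2)[r1 r10 Hr1] := Ec.
pose r := Num.min d r1.
have r0 : 0 < r by rewrite lt_min d0.
have Bd : B r `<=` B d.
  by move=> q; rewrite /B/= => qr; rewrite (lt_le_trans qr)// ge_min lexx.
have E_gt0 q : B r q -> 0 < E q.
  rewrite /B/= => qr; have : `|q0 - q| < r1 by rewrite distrC (lt_le_trans qr)// ge_min lexx orbT.
  move=> /Hr1/ltr_normlP[_ +]; rewrite E0; have := e0_gt0; lra.
have powE (t x : R) : 0 < x -> is_derive x 1 (fun x => x `^ t) (t * x `^ (t - 1)).
  exact: is_derive1_powR.
have EsC : C1on (B r) (fun q => E q `^ s) (fun i q => s * E q `^ (s - 1) * dE i q).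
  apply: (@C1on_comp _ _ _ E dE (fun x => x `^ s) (fun x => s * x `^ (s - 1))).
    exact: C1on_sub EC.
  move=> q /E_gt0 Eq; split; first exact: powE.
  apply: forM; first exact: cts_cst.
  exact: is_derive_continuous (powE _ _ Eq).
rewrite -radial_div; apply: (viscosity (d := r) (w := w) (dw := dw)
  (a := fun j q => E q `^ s * AX j q) (b := fun j q => E q `^ s * AY j q) p1 sol rhs_continuous) => //.
- exact: C1on_sub wC.
- by move=> j; apply: C1on_mul EsC _; exact: C1on_sub (AXC j).
- by move=> j; apply: C1on_mul EsC _; exact: C1on_sub (AYC j).
- move=> j q /E_gt0 Eq; rewrite liftX_dw gradsq_dw -powR12_sqrt ?ltW// -powRrM.
  by congr (_ `^ _ * _); rewrite /s mulrC.
- move=> j q /E_gt0 Eq; rewrite liftY_dw gradsq_dw -powR12_sqrt ?ltW// -powRrM.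
  by congr (_ `^ _ * _); rewrite /s mulrC.
move=> q /Bd/beta_max qmax qq0; rewrite /w gauge4_id addr0.
have : 0 < gauge4 q0 q.
  by rewrite lt_neqAle gauge4_ge0 andbT eq_sym; apply/eqP => /gauge4_eq0.
lra.
Qed.

(** First-order condition at the maximum, along each coordinate line. *)
Lemma radial_grad_norm : hgrad_norm u q0 = Num.sqrt e0.
Proof.
have u1 : Ck 1 u by case: sol.
have uC : C1on setT u (fun i => partial i u) := C1on_Ck1 u1.
have gC : C1on (B d) (fun q => beta (gauge4 c q)) (fun i q => b1 (gauge4 c q) * dgauge4 c i q).
  apply: (C1on_comp (gauge4_C1 c)) => q /beta_derive[b1d b2d _].
  by split=> //; exact: is_derive_continuous b2d.
have Bq0 : B d q0 by rewrite /B/= subrr normr0.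
have crit i : partial i u q0 = b1 n0 * dgauge4 c i q0.
  pose h (t : R) := u (t *: delta_mx 0 i + q0) + -1 * beta (gauge4 c (t *: delta_mx 0 i + q0)).
  have inB (t : R) : t \in `](- d), d[ -> B d (t *: delta_mx 0 i + q0).
    rewrite in_itv/= -ltr_norml => td; rewrite /B/= addrK; apply: row_norm_lt => // k.
    by rewrite !mxE eqxx/=; case: (k == i); rewrite ?mulr1// mulr0 normr0.
  have hd (t : R) : t \in `](- d), d[ -> is_derive t 1 h
      (partial i u (t *: delta_mx 0 i + q0) +
       -1 * (b1 (gauge4 c (t *: delta_mx 0 i + q0)) * dgauge4 c i (t *: delta_mx 0 i + q0))).
    move=> /inB Bt; have [_ /(_ i)[ud _]] := uC _ (Logic.I : setT (t *: delta_mx 0 i + q0)).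
    have [_ /(_ i)[bd _]] := gC _ Bt.
    have bd' := @is_deriveZ _ _ _ _ (-1) _ _ _ bd.
    have /(is_derive_line (fun q => u q + -1 * beta (gauge4 c q))) := is_deriveD ud bd'.
    by [].
  have dd : - d < d by have := d0; lra.
  have z_in : (0 : R) \in `](- d), d[ by rewrite in_itv/= oppr_lt0 d0.
  have h0 : is_derive (0 : R) 1 h 0.
    apply: (derive1_at_max (ltW dd)) => //; first by move=> t /hd[].
    move=> t /inB/beta_max; rewrite /h scale0r add0r; lra.
  have [_ E1] := h0; have [_ E2] := hd _ z_in.
  by move: E1; rewrite E2 scale0r add0r -/n0; lra.
rewrite hgrad_normE /gradsq /e0 -gauge_gradsq mulr_sumr; congr Num.sqrt; apply: eq_bigr => j _.
rewrite -liftX_gauge4 -liftY_gauge4 /liftX /liftY !crit; ring.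
Qed.

End RadialComparison.

(** * The radial barrier *)

Section Barrier.
Context {R : realType}.
Variables (p : R) (f l g dg G : R -> R) (C : R).
Hypothesis p1 : 1 < p.
Hypothesis f_gt0 : forall t : R, 0 < t -> 0 < f t.
Hypothesis f_lt : forall x y : R, 0 <= x -> x < y -> f x < f y.
Hypothesis fc : forall t : R, 0 < t -> {for t, continuous f}.
Hypothesis l_gt0 : forall t : R, 0 < t -> 0 < l t.
Hypothesis lc : forall t : R, 0 < t -> {for t, continuous l}.
Hypothesis lC : forall s t : R, 0 <= s -> s <= t -> l s <= C * l t.
Hypothesis lo : (fun t : R => t `^ (p - 1) / l t) x @[x --> 0^'+] --> 0.
Hypothesis g_gt0 : forall y : R, 0 < y -> 0 < g y.
Hypothesis g_der : forall y : R, 0 < y -> is_derive y 1 g (dg y).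
Hypothesis dgE : forall y : R, 0 < y -> dg y = f y * l (g y) / ((p - 1) * g y `^ (p - 1)).
Hypothesis g_lt : forall x y : R, 0 < x -> x < y -> g x < g y.
Hypothesis g_small : forall e : R, 0 < e -> exists2 y : R, 0 < y & g y < e.
Hypothesis G_der : forall y : R, 0 < y -> is_derive y 1 G (g y)^-1.
Variable Gmax : R.
Hypothesis G_le : forall y : R, 0 < y -> G y <= Gmax.

(* Off the axis, [a] of the gauge has [p]-Laplacian at most [k * Lambda * f(a) l(|grad|)],
   [Lambda] being the constant of [l]; [Q] is the homogeneous dimension minus one. *)
Definition is_barrier (Q k r0 s1 eta A : R) (a a1 a2 : R -> R) :=
  [/\ (forall s, s <= r0 -> a s = eta) /\ (forall s, s1 <= s -> a s = A),
    forall s t, s <= t -> a s <= a t,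
    exists2 L, 0 <= L & forall s t, `|a s - a t| <= L * `|s - t|,
    forall s, r0 < s < s1 -> [/\ is_derive s 1 a (a1 s), is_derive s 1 a1 (a2 s),
      {for s, continuous a2} & 0 < a1 s] &
    forall s, r0 < s < s1 ->
      (p - 1) * a1 s `^ (p - 2) * a2 s + Q * a1 s `^ (p - 1) / s <= k * (f (a s) * l (a1 s))].

Let w := primitive_inv G.
Let wK (y : R) : 0 < y -> w (G y) = y.
Proof. exact: primitive_invK. Qed.
Let G_lt (x y : R) : 0 < x -> x < y -> G x < G y.
Proof. exact: primitive_lt. Qed.
Let f_le (x y : R) : 0 <= x -> x <= y -> f x <= f y.
Proof. by move=> x0; rewrite le_eqVlt => /predU1P[->//|/(f_lt x0)/ltW]. Qed.
Let g_le (x y : R) : 0 < x -> x <= y -> g x <= g y.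
Proof. by move=> x0; rewrite le_eqVlt => /predU1P[->//|/(g_lt x0)/ltW]. Qed.

(** Integrates the flux equation by the mean value theorem and estimates its right-hand side at the
    upper end; comparing values of [l] costs the factor [C]. It controls the first-order term of the
    radial operator. *)
Lemma flux_growth (y0 y : R) : 0 < y0 -> y0 < y ->
  g y `^ (p - 1) <= g y0 `^ (p - 1) + (G y - G y0) * (f y * (C * l (g y))).
Proof.
move=> y0_gt0 yy; have y_gt0 := lt_trans y0_gt0 yy.
have fd (z : R) : 0 < z -> is_derive (G z) 1 (fun x => g (w x) `^ (p - 1)) (f z * l (g z)).
  exact: flux_derive.
have IV (x : R) : G y0 < x < G y -> exists2 z, y0 <= z <= y & G z = x.
  move=> /andP[x1 x2]; apply: (primitive_IVT G_der y0_gt0 (ltW yy)).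
  by rewrite !ltW.
have fd' (x : R) : G y0 < x < G y ->
    is_derive x 1 (fun x => g (w x) `^ (p - 1)) (f (w x) * l (g (w x))).
  move=> /IV[z /andP[z1 _] <-]; have z0 := lt_le_trans y0_gt0 z1.
  by rewrite wK//; exact: fd.
have [x xy] := MVT_oo (G_lt y0_gt0 yy) fd' (is_derive_continuous (fd _ y0_gt0))
  (is_derive_continuous (fd _ y_gt0)).
have [z /andP[z1 z2] zx] := IV _ xy; have z0 := lt_le_trans y0_gt0 z1.
rewrite -zx !wK// => E; rewrite -lerBlDl E mulrC ler_wpM2l//.
  by rewrite subr_ge0 ltW// G_lt.
apply: ler_pM; [exact/ltW/f_gt0|exact/ltW/l_gt0/g_gt0|exact: f_le (ltW z0) z2|].
by apply: lC; [exact/ltW/g_gt0|exact: g_le].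
Qed.

Section Scaled.
Variables (sg eta A r0 : R).
Hypotheses (sg_gt0 : 0 < sg) (sg_le1 : sg <= 1) (eta_gt0 : 0 < eta) (etaA : eta < A) (r0_gt0 : 0 < r0).

(** [al] below is the dilate $w(\sigma s+\mathrm{const})/\sigma$. Its slope is $g(Y)$, and its flux
    has derivative $\sigma f(\sigma\,al)\,l(al')\le\sigma f(al)\,l(al')$: the factor $\sigma$ makes
    it nearly a solution of the homogeneous equation. *)
Let Y (s : R) := w (sg * (s - r0) + G (sg * eta)).
Definition barrier_end := r0 + (G (sg * A) - G (sg * eta)) / sg.
Let s1 := barrier_end.

Let sgeta : 0 < sg * eta. Proof. exact: mulr_gt0. Qed.
Let sgA : sg * eta < sg * A. Proof. by rewrite ltr_pM2l. Qed.

Let YP (s : R) : r0 <= s <= s1 -> [/\ sg * eta <= Y s <= sg * A & G (Y s) = sg * (s - r0) + G (sg * eta)].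
Proof.
move=> /andP[rs ss].
have [|y yb Gy] := primitive_IVT G_der sgeta (ltW sgA) (x := sg * (s - r0) + G (sg * eta)).
  have q1 : 0 <= sg * (s - r0) by rewrite mulr_ge0 ?subr_ge0// ltW.
  have q2 : sg * (s - r0) <= G (sg * A) - G (sg * eta).
    by rewrite mulrC -ler_pdivlMr//; move: ss; rewrite /s1 /barrier_end; lra.
  by apply/andP; split; lra.
have y0 : 0 < y by case/andP: yb => /(lt_le_trans sgeta).
by rewrite /Y -Gy wK.
Qed.

Let Y_gt0 (s : R) : r0 <= s <= s1 -> 0 < Y s.
Proof. by move=> /YP[/andP[/(lt_le_trans sgeta)]]. Qed.

Let Y_derive (s : R) : r0 <= s <= s1 -> is_derive s 1 Y (g (Y s) * sg).
Proof.
move=> ss; have [_ GY] := YP ss; have Y0 := Y_gt0 ss.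
have D1 := primitive_inv_derive g_gt0 G_der Y0; rewrite GY in D1.
have D2 : is_derive s 1 (fun s : R => sg * (s - r0) + G (sg * eta)) sg.
  have H : is_derive s 1 (sg \*: (id - cst r0) + cst (G (sg * eta))) (sg *: (1 - 0) + 0) by apply: is_deriveD.
  by rewrite subr0 addr0 [sg *: 1]mulr1 in H.
exact: (@is_derive1_comp _ (primitive_inv G) (fun s : R => sg * (s - r0) + G (sg * eta)) s _ _ D1 D2).
Qed.

Let al (s : R) := Y s / sg.

Let al_derive (s : R) : r0 <= s <= s1 -> is_derive s 1 al (g (Y s)).
Proof.
move=> ss; have H := is_deriveZ sg^-1 (Y_derive ss).
rewrite (_ : _ *: _ = g (Y s)) in H; last by rewrite /GRing.scale/=; field; rewrite gt_eqF.
by rewrite (_ : al = sg^-1 \*: Y)//; apply/funext => z; rewrite /al mulrC.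
Qed.

Let al_r0 : al r0 = eta.
Proof. by rewrite /al /Y subrr mulr0 add0r wK// mulrC mulKf// gt_eqF. Qed.

Let al_s1 : al s1 = A.
Proof.
have sA : 0 < sg * A := lt_trans sgeta sgA.
rewrite /al /Y /s1 /barrier_end (_ : sg * _ + _ = G (sg * A)); first by rewrite wK// mulrC mulKf// gt_eqF.
by field; rewrite gt_eqF.
Qed.

Let r0s1 : r0 < s1.
Proof. by rewrite /s1 /barrier_end ltrDl divr_gt0// subr_gt0 G_lt. Qed.

Let al_diff (s t : R) : r0 <= s -> s <= t -> t <= s1 ->
  0 <= al t - al s <= g (sg * A) * (t - s).
Proof.
move=> rs; rewrite le_eqVlt => /predU1P[<- _|st ts]; first by rewrite !subrr mulr0 lexx.
have I z : s <= z <= t -> r0 <= z <= s1.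
  by move=> /andP[sz zt]; rewrite (le_trans rs sz) (le_trans zt ts).
have ss : s <= s <= t by rewrite lexx ltW.
have tt : s <= t <= t by rewrite lexx ltW.
have D z : s < z < t -> is_derive z 1 al (g (Y z)).
  by move=> /andP[sz zt]; apply: al_derive; apply: I; rewrite !ltW.
have [z /andP[sz zt] ->] := MVT_oo st D (is_derive_continuous (al_derive (I _ ss)))
  (is_derive_continuous (al_derive (I _ tt))).
have Iz : r0 <= z <= s1 by apply: I; rewrite !ltW.
have [/andP[_ YA] _] := YP Iz; have Yz := Y_gt0 Iz.
have ts0 : 0 <= t - s by rewrite subr_ge0 ltW.
apply/andP; split; first by rewrite mulr_ge0// ltW// g_gt0.
by rewrite ler_wpM2r// g_le.
Qed.

Let cl (s : R) := Num.max r0 (Num.min s s1).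
Let cl_in (s : R) : r0 <= cl s <= s1.
Proof. by rewrite /cl le_max lexx/= ge_max ge_min lexx orbT ltW. Qed.
Let cl_le (s t : R) : s <= t -> 0 <= cl t - cl s <= t - s.
Proof.
move=> st; have := r0s1; rewrite /cl; case: (leP s s1); case: (leP t s1) => //= h1 h2;
  case: (leP r0 s) => h3; case: (leP r0 t) => h4; case: (leP r0 s1) => h5; move=> *; lra.
Qed.

(** Clamping the argument makes the barrier constant before [r0] and after [s1], hence globally
    Lipschitz, and the maximum can be taken over a ball without boundary terms. *)
Definition barrier (s : R) := al (cl s).

Let eq_barrier (s : R) : r0 < s < s1 -> \forall z \near s, al z = barrier z.
Proof.
move=> /andP[rs ss]; have := near_gt rs; have := near_lt ss; apply: filterS2 => z z1 z2.
by rewrite /barrier /cl min_l ?max_r ?ltW.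
Qed.

(** The three summands of the factor: the second-order part of the operator gives [sg]. In
    $Q\,a'^{p-1}/s$, the growth of the flux since [r0] gives [Q * C * sg], as $s-r_0\le s$ cancels
    the division by $s$. The initial flux gives the last one, through $s\ge r_0$ and $f(a)\ge
    f(\eta)$. *)
Lemma barrier_is_barrier (Q eps : R) : 0 <= C -> 0 <= Q ->
  g (sg * eta) `^ (p - 1) <= eps * l (g (sg * eta)) -> 0 <= eps ->
  is_barrier Q (sg + Q * C * sg + Q * C * eps / (r0 * f eta)) r0 s1 eta A
    barrier (g \o Y) (fun s => dg (Y s) * (g (Y s) * sg)).
Proof.
move=> C0 Q0 small eps0; split.
- split=> s ss; rewrite /barrier /cl.
    have ss1 : s <= s1 by rewrite (le_trans ss)// ltW.
    by rewrite min_l// max_l.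
  by rewrite min_r// max_r// ltW.
- move=> s t st; have /andP[c1 c2] := cl_le st.
  have /andP[cs _] := cl_in s; have /andP[_ ct] := cl_in t.
  have cst : cl s <= cl t by rewrite -subr_ge0.
  by have /andP[+ _] := al_diff cs cst ct; rewrite subr_ge0.
- have gA0 : 0 <= g (sg * A) by rewrite ltW// g_gt0// (lt_trans sgeta).
  exists (g (sg * A)) => // s t.
  wlog st : s t / s <= t.
    by move=> H; case: (leP s t) => [/H//|/ltW/H]; rewrite distrC (distrC s).
  have /andP[c1 c2] := cl_le st.
  have /andP[cs _] := cl_in s; have /andP[_ ct] := cl_in t.
  have cst : cl s <= cl t by rewrite -subr_ge0.
  have /andP[d1 d2] := al_diff cs cst ct.
  rewrite distrC ger0_norm// (le_trans d2)// (distrC s) [in leRHS]ger0_norm ?subr_ge0//.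
  exact: ler_wpM2l.
- move=> s ss; have ss' : r0 <= s <= s1 by case/andP: ss => ? ?; rewrite !ltW.
  have Y0 := Y_gt0 ss'; have Yd := Y_derive ss'; have Yc := is_derive_continuous Yd.
  have gc : {for s, continuous (g \o Y)}.
    by apply: (@for_comp _ _ Y g) => //; exact: is_derive_continuous (g_der Y0).
  split.
  + by apply: near_eq_is_derive (al_derive ss'); exact: eq_barrier.
  + exact: (is_derive1_comp (g_der Y0) Yd).
  + have E : (fun y => f y * l (g y) / ((p - 1) * g y `^ (p - 1))) =
      (fun y => f y * (l (g y) * ((p - 1) * g y `^ (p - 1))^-1)).
      by apply/funext => y; rewrite mulrA.
    have dgc : {for Y s, continuous dg}.
      apply: (near_pos_eq_continuous (f := fun y => f y * l (g y) / ((p - 1) * g y `^ (p - 1)))) => //.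
        by move=> y y0; rewrite dgE.
      have gYc := is_derive_continuous (g_der Y0); have gY0 := g_gt0 Y0.
      rewrite E; apply: forM; first exact: fc.
      apply: forM; first by apply: (@for_comp _ _ g l) => //; exact: lc.
      apply: (@for_comp _ _ (fun y => (p - 1) * g y `^ (p - 1)) (fun x : R => x^-1)).
        apply: forM; first exact: cts_cst.
        apply: (@for_comp _ _ g (fun x : R => x `^ (p - 1))) => //.
        exact: is_derive_continuous (is_derive1_powR _ gY0).
      by apply: inv_continuous; rewrite gt_eqF// mulr_gt0 ?powR_gt0// subr_gt0.
    apply: forM; first by apply: (@for_comp _ _ Y dg).
    by apply: forM => //; exact: cts_cst.
  + exact: g_gt0.
move=> s ss; have ss' : r0 <= s <= s1 by case/andP: ss => ? ?; rewrite !ltW.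
have [/andP[Y1 Y2] GY] := YP ss'; have Y0 := Y_gt0 ss'; have gY0 := g_gt0 Y0.
have -> : barrier s = al s by have := eq_barrier ss; move/nbhs_singleton.
have s_gt0 : 0 < s by case/andP: ss => [/(lt_trans r0_gt0)].
have YE : Y s = sg * al s by rewrite /al mulrCA divff ?mulr1// gt_eqF.
have ala : eta <= al s by rewrite /al ler_pdivlMr// mulrC.
have fY : f (Y s) <= f (al s).
  apply: f_le; first exact: ltW.
  by rewrite YE ler_piMl// (le_trans (ltW eta_gt0)).
have lY := l_gt0 gY0; have feta := f_gt0 eta_gt0.
have fal : f eta <= f (al s) by apply: f_le => //; exact: ltW.
have pg : 0 < g (Y s) `^ (p - 2) by exact: powR_gt0.
have pE : g (Y s) `^ (p - 1) = g (Y s) `^ (p - 2) * g (Y s) by rewrite powR_sub2// ltW.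
have -> : (p - 1) * (g \o Y) s `^ (p - 2) * (dg (Y s) * (g (Y s) * sg)) = sg * (f (Y s) * l (g (Y s))).
  by rewrite /= dgE// pE; field; rewrite subr_eq0 !gt_eqF.
have T1 : sg * (f (Y s) * l (g (Y s))) <= sg * (f (al s) * l (g (Y s))).
  by rewrite ler_pM2l// ler_wpM2r// ltW.
have sr0 : 0 <= s - r0 by rewrite subr_ge0; case/andP: ss => /ltW.
have flux : g (Y s) `^ (p - 1) <= g (sg * eta) `^ (p - 1) + sg * (s - r0) * (f (Y s) * (C * l (g (Y s)))).
  have := Y1; rewrite le_eqVlt => /predU1P[<-|Yg].
    rewrite lerDl; apply: mulr_ge0; first by apply: mulr_ge0 => //; exact: ltW.
    by apply: mulr_ge0; [exact/ltW/f_gt0|apply: mulr_ge0 => //; exact/ltW/l_gt0/g_gt0].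
  have := flux_growth sgeta Yg; rewrite GY addrK//.
have T2 : sg * (s - r0) * (f (Y s) * (C * l (g (Y s)))) <= sg * s * (C * (f (al s) * l (g (Y s)))).
  apply: ler_pM.
  - by apply: mulr_ge0 => //; exact: ltW.
  - by apply: mulr_ge0; [exact/ltW/f_gt0|apply: mulr_ge0 => //; exact: ltW].
  - by rewrite ler_pM2l// gerBl ltW.
  - by rewrite mulrCA ler_wpM2l// ler_wpM2r// ltW.
have T3 : g (sg * eta) `^ (p - 1) <= s / r0 * (eps * (C * (l (g (Y s)) * (f (al s) / f eta)))).
  rewrite (le_trans small)//.
  apply: (@le_trans _ _ (1 * (eps * (C * (l (g (Y s)) * 1))))).
    rewrite mul1r mulr1 ler_wpM2l//; apply: lC; first exact/ltW/g_gt0.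
    exact: g_le.
  have sr : 1 <= s / r0 by rewrite ler_pdivlMr// mul1r; case/andP: ss => /ltW.
  apply: ler_pM => //; first by rewrite !mulr_ge0// ltW.
  do 2!apply: ler_wpM2l => //; apply: ler_wpM2l; first exact: ltW.
  by rewrite ler_pdivlMr// mul1r.
pose X := f (al s) * l (g (Y s)).
have bd : g (Y s) `^ (p - 1) / s <= eps * C * X / (r0 * f eta) + sg * C * X.
  rewrite ler_pdivrMr//; apply: (le_trans flux); rewrite mulrDl; apply: lerD.
    apply: (le_trans T3); rewrite le_eqVlt; apply/orP; left; apply/eqP.
    by rewrite /X; field; rewrite !gt_eqF.
  by apply: (le_trans T2); rewrite /X le_eqVlt; apply/orP; left; apply/eqP; ring.
have Qbd := ler_wpM2l Q0 bd; rewrite -/X in T1 *; rewrite /= -[Q * _ / s]mulrA.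
apply: (le_trans (lerD T1 Qbd)); rewrite le_eqVlt; apply/orP; left; apply/eqP.
by field; rewrite !gt_eqF.
Qed.

(** Below height [U] the slope is at most [g (sg * U)], which tends to 0 with [sg]: a strong
    dilation keeps the barrier low for as long as desired. *)
Lemma barrier_slow (U s : R) : eta < U -> U <= barrier s -> U - eta <= g (sg * U) * (s - r0).
Proof.
move=> etaU Us; have U0 : 0 < U := lt_trans eta_gt0 etaU.
have [sr|rs] := leP s r0.
  move: Us; rewrite /barrier /cl max_l; last by rewrite ge_min sr.
  by rewrite al_r0 leNgt etaU.
have cs : cl s <= s by rewrite /cl ge_max ltW//= ge_min lexx.
have [_ GY] := YP (cl_in s); have Y0 := Y_gt0 (cl_in s).
have sgU : sg * eta < sg * U by rewrite ltr_pM2l.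
have sU0 := lt_trans sgeta sgU.
have UY : sg * U <= Y (cl s) by move: Us; rewrite /barrier /al ler_pdivlMr// mulrC.
have GU : G (sg * U) <= sg * (cl s - r0) + G (sg * eta).
  by rewrite -GY; exact: (primitive_le g_gt0 G_der).
have D z : sg * eta < z < sg * U -> is_derive z 1 G (g z)^-1.
  by move=> /andP[z1 _]; apply: G_der; exact: lt_trans z1.
have [z /andP[z1 z2] E] := MVT_oo sgU D (is_derive_continuous (G_der sgeta))
  (is_derive_continuous (G_der sU0)).
have z0 := lt_trans sgeta z1; have gz := g_gt0 z0.
have E2 : (g z)^-1 * (sg * U - sg * eta) <= sg * (cl s - r0) by rewrite -E; lra.
have : U - eta <= g z * (cl s - r0).
  rewrite -(ler_pM2l sg_gt0) mulrCA -ler_pdivrMl// mulrBr//.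
move=> /le_trans; apply; apply: ler_pM.
- exact: ltW.
- by have /andP[+ _] := cl_in s; rewrite subr_ge0.
- by apply: g_le => //; exact: ltW.
- by rewrite lerB.
Qed.

Lemma barrier_end_gt : r0 < barrier_end.
Proof. exact: r0s1. Qed.

End Scaled.

(** [T] comes before [A]: the dilation is chosen independently of the height, and the length
    $(G(\sigma A)-G(\sigma\eta))/\sigma$ is bounded through [Gmax]. This lets [A] be taken later,
    above [u] on a ball whose radius depends on [T]. *)
Lemma barrier_exists (Q k eta U r0 r1 : R) : 0 <= C -> 0 <= Q -> 0 < k -> 0 < eta -> eta < U -> 0 < r0 ->
  exists T, forall A, U <= A -> exists s1 a a1 a2,
    [/\ r0 < s1 < T, is_barrier Q k r0 s1 eta A a a1 a2 & forall s, s <= r1 -> a s < U].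
Proof.
move=> C0 Q0 k0 eta0 etaU r00; have feta := f_gt0 eta0.
have U0 := lt_trans eta0 etaU.
have QC0 : 0 <= Q * C by exact: mulr_ge0.
have QC1 : 0 < Q * C + 1 by rewrite ltr_wpDl.
(* Makes the summand of the initial flux at most [k / 4]; the cap on [sg] bounds the other two
   together by [k / 4]. *)
pose eps := k * (r0 * f eta) / (4 * (Q * C + 1)).
have eps0 : 0 < eps by rewrite /eps divr_gt0// mulr_gt0// mulr_gt0.
have [d d0 Hd] : exists2 d, 0 < d & forall t, 0 < t -> t < d -> t `^ (p - 1) <= eps * l t.
  have /cvgrPdist_lt/(_ eps eps0) := lo; move=> [d /= d0 Hd].
  exists d => // t t0 td; have lt0 := l_gt0 t0; rewrite -ler_pdivrMr//.
  have := Hd t; rewrite /= !sub0r !normrN (gtr0_norm t0) => /(_ td t0)/ltW.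
  by apply: le_trans; exact: ler_norm.
have [y1 y10 gy1] := g_small d0.
(* With slope below [e2] the climb from [eta] to [U] takes longer than reaching [r1]. *)
pose e2 := (U - eta) / (`|r1 - r0| + 1).
have r10 : 0 < `|r1 - r0| + 1 by rewrite ltr_wpDl.
have e20 : 0 < e2 by rewrite divr_gt0// subr_gt0.
have [y2 y20 gy2] := g_small e20.
have [sg [sg0 sg1 sgk [sgy1 sgy2]]] : exists sg : R, [/\ 0 < sg, sg <= 1, sg <= k / (4 * (Q * C + 1)) &
    sg * eta <= y1 /\ sg * U <= y2].
  exists (Num.min (Num.min 1 (k / (4 * (Q * C + 1)))) (Num.min (y1 / eta) (y2 / U))); split.
  - by rewrite !lt_min ltr01 !divr_gt0// mulr_gt0.
  - by rewrite !ge_min lexx.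
  - by rewrite !ge_min lexx orbT.
  - by rewrite -!ler_pdivlMr// !ge_min !lexx !orbT.
have sgeta : 0 < sg * eta by exact: mulr_gt0.
have small : g (sg * eta) `^ (p - 1) <= eps * l (g (sg * eta)).
  by apply: Hd; [exact: g_gt0|apply: le_lt_trans gy1; exact: g_le].
(* The final 1 makes the bound on [s1] strict. *)
exists (r0 + (Gmax - G (sg * eta)) / sg + 1) => A UA.
have etaA := lt_le_trans etaU UA; have A0 := lt_trans eta0 etaA.
have bar := barrier_is_barrier sg0 sg1 eta0 etaA r00 C0 Q0 small (ltW eps0).
exists (barrier_end sg eta A r0), (barrier sg eta A r0),
  (g \o (fun s => w (sg * (s - r0) + G (sg * eta)))),
  (fun s => dg (w (sg * (s - r0) + G (sg * eta))) * (g (w (sg * (s - r0) + G (sg * eta))) * sg)).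
split.
- apply/andP; split; first exact: barrier_end_gt.
  rewrite /barrier_end; apply: (@le_lt_trans _ _ (r0 + (Gmax - G (sg * eta)) / sg)); last by rewrite ltrDl.
  by rewrite lerD2l ler_pM2r ?invr_gt0// lerD2r G_le// mulr_gt0.
- have [[bl br] mono lip der ineq] := bar; split=> // s ss.
  apply: (le_trans (ineq s ss)); have [_ _ _ a10] := der _ ss.
  apply: ler_wpM2r.
    apply: mulr_ge0; last exact/ltW/l_gt0.
    apply: ltW; apply: f_gt0; apply: (lt_le_trans eta0).
    by case/andP: ss => /ltW/mono; rewrite bl.
  have -> : Q * C * eps / (r0 * f eta) = Q * C * (k / (4 * (Q * C + 1))).
    by rewrite /eps; field; rewrite !gt_eqF.
  have : (Q * C + 1) * (k / (4 * (Q * C + 1))) = k / 4.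
    by field; rewrite gt_eqF.
  have := ler_wpM2l QC0 sgk; set z := k / _ in sgk *; lra.
move=> s sr1; rewrite ltNge; apply/negP => Us.
have H := barrier_slow sg0 eta0 etaA etaU Us.
have gU : g (sg * U) < e2.
  by apply: le_lt_trans gy2; apply: g_le => //; exact: mulr_gt0.
have gU0 : 0 < g (sg * U) by apply: g_gt0; exact: mulr_gt0.
have : g (sg * U) * (s - r0) < e2 * (`|r1 - r0| + 1).
  apply: (@le_lt_trans _ _ (g (sg * U) * (`|r1 - r0| + 1))).
    rewrite ler_pM2l//; have := ler_norm (r1 - r0); lra.
  by rewrite ltr_pM2r.
by rewrite /e2 divfK ?gt_eqF//; lra.
Qed.

End Barrier.

(** * Nonexistence *)

Section FourthRoot.
Context {R : realType}.

Definition root4 (x : R) : R := x `^ 4^-1.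

Lemma root4_ge0 x : 0 <= root4 x. Proof. exact: powR_ge0. Qed.

Lemma root4K x : 0 <= x -> root4 x ^+ 4 = x.
Proof.
move=> x0; rewrite -powR_mulrn ?root4_ge0// /root4 -powRrM mulVf ?powRr1//.
Qed.

Lemma root4_gt0 x : 0 < x -> 0 < root4 x. Proof. exact: powR_gt0. Qed.

Lemma root4_le x y : 0 <= x -> x <= y -> root4 x <= root4 y.
Proof.
by move=> x0 xy; apply: ge0_ler_powR; rewrite ?nnegrE// (le_trans x0).
Qed.

Lemma root4_lt x y : 0 <= x -> x < y -> root4 x < root4 y.
Proof.
by move=> x0 xy; apply: gt0_ltr_powR; rewrite ?nnegrE// (le_trans x0)// ltW.
Qed.

Lemma root4_powB1 x : 0 < x -> x `^ (4^-1 - 1) = (root4 x ^+ 3)^-1.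
Proof.
move=> x0; have r0 := root4_gt0 x0.
rewrite powRD ?(gt_eqF x0) ?implybT// -/(root4 x) powR_inv1 ?ltW// -[X in _ / X](root4K (ltW x0)).
by field; rewrite gt_eqF.
Qed.

Lemma root4_powB2 x : 0 < x -> x `^ (4^-1 - 1 - 1) = (root4 x ^+ 7)^-1.
Proof.
move=> x0; have r0 := root4_gt0 x0.
rewrite powRD ?(gt_eqF x0) ?implybT// root4_powB1// powR_inv1 ?ltW// -[X in _ / X](root4K (ltW x0)).
by field; rewrite gt_eqF.
Qed.

(** $b^4-a^4\ge(b-a)a^3$. The fourth root is not Lipschitz at 0; the bound holds beyond [r0], and
    the barrier is constant before it. *)
Lemma root4_lip r0 x y : 0 < r0 -> 0 <= x -> r0 <= root4 x -> x <= y ->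
  root4 y - root4 x <= (y - x) / r0 ^+ 3.
Proof.
move=> r00 x0 rx xy.
have y0 := le_trans x0 xy.
have E : y - x = root4 y ^+ 4 - root4 x ^+ 4 by rewrite !root4K.
rewrite ler_pdivlMr ?exprn_gt0// E.
set a := root4 x in rx *; set b := root4 y.
have ab : a <= b by exact: root4_le.
have a3 : r0 ^+ 3 <= a ^+ 3 by rewrite ler_pXn2r// nnegrE ?ltW// (lt_le_trans r00).
have -> : b ^+ 4 - a ^+ 4 = (b - a) * (b ^+ 3 + b ^+ 2 * a + b * a ^+ 2 + a ^+ 3) by ring.
apply: ler_wpM2l; first by rewrite subr_ge0.
have a0 : 0 <= a by exact: root4_ge0.
have b0 : 0 <= b by exact: root4_ge0.
apply: (le_trans a3); rewrite lerDr !addr_ge0// ?mulr_ge0// exprn_ge0.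
Qed.

Lemma root4_continuous x : 0 < x -> {for x, continuous root4}.
Proof. by move=> x0; exact: is_derive_continuous (is_derive1_powR _ x0). Qed.

End FourthRoot.

(** * A maximum inside the annulus lies on the axis *)

Section OffAxis.
Context {R : realType} {m : nat}.
Local Notation H := (heis R m).
Variables (p Lam k : R) (f l : R -> R) (u : H -> R).
Hypothesis p1 : 1 < p.
Hypothesis f_gt0 : forall t : R, 0 < t -> 0 < f t.
Hypothesis f_lt : forall x y : R, 0 <= x -> x < y -> f x < f y.
Hypothesis l_gt0 : forall t : R, 0 < t -> 0 < l t.
Hypothesis l_scale : forall s t : R, 0 <= s <= 1 -> 0 <= t -> l t * s `^ p <= Lam * l (s * t).
Hypothesis k0 : 0 <= k.
Hypothesis kLam : k * Lam < 1.
Hypothesis sol : weak_solution p f l u.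
Hypothesis rhs_continuous : continuous (fun q => f (u q) * l (hgrad_norm u q)).
Variables (r0 s1 eta A : R) (a a1 a2 : R -> R).
Hypotheses (r00 : 0 < r0) (eta0 : 0 < eta).
Hypothesis bar : is_barrier p f l (m%:R *+ 2 + 1) k r0 s1 eta A a a1 a2.

(** Put $h=|z|/r$, the length of the horizontal gradient of the gauge at [q0]; off the axis $0<h\le
    1$. There the $p$-Laplacian of the barrier is $h^p$ times the radial operator, so at most
    $k\,h^pf(a)l(a')\le k\Lambda f(a)l(ha')$. As $k\Lambda<1$, $f(a)<f(u)$ and $|\nabla u|=ha'$,
    this is less than $f(u)l(|\nabla u|)$, against [radial_viscosity]. *)
Lemma local_max_on_axis (c q0 : H) (d : R) : 0 < d ->
  (forall q, `|q - q0| < d -> u q - a (root4 (gauge4 c q)) <= u q0 - a (root4 (gauge4 c q0))) ->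
  r0 < root4 (gauge4 c q0) < s1 -> a (root4 (gauge4 c q0)) < u q0 -> relsq c q0 = 0.
Proof.
move=> d0 qmax r_in ua; apply/eqP; rewrite eq_le relsq_ge0 andbT leNgt; apply/negP => S0.
have [[al _] mono _ der ineq] := bar.
pose N q := gauge4 c q.
have N_gt0 q : r0 < root4 (N q) -> 0 < N q.
  move=> rq; rewrite lt_neqAle gauge4_ge0 andbT; apply/eqP => N0; move: rq.
  by rewrite -N0 /root4 powR0 ?invr_eq0// ltNge ltW.
have Nq0 : 0 < N q0 by case/andP: r_in => /N_gt0.
pose e1 (x : R) := 4^-1 * x `^ (4^-1 - 1).
pose e2 (x : R) := 4^-1 * ((4^-1 - 1) * x `^ (4^-1 - 1 - 1)).
have rd (x : R) : 0 < x -> is_derive x 1 root4 (e1 x) by exact: is_derive1_powR.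
have e1d (x : R) : 0 < x -> is_derive x 1 e1 (e2 x).
  by move=> x0; have := is_deriveZ 4^-1 (is_derive1_powR (4^-1 - 1) x0).
pose b1 x := a1 (root4 x) * e1 x.
pose b2 x := a2 (root4 x) * e1 x * e1 x + a1 (root4 x) * e2 x.
have near_in : exists2 d' : R, 0 < d' & forall q, `|q - q0| < d' -> r0 < root4 (N q) < s1.
  have rc : {for q0, continuous (fun q => root4 (N q))}.
    apply: (@for_comp _ _ N root4); last exact: root4_continuous.
    by have [] := gauge4_C1 c (Logic.I : setT q0).
  pose e := Num.min (root4 (N q0) - r0) (s1 - root4 (N q0)).
  have e0 : 0 < e by rewrite lt_min !subr_gt0.
  have /continuousPe/(_ e e0)[d' d'0 Hd] := rc.
  exists d' => // q qd; have := Hd q; rewrite distrC => /(_ qd).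
  rewrite /e lt_min => /andP[/ltr_normlP[_ h1] /ltr_normlP[h2 _]].
  by apply/andP; split; lra.
have [d' d'0 Hd'] := near_in.
pose dd := Num.min d d'.
have dd0 : 0 < dd by rewrite lt_min d0.
have bd q : `|q - q0| < dd -> [/\ is_derive (N q) 1 (fun x => a (root4 x)) (b1 (N q)),
    is_derive (N q) 1 b1 (b2 (N q)) & {for N q, continuous b2}].
  rewrite lt_min => /andP[_ /Hd' rq]; have Nq : 0 < N q by case/andP: rq => /N_gt0.
  have [ad a1d a2c _] := der _ rq; have rdN := rd _ Nq; have e1N := e1d _ Nq.
  have rc := is_derive_continuous rdN; have ec := is_derive_continuous e1N.
  have a1rd : is_derive (N q) 1 (fun x => a1 (root4 x)) (a2 (root4 (N q)) * e1 (N q)).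
    exact: (@is_derive1_comp _ a1 root4).
  split.
  - exact: (@is_derive1_comp _ a root4).
  - have := is_deriveM a1rd e1N.
    rewrite (_ : a1 (root4 (N q)) *: e2 (N q) + e1 (N q) *: (a2 (root4 (N q)) * e1 (N q)) = b2 (N q))//.
    by rewrite /b2 /GRing.scale/=; ring.
  have e2c : {for N q, continuous e2}.
    apply: forM; first exact: cts_cst. apply: forM; first exact: cts_cst.
    exact: is_derive_continuous (is_derive1_powR _ Nq).
  apply: forD; last by apply: forM => //; exact: is_derive_continuous a1rd.
  apply: forM => //; apply: forM => //.
  by apply: (@for_comp _ _ root4 a2).
have qmax' q : `|q - q0| < dd -> u q - a (root4 (N q)) <= u q0 - a (root4 (N q0)).
  by rewrite lt_min => /andP[/qmax].
pose r := root4 (N q0); have rgt : r0 < r by case/andP: r_in.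
have r_gt0 : 0 < r := lt_trans r00 rgt.
have NE : N q0 = r ^+ 4 by rewrite /r root4K// ltW.
have [_ _ _ a10] := der _ r_in; rewrite -/r in a10.
have e1E : e1 (N q0) = (4 * r ^+ 3)^-1 by rewrite /e1 root4_powB1// -/r; field; rewrite gt_eqF.
have e2E : e2 (N q0) = - 3 / (16 * r ^+ 7) by rewrite /e2 root4_powB2// -/r; field; rewrite gt_eqF.
have b1_gt0 : 0 < b1 (N q0) by rewrite /b1 e1E divr_gt0// mulr_gt0// exprn_gt0.
have visc := radial_viscosity p1 sol rhs_continuous dd0 bd qmax' S0 b1_gt0.
have grad := radial_grad_norm sol dd0 bd qmax'.
pose h := Num.sqrt (relsq c q0) / r.
have h0 : 0 < h by rewrite divr_gt0// sqrtr_gt0.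
have h2 : relsq c q0 = h ^+ 2 * r ^+ 2.
  rewrite /h expr_div_n sqr_sqrtr ?relsq_ge0// divfK//.
  by rewrite gt_eqF// exprn_gt0.
have h1 : h <= 1.
  rewrite -(@expr_le1 _ 4)//; last exact: ltW.
  rewrite -(ler_pM2r (exprn_gt0 4 r_gt0)) mul1r -NE.
  rewrite (_ : h ^+ 4 * N q0 = relsq c q0 ^+ 2); last by rewrite h2 NE; ring.
  by rewrite /N /gauge4 lerDl sqr_ge0.
have Eb : b1 (N q0) ^+ 2 * (16 * N q0 * relsq c q0) = (a1 r * h) ^+ 2.
  by rewrite /b1 -/r e1E h2 NE; field; rewrite gt_eqF.
have ah0 : 0 < a1 r * h by exact: mulr_gt0.
rewrite -/(N q0) Eb sqrtr_sqr gtr0_norm// in grad.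
rewrite -/(N q0) Eb grad in visc.
have powE : ((a1 r * h) ^+ 2) `^ ((p - 2) / 2) = a1 r `^ (p - 2) * h `^ (p - 2).
  rewrite -powRM ?ltW// -powR_mulrn ?ltW// -powRrM.
  by congr (_ `^ _); field.
have hp : h `^ (p - 2) * h ^+ 2 = h `^ p.
  rewrite -powR_mulrn ?ltW// -powRD ?(gt_eqF h0) ?implybT//.
  by congr (_ `^ _); ring.
have pE : a1 r `^ (p - 1) = a1 r `^ (p - 2) * a1 r by rewrite powR_sub2// ltW.
have := ineq _ r_in; rewrite -/r pE => ineq_r.
move: visc; rewrite powE.
set X := (X in _ <= X -> _).
(* Passing from the fourth power to the gauge, the second derivative of the root contributes
   $-3(p-1)a'/r^3$ and cancels the term $12(p-1)$ of the divergence; only $2m+1$ survives. *)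
have -> : X = h `^ p * ((p - 1) * a1 r `^ (p - 2) * a2 r + (m%:R *+ 2 + 1) * (a1 r `^ (p - 2) * a1 r) / r).
  by rewrite /X -/(N q0) -hp /b2 /b1 -/r e1E e2E h2 NE; field; rewrite gt_eqF.
rewrite leNgt => /negP; apply.
have a_gt0 : 0 < a r.
  by apply: (lt_le_trans eta0); rewrite -(al r0 (lexx _)); apply: mono; exact: ltW.
have fau : f (a r) < f (u q0) by apply: f_lt => //; exact: ltW.
have fa := f_gt0 a_gt0; have lah := l_gt0 ah0.
apply: (le_lt_trans (ler_wpM2l (powR_ge0 _ _) ineq_r)).
have h01 : 0 <= h <= 1 by rewrite ltW.
have := l_scale h01 (ltW a10); rewrite (mulrC h) => ls.
apply: (@le_lt_trans _ _ (k * f (a r) * (Lam * l (a1 r * h)))).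
  have := ler_wpM2l (mulr_ge0 k0 (ltW fa)) ls; lra.
apply: (@lt_trans _ _ (f (a r) * l (a1 r * h))); last by rewrite ltr_pM2r.
have fl : 0 < f (a r) * l (a1 r * h) by exact: mulr_gt0.
have := kLam; rewrite -(ltr_pM2r fl); lra.
Qed.

End OffAxis.

(** * Horizontal flows of the centre *)

Section Flows.
Context {R : realType} {m : nat}.
Local Notation N := (m + m + 1)%N.
Local Notation H := (heis R m).
Implicit Types (c q : H) (s t : R) (j k : 'I_m).

(** Integral curve of $X_j$ through [c]; it is a straight line because $y_j$ is constant along it.
    Likewise for $Y_j$ below. *)
Definition flowX j s c : H :=
  c + s *: (delta_mx 0 (idx_x j) + (2 * c 0 (idx_y j)) *: delta_mx 0 (idx_t m)).
Definition flowY j s c : H :=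
  c + s *: (delta_mx 0 (idx_y j) - (2 * c 0 (idx_x j)) *: delta_mx 0 (idx_t m)).

Lemma flowX_x j s c k : flowX j s c 0 (idx_x k) = c 0 (idx_x k) + s * (k == j)%:R.
Proof. by rewrite /flowX !mxE eqxx idx_xx idx_xt /= mulr0 addr0. Qed.

Lemma flowX_y j s c k : flowX j s c 0 (idx_y k) = c 0 (idx_y k).
Proof. by rewrite /flowX !mxE eqxx idx_yx idx_yt /= !mulr0 !addr0 mulr0 addr0. Qed.

Lemma flowX_t j s c : flowX j s c 0 (idx_t m) = c 0 (idx_t m) + s * (2 * c 0 (idx_y j)).
Proof. by rewrite /flowX !mxE !eqxx idx_tx /= mulr1 add0r. Qed.

Lemma flowY_x j s c k : flowY j s c 0 (idx_x k) = c 0 (idx_x k).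
Proof. by rewrite /flowY !mxE eqxx idx_xy idx_xt /= !mulr0 subr0 mulr0 addr0. Qed.

Lemma flowY_y j s c k : flowY j s c 0 (idx_y k) = c 0 (idx_y k) + s * (k == j)%:R.
Proof. by rewrite /flowY !mxE eqxx idx_yy idx_yt /= mulr0 subr0. Qed.

Lemma flowY_t j s c : flowY j s c 0 (idx_t m) = c 0 (idx_t m) - s * (2 * c 0 (idx_x j)).
Proof. by rewrite /flowY !mxE !eqxx idx_ty /= mulr1 sub0r mulrN. Qed.

Lemma heis_ext c q : (forall k, c 0 (idx_x k) = q 0 (idx_x k)) ->
  (forall k, c 0 (idx_y k) = q 0 (idx_y k)) -> c 0 (idx_t m) = q 0 (idx_t m) -> c = q.
Proof.
move=> cx cy ct; apply/rowP => i; case: (split_ordP i) => k ->; last by rewrite ord1.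
by case: (split_ordP k) => k' ->; [exact: cx|exact: cy].
Qed.

Lemma flowX_add j s t c : flowX j s (flowX j t c) = flowX j (t + s) c.
Proof.
apply: heis_ext => [k|k|].
- by rewrite !flowX_x mulrDl addrA.
- by rewrite !flowX_y.
- by rewrite !flowX_t flowX_y; ring.
Qed.

Lemma flowY_add j s t c : flowY j s (flowY j t c) = flowY j (t + s) c.
Proof.
apply: heis_ext => [k|k|].
- by rewrite !flowY_x.
- by rewrite !flowY_y mulrDl addrA.
- by rewrite !flowY_t flowY_x; ring.
Qed.

Lemma flowX0 j c : flowX j 0 c = c.
Proof. by rewrite /flowX scale0r addr0. Qed.

Lemma flowY0 j c : flowY j 0 c = c.
Proof. by rewrite /flowY scale0r addr0. Qed.

(** The relation $[X_j,Y_j]=-4\partial_t$, exact for finite times because the group has step two. *)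
Lemma flow_commutator j s t c :
  flowY j (- t) (flowX j (- s) (flowY j t (flowX j s c))) =
  c + (- 4 * s * t) *: delta_mx 0 (idx_t m).
Proof.
have V i : (c + (- 4 * s * t) *: delta_mx 0 (idx_t m)) 0 i = c 0 i + - 4 * s * t * (i == idx_t m)%:R.
  by rewrite !mxE eqxx.
apply: heis_ext => [k|k|]; rewrite V.
- by rewrite !(flowX_x, flowY_x) idx_xt /=; ring.
- by rewrite !(flowX_y, flowY_y) idx_yt /=; ring.
- by rewrite !(flowX_t, flowY_t, flowX_x, flowY_x, flowX_y, flowY_y) !eqxx /=; ring.
Qed.

Lemma flowX_norm j s c : `|flowX j s c - c| <= `|s| * (1 + 2 * `|c|).
Proof.
rewrite /flowX addrC addKr normrZ ler_wpM2l// (le_trans (ler_normD _ _))//.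
have d1 i : `|delta_mx 0 i : H| <= 1.
  by apply: row_norm_le => // k; rewrite mxE eqxx/=; case: (k == i); rewrite ?normr1// normr0.
apply: lerD => //; rewrite normrZ -[leRHS]mulr1; apply: ler_pM => //.
by rewrite normrM (@ger0_norm _ 2)// ler_pM2l// coord_norm_le.
Qed.

Lemma flowY_norm j s c : `|flowY j s c - c| <= `|s| * (1 + 2 * `|c|).
Proof.
rewrite /flowY addrC addKr normrZ ler_wpM2l// (le_trans (ler_normB _ _))//.
have d1 i : `|delta_mx 0 i : H| <= 1.
  by apply: row_norm_le => // k; rewrite mxE eqxx/=; case: (k == i); rewrite ?normr1// normr0.
apply: lerD => //; rewrite normrZ -[leRHS]mulr1; apply: ler_pM => //.
by rewrite normrM (@ger0_norm _ 2)// ler_pM2l// coord_norm_le.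
Qed.

Lemma relsq0_coord c q : relsq c q = 0 -> forall k, relx c k q = 0 /\ rely c k q = 0.
Proof.
by move=> s0 k; have [] := relx_le c k q; rewrite s0 sqrtr0 !normr_le0 => /eqP -> /eqP ->.
Qed.

Let sum_delta (F : 'I_m -> R) j : \sum_k (k == j)%:R * F k = F j.
Proof.
rewrite (bigD1 j)//= eqxx mul1r big1 ?addr0// => k /negPf kj.
by rewrite kj mul0r.
Qed.

(** With [q] on the axis of [c], the shift creates horizontal distance [s], while the vertical
    component is unchanged since its variation is proportional to [rely], which is 0. *)
Lemma flowX_gauge4 j s c q : relsq c q = 0 -> gauge4 (flowX j s c) q = s ^+ 4 + gauge4 c q.
Proof.
move=> s0; have rel0 := relsq0_coord s0; rewrite /gauge4.
have -> : relsq (flowX j s c) q = s ^+ 2.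
  rewrite -(sum_delta (fun=> s ^+ 2) j); apply: eq_bigr => k _.
  have [xk yk] := rel0 k.
  have -> : relx (flowX j s c) k q = - s * (k == j)%:R.
    by rewrite -[RHS]add0r -xk /relx flowX_x; ring.
  have -> : rely (flowX j s c) k q = 0 by rewrite -yk /rely flowX_y.
  by case: (k == j); rewrite /=; ring.
have -> : relt (flowX j s c) q = relt c q.
  rewrite /relt flowX_t.
  have -> : \sum_k (flowX j s c 0 (idx_y k) * q 0 (idx_x k) - flowX j s c 0 (idx_x k) * q 0 (idx_y k)) =
      \sum_k (c 0 (idx_y k) * q 0 (idx_x k) - c 0 (idx_x k) * q 0 (idx_y k)) - s * q 0 (idx_y j).
    rewrite -(sum_delta (fun k => q 0 (idx_y k)) j) mulr_sumr -sumrB; apply: eq_bigr => k _.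
    by rewrite flowX_y flowX_x; ring.
  by have [_ /eqP] := rel0 j; rewrite /rely subr_eq0 => /eqP ->; ring.
by rewrite s0; ring.
Qed.

Lemma flowY_gauge4 j s c q : relsq c q = 0 -> gauge4 (flowY j s c) q = s ^+ 4 + gauge4 c q.
Proof.
move=> s0; have rel0 := relsq0_coord s0; rewrite /gauge4.
have -> : relsq (flowY j s c) q = s ^+ 2.
  rewrite -(sum_delta (fun=> s ^+ 2) j); apply: eq_bigr => k _.
  have [xk yk] := rel0 k.
  have -> : rely (flowY j s c) k q = - s * (k == j)%:R.
    by rewrite -[RHS]add0r -yk /rely flowY_y; ring.
  have -> : relx (flowY j s c) k q = 0 by rewrite -xk /relx flowY_x.
  by case: (k == j); rewrite /=; ring.
have -> : relt (flowY j s c) q = relt c q.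
  rewrite /relt flowY_t.
  have -> : \sum_k (flowY j s c 0 (idx_y k) * q 0 (idx_x k) - flowY j s c 0 (idx_x k) * q 0 (idx_y k)) =
      \sum_k (c 0 (idx_y k) * q 0 (idx_x k) - c 0 (idx_x k) * q 0 (idx_y k)) + s * q 0 (idx_x j).
    rewrite -(sum_delta (fun k => q 0 (idx_x k)) j) mulr_sumr -big_split/=; apply: eq_bigr => k _.
    by rewrite flowY_y flowY_x; ring.
  by have [/eqP + _] := rel0 j; rewrite /relx subr_eq0 => /eqP ->; ring.
by rewrite s0; ring.
Qed.

Lemma vertical_gauge4 t c q : relsq c q = 0 ->
  gauge4 (c + t *: delta_mx 0 (idx_t m)) q = (relt c q - t) ^+ 2.
Proof.
move=> s0; set c' := c + _.
have cx k : c' 0 (idx_x k) = c 0 (idx_x k) by rewrite !mxE eqxx idx_xt /= mulr0 addr0.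
have cy k : c' 0 (idx_y k) = c 0 (idx_y k) by rewrite !mxE eqxx idx_yt /= mulr0 addr0.
have ct : c' 0 (idx_t m) = c 0 (idx_t m) + t by rewrite !mxE !eqxx /= mulr1.
rewrite /gauge4 (_ : relsq c' q = 0) ?expr0n ?add0r; last first.
  by rewrite -s0; apply: eq_bigr => k _; rewrite /relx /rely cx cy.
congr (_ ^+ 2); rewrite /relt ct (_ : \sum_k _ = \sum_k (c 0 (idx_y k) * q 0 (idx_x k) - c 0 (idx_x k) * q 0 (idx_y k))).
  ring.
by apply: eq_bigr => k _; rewrite cx cy.
Qed.

(** Compares gauge balls with norm balls. The last term comes from the twist $2\sum_k(\dots)$ in the
    vertical component, which grows with the centre. *)
Lemma gauge4_norm (D r : R) c q : `|c| <= D -> 0 <= r -> gauge4 c q <= r ^+ 4 ->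
  `|q - c| <= r + r ^+ 2 + 4 * m%:R * D * r.
Proof.
move=> cD r0 gr; have D0 : 0 <= D := le_trans (normr_ge0 _) cD.
have E0 : 0 <= 4 * m%:R * D * r by rewrite !mulr_ge0.
have sr : relsq c q <= r ^+ 2.
  rewrite -(@ler_pXn2r _ 2)// ?nnegrE ?relsq_ge0 ?sqr_ge0// -exprM.
  by apply: le_trans gr; rewrite /gauge4 lerDl sqr_ge0.
have tr : `|relt c q| <= r ^+ 2.
  rewrite -(@ler_pXn2r _ 2)// ?nnegrE ?sqr_ge0// -exprM real_normK ?num_real//.
  by apply: le_trans gr; rewrite /gauge4 lerDr sqr_ge0.
have xr k : `|relx c k q| <= r /\ `|rely c k q| <= r.
  have [x1 x2] := relx_le c k q.
  have sq : Num.sqrt (relsq c q) <= r by rewrite -(ger0_norm r0) -sqrtr_sqr ler_wsqrtr.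
  by rewrite (le_trans x1)// (le_trans x2).
apply: row_norm_le => [|i]; first by rewrite !addr_ge0 ?sqr_ge0.
rewrite mxE mxE; case: (split_ordP i) => k ->; last first.
  rewrite ord1 -/(idx_t m).
  have -> : q 0 (idx_t m) - c 0 (idx_t m) = relt c q +
      2 * \sum_k (c 0 (idx_y k) * relx c k q - c 0 (idx_x k) * rely c k q).
    rewrite /relt (_ : \sum_k (c 0 (idx_y k) * relx c k q - _) =
      \sum_k (c 0 (idx_y k) * q 0 (idx_x k) - c 0 (idx_x k) * q 0 (idx_y k))); first by ring.
    by apply: eq_bigr => i' _; rewrite /relx /rely; ring.
  rewrite (le_trans (ler_normD _ _))// normrM (@ger0_norm _ 2)//.
  have : `|\sum_k (c 0 (idx_y k) * relx c k q - c 0 (idx_x k) * rely c k q)| <= \sum_(k < m) (2 * D * r).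
    rewrite (le_trans (ler_norm_sum _ _ _))//; apply: ler_sum => i' _.
    have [x1 y1] := xr i'; rewrite (le_trans (ler_normB _ _))// !normrM -mulrA mulr2n mulrDl mul1r.
    by apply: lerD; apply: ler_pM => //; rewrite (le_trans (coord_norm_le _ _)).
  rewrite sumr_const card_ord -mulr_natr; lra.
have r20 := sqr_ge0 r.
by case: (split_ordP k) => k' ->; have [x1 y1] := xr k'; move: x1 y1; rewrite /relx /rely /idx_x /idx_y; lra.
Qed.

End Flows.

(** Cutting the unit interval into $n+1$ steps bounds the total variation by $L(n+1)^{-3}$, which
    contradicts a positive difference for large $n$. *)
Lemma quartic_constant {R : realType} (P : R -> R) (L : R) :
  (forall x y : R, 0 <= x <= 1 -> 0 <= y <= 1 -> `|P x - P y| <= L * (x - y) ^+ 4) -> P 1 = P 0.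
Proof.
move=> HP; apply/eqP; rewrite -subr_eq0 -normr_le0 leNgt; apply/negP => D0.
set D := `|P 1 - P 0| in D0.
have L0 : 0 <= L.
  by have := HP 1 0; rewrite !lexx !ler01 subr0 expr1n mulr1 => /(_ isT isT); apply: le_trans.
have H n : n.+1%:R * D <= L.
  have n0 : (0 : R) < n.+1%:R by [].
  have step i : (i <= n)%N -> `|P (i.+1%:R / n.+1%:R) - P (i%:R / n.+1%:R)| <= L * n.+1%:R^-1 ^+ 4.
    move=> i_n; have I k : (k <= n.+1)%N -> 0 <= (k%:R / n.+1%:R : R) <= 1.
      by move=> kn; rewrite divr_ge0//= ler_pdivrMr// mul1r ler_nat.
    apply: (le_trans (HP (i.+1%:R / n.+1%:R) (i%:R / n.+1%:R) (I i.+1 i_n) (I i (leqW i_n)))).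
    by rewrite -mulrBl -natrB// subSnn mul1r.
  have -> : D = `|\sum_(0 <= i < n.+1) (P (i.+1%:R / n.+1%:R) - P (i%:R / n.+1%:R))|.
    by rewrite (telescope_sumr (fun i => P (i%:R / n.+1%:R)))// mul0r divff// gt_eqF.
  apply: (@le_trans _ _ (n.+1%:R * \sum_(0 <= i < n.+1) L * n.+1%:R^-1 ^+ 4)).
    rewrite ler_pM2l// (le_trans (ler_norm_sum _ _ _))//.
    by rewrite !big_mkord; apply: ler_sum => i _; apply: step; rewrite -ltnS.
  rewrite big_mkord sumr_const card_ord -[X in _ * X]mulr_natr.
  have -> : n.+1%:R * (L * n.+1%:R^-1 ^+ 4 * n.+1%:R) = L * n.+1%:R^-1 ^+ 2 :> R.
    by field; rewrite gt_eqF.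
  rewrite ler_piMr// exprn_ile1// ?invr_ge0// invf_le1// ler1n//.
have := archi_boundP (divr_ge0 L0 (ltW D0)); rewrite ltr_pdivrMr//.
move=> LD; have := H (Num.bound (L / D)).
by rewrite -natr1 mulrDl mul1r; lra.
Qed.

(** * Contradiction from moving the centre *)

Section MovingCentre.
Context {R : realType} {m : nat}.
Local Notation N := (m + m + 1)%N.
Local Notation H := (heis R m).
Variables (p Q k : R) (f l : R -> R) (u : H -> R) (r0 s1 eta A : R) (a a1 a2 : R -> R).
Hypothesis m_gt0 : (0 < m)%N.
Hypothesis uc : continuous u.
Hypothesis r00 : 0 < r0.
Hypothesis r0s1 : r0 < s1.
Hypothesis bar : is_barrier p f l Q k r0 s1 eta A a a1 a2.
Hypothesis max_on_axis : forall (c q0 : H) (d : R), 0 < d ->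
  (forall q, `|q - q0| < d -> u q - a (root4 (gauge4 c q)) <= u q0 - a (root4 (gauge4 c q0))) ->
  r0 < root4 (gauge4 c q0) < s1 -> a (root4 (gauge4 c q0)) < u q0 -> relsq c q0 = 0.
Variables (c0 q1 : H) (rho0 rho : R).
Hypothesis rho00 : 0 < rho0.
(** For these centres the hypotheses below trap the maximum: the difference is positive at [q1], but
    negative where the gauge is at most [r0] (barrier [eta], above [u]) and, inside the ball, where
    it is at least [s1] (barrier [A], above [u]). *)
Let good (c : H) := `|c - c0| < rho0.
Hypothesis u_small : forall c q, good c -> root4 (gauge4 c q) <= r0 -> u q < eta.
Hypothesis u_q1 : forall c, good c -> a (root4 (gauge4 c q1)) < u q1.
Hypothesis inside : forall c q, good c -> root4 (gauge4 c q) < s1 -> `|q| < rho.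
Hypothesis u_lt : forall q, `|q| <= rho -> u q < A.
Hypothesis q1_in : `|q1| <= rho.

(** Composed with the fourth root the barrier is still Lipschitz in the fourth power of the gauge:
    constant up to $r_0^4$, and beyond it [root4_lip] applies. *)
Lemma barrier_root4_lip : exists2 L, 0 <= L & forall x y : R, 0 <= x -> x <= y ->
  0 <= a (root4 y) - a (root4 x) <= L * (y - x).
Proof.
have [[al _] mono [L L0 lip] _ _] := bar; exists (L / r0 ^+ 3) => [|x y x0 xy].
  by rewrite divr_ge0// exprn_ge0// ltW.
have y0 := le_trans x0 xy; have rxy := root4_le x0 xy.
apply/andP; split; first by rewrite subr_ge0 mono.
have key (z : R) : 0 <= z -> z <= y -> r0 <= root4 z -> a (root4 y) - a (root4 z) <= L / r0 ^+ 3 * (y - z).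
  move=> z0 zy rz; apply: (le_trans (ler_norm _)); apply: (le_trans (lip _ _)).
  rewrite -mulrA ler_wpM2l// ger0_norm ?subr_ge0 ?root4_le// mulrC.
  exact: root4_lip.
have [rx|rx] := leP r0 (root4 x); first exact: key.
rewrite (al _ (ltW rx)).
have L3 : 0 <= L / r0 ^+ 3 by rewrite divr_ge0// exprn_ge0// ltW.
have [ry|ry] := leP (root4 y) r0; first by rewrite al// subrr mulr_ge0// subr_ge0.
have rE : root4 (r0 ^+ 4) = r0.
  by rewrite /root4 -powR_mulrn ?ltW// -powRrM mulfV// powRr1// ltW.
have r4 : 0 <= r0 ^+ 4 by rewrite exprn_ge0// ltW.
have ltN z : 0 <= z -> r0 ^+ 4 < z = (r0 < root4 z).
  by move=> z0; rewrite -[in LHS](root4K z0) ltr_pXn2r// nnegrE ?root4_ge0// ltW.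
have r4y : r0 ^+ 4 <= y by rewrite ltW// ltN.
have r4x : x <= r0 ^+ 4 by rewrite leNgt ltN// -leNgt ltW.
have := key _ r4 r4y; rewrite rE (al _ (lexx _)) => /(_ (lexx _)) /le_trans; apply.
by rewrite ler_wpM2l// lerB.
Qed.

Let v (c q : H) := u q - a (root4 (gauge4 c q)).

Let v_continuous c : continuous (v c).
Proof.
have [L L0 lip] := barrier_root4_lip.
suff ac : continuous (fun q : H => a (root4 (gauge4 c q))) by exact: ctsB.
move=> q; have [Nc _] := gauge4_C1 c (Logic.I : setT q).
apply/continuousPe => e e0; have e'0 : 0 < e / (L + 1) by rewrite divr_gt0// ltr_wpDl.
have /continuousPe/(_ _ e'0)[d d0 Hd] := Nc.
exists d => // q' /Hd Nqq; apply: (@le_lt_trans _ _ (L * `|gauge4 c q - gauge4 c q'|)).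
  have [xy|/ltW yx] := leP (gauge4 c q) (gauge4 c q').
    have /andP[h1 h2] := lip _ _ (gauge4_ge0 c q) xy.
    by rewrite distrC ger0_norm// (distrC (gauge4 c q)) [in leRHS]ger0_norm ?subr_ge0.
  have /andP[h1 h2] := lip _ _ (gauge4_ge0 c q') yx.
  by rewrite ger0_norm// [in leRHS]ger0_norm ?subr_ge0.
apply: (@le_lt_trans _ _ ((L + 1) * `|gauge4 c q - gauge4 c q'|)).
  by rewrite ler_wpM2r// lerDl.
by rewrite mulrC -ltr_pdivlMr// ltr_wpDl.
Qed.

Let argmax c : exists qm : H, `|qm| <= rho /\ forall q, `|q| <= rho -> v c q <= v c qm.
Proof.
pose K := [set q : H | `|q| <= rho].
have cK : compact K.
  apply: bounded_closed_compact; last exact: closed_norm_le.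
  by exists rho; split; [exact: num_real|move=> x rx q /= /le_trans; apply; exact: ltW].
have K0 : K !=set0 by exists q1.
have [q /[!inE] Kq qm] := EVT_max_rV K0 cK (continuous_subspaceT (@v_continuous c)).
by exists q; split=> // q' q'K; apply: qm; rewrite inE.
Qed.

Let qm c := sval (cid (argmax c)).
Let qmP c : `|qm c| <= rho /\ forall q, `|q| <= rho -> v c q <= v c (qm c).
Proof. exact: (svalP (cid (argmax c))). Qed.
Let M c := v c (qm c).

(** The maximum value is positive, which places the maximum point in the annulus, hence in the
    interior of the ball; it is then a local maximum and lies on the axis. *)
Let qm_good c : good c ->
  [/\ r0 < root4 (gauge4 c (qm c)) < s1, relsq c (qm c) = 0 & 0 < gauge4 c (qm c)].
Proof.
move=> gc; have [[al ar] mono _ _ _] := bar; have [qin qmax] := qmP c.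
have Mpos : 0 < v c (qm c).
  by apply: lt_le_trans (qmax _ q1_in); rewrite /v subr_gt0; exact: u_q1.
have r_in : r0 < root4 (gauge4 c (qm c)) < s1.
  apply/andP; split; rewrite ltNge; apply/negP => rq; move: Mpos; rewrite /v.
    by rewrite al// subr_gt0 ltNge ltW// (u_small gc rq).
  by rewrite ar// subr_gt0 ltNge ltW// u_lt.
have qlt : `|qm c| < rho by case/andP: r_in => _ /(inside gc).
split=> //.
  apply: (max_on_axis (d := rho - `|qm c|)) => //; last by rewrite -subr_gt0.
    by rewrite subr_gt0.
  move=> q qq; apply: qmax; have := ler_normD (q - qm c) (qm c); rewrite subrK; lra.
rewrite lt_neqAle gauge4_ge0 andbT; apply/eqP => N0; case/andP: r_in.
by rewrite -N0 /root4 powR0 ?invr_eq0// ltNge ltW.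
Qed.

Section Flow.
Variable flow : R -> H -> H.
Hypothesis flow_add : forall s t c, flow s (flow t c) = flow (t + s) c.
Hypothesis flow0 : forall c, flow 0 c = c.
Hypothesis flow_norm : forall s c, `|flow s c - c| <= `|s| * (1 + 2 * `|c|).
Hypothesis flow_gauge4 : forall s c q, relsq c q = 0 -> gauge4 (flow s c) q = s ^+ 4 + gauge4 c q.

(** The old maximum point is a competitor for the new centre and loses at most $L s^4$. Flowing back
    gives the reverse inequality. *)
Let flow_step : exists2 L, 0 <= L & forall s c, good c -> good (flow s c) ->
  `|M (flow s c) - M c| <= L * s ^+ 4.
Proof.
have [L L0 lip] := barrier_root4_lip; exists L => // s c.
have half (t : R) (c' : H) : good c' -> M c' - L * t ^+ 4 <= M (flow t c').
  move=> gc'; have [_ S0 _] := qm_good gc'; have [qin _] := qmP c'.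
  have t4 : 0 <= t ^+ 4 by rewrite (_ : 4 = 2 * 2)%N// exprM sqr_ge0.
  have [_ qmax] := qmP (flow t c'); apply: le_trans (qmax _ qin).
  have Nle : gauge4 c' (qm c') <= t ^+ 4 + gauge4 c' (qm c') by rewrite lerDr.
  have /andP[_ +] := lip _ _ (gauge4_ge0 _ _) Nle.
  by rewrite /M /v flow_gauge4// addrK; lra.
move=> gc gs; have h1 := half s c gc; have := half (- s) _ gs.
rewrite flow_add subrr flow0 (_ : (- s) ^+ 4 = s ^+ 4); last by ring.
move: h1; move: (M c) (M (flow s c)) (L * s ^+ 4) => x y z h1 h2.
by rewrite ler_norml; apply/andP; split; lra.
Qed.

Lemma flow_constant s c : (forall t, `|t| <= `|s| -> good (flow t c)) -> M (flow s c) = M c.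
Proof.
move=> path; have [L L0 step] := flow_step.
have := @quartic_constant _ (fun x => M (flow (x * s) c)) (L * s ^+ 4).
rewrite mul1r mul0r flow0; apply => x y /andP[x0 x1] /andP[y0 y1].
have in_path (z : R) : 0 <= z -> z <= 1 -> good (flow (z * s) c).
  by move=> z0 z1; apply: path; rewrite normrM (ger0_norm z0) ler_piMl.
have := step ((x - y) * s) (flow (y * s) c) (in_path _ y0 y1).
rewrite flow_add (_ : y * s + (x - y) * s = x * s); last by ring.
move=> /(_ (in_path _ x0 x1)); rewrite exprMn; lra.
Qed.

(** The constant collects the displacement of the flow, at most $d(1+2(|c_0|+1))$, and the initial
    distance [d]. *)
Lemma flow_constant_near (d : R) s c : d * (2 * (`|c0| + 1) + 2) < rho0 -> d <= 1 ->
  `|c - c0| <= d -> `|s| <= d -> M (flow s c) = M c.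
Proof.
move=> dr d1 cd sd; apply: flow_constant => t ts; rewrite /good.
have cn : `|c| <= `|c0| + 1 by have := ler_normD (c - c0) c0; rewrite subrK; lra.
have d0 : 0 <= d := le_trans (normr_ge0 _) cd.
apply: le_lt_trans dr; have := ler_normD (flow t c - c) (c - c0); rewrite addrA subrK.
move=> /le_trans; apply; have := flow_norm t c.
have : `|t| * (1 + 2 * `|c|) <= d * (1 + 2 * (`|c0| + 1)).
  by apply: ler_pM; [exact: normr_ge0|rewrite addr_ge0// mulr_ge0|exact: le_trans sd|rewrite lerD2l ler_pM2l].
lra.
Qed.

End Flow.

Lemma moving_centre_false : False.
Proof.
pose D := `|c0| + 1; pose E := 2 * D + 2.
have D0 : 0 <= D by rewrite /D addr_ge0.
have E0 : 0 < E by rewrite /E ltr_wpDl// mulr_ge0.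
pose d := Num.min 1 (rho0 / (2 * E)).
have d0 : 0 < d by rewrite lt_min ltr01 divr_gt0// mulr_gt0.
have d1 : d <= 1 by rewrite ge_min lexx.
have dE : d * E < rho0.
  apply: (@le_lt_trans _ _ (rho0 / (2 * E) * E)); first by rewrite ler_pM2r// ge_min lexx orbT.
  rewrite (_ : rho0 / (2 * E) * E = rho0 / 2); last by field; rewrite gt_eqF.
  by rewrite ltr_pdivrMr// ltr_pMr// ltr1n.
pose j : 'I_m := Ordinal m_gt0.
have g0 : good c0 by rewrite /good subrr normr0.
have [r_in S0 N0] := qm_good g0.
pose th := relt c0 (qm c0).
have NE : gauge4 c0 (qm c0) = th ^+ 2 by rewrite /gauge4 S0 expr0n add0r.
have th0 : th != 0 by move: N0; rewrite NE lt0r sqrf_eq0 sqr_ge0 andbT.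
(* Each leg displaces by at most [s * E], a third of [d], so [c1], [c2] and [c3] stay within [d] of
   [c0]. The second bound, with [s <= 1], keeps the vertical shift $4s^2$ from overshooting the
   maximum point. *)
pose s := Num.min (d / (3 * E)) (`|th| / 4).
have s0 : 0 < s by rewrite lt_min !divr_gt0 ?mulr_gt0// normr_gt0.
have sd3 : s * (3 * E) <= d by rewrite -ler_pdivlMr ?mulr_gt0// ge_min lexx.
have sth : s * 4 <= `|th| by rewrite -ler_pdivlMr// ge_min lexx orbT.
have E2 : 2 <= E by rewrite /E lerDr mulr_ge0.
have s1' : s <= 1.
  apply: le_trans d1; apply: le_trans sd3; rewrite ler_peMr//; first exact: ltW.
  lra.
(* The sign makes the shift [- 4 * s * s'] point towards the maximum point. *)
pose s' := - Num.sg th * s.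
have s'E : `|s'| = s by rewrite /s' normrM normrN normr_sg th0 mul1r gtr0_norm.
have move1 (c c' : H) : `|c - c0| <= 2 * (s * E) -> `|c' - c| <= s * (1 + 2 * `|c|) -> `|c' - c0| <= `|c - c0| + s * E.
  move=> cc c'c; have cn : `|c| <= D.
    have := ler_normD (c - c0) c0; rewrite subrK /D; lra.
  have := ler_normD (c' - c) (c - c0); rewrite addrA subrK.
  have : s * (1 + 2 * `|c|) <= s * E by rewrite ler_pM2l// /E; lra.
  lra.
have sE0 : 0 <= s * E by rewrite mulr_ge0// ltW.
pose c1 := flowX j s c0; pose c2 := flowY j s' c1; pose c3 := flowX j (- s) c2.
have sn : `|s| = s by rewrite gtr0_norm.
have n0 : `|c0 - c0| = 0 by rewrite subrr normr0.
have n1 : `|c1 - c0| <= s * E.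
  by have := move1 c0 c1; rewrite n0 add0r; apply; [rewrite mulr_ge0|rewrite -[X in X * _]sn; exact: flowX_norm].
have n2 : `|c2 - c0| <= 2 * (s * E).
  have := move1 c1 c2; rewrite -{2}s'E => /(_ _ (flowY_norm _ _ _)); lra.
have n3 : `|c3 - c0| <= 3 * (s * E).
  have := move1 c2 c3; rewrite -{2}sn -(normrN s) => /(_ _ (flowX_norm _ _ _)); lra.
(* An opaque copy of [M], so that the equalities below do not unfold the chosen maximisers. *)
have [M' M'E] : exists M', M' = M by exists M.
have MX (t : R) c : `|c - c0| <= d -> `|t| <= d -> M' (flowX j t c) = M' c.
  rewrite M'E; exact: (flow_constant_near (@flowX_add _ _ j) (@flowX0 _ _ j)
    (@flowX_norm _ _ j) (@flowX_gauge4 _ _ j) dE d1).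
have MY (t : R) c : `|c - c0| <= d -> `|t| <= d -> M' (flowY j t c) = M' c.
  rewrite M'E; exact: (flow_constant_near (@flowY_add _ _ j) (@flowY0 _ _ j)
    (@flowY_norm _ _ j) (@flowY_gauge4 _ _ j) dE d1).
have sd : s <= d by apply: le_trans sd3; rewrite ler_peMr//; [exact: ltW|lra].
have Meq : M' (c0 + (- 4 * s * s') *: delta_mx 0 (idx_t m)) = M' c0.
  have E4 : flowY j (- s') c3 = c0 + (- 4 * s * s') *: delta_mx 0 (idx_t m) := flow_commutator j s s' c0.
  have m1 : M' c1 = M' c0 by apply: MX; rewrite ?n0 ?sn// ltW.
  have m2 : M' c2 = M' c1 by apply: MY; [lra|rewrite s'E].
  have m3 : M' c3 = M' c2 by apply: MX; [lra|rewrite normrN sn].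
  have m4 : M' (flowY j (- s') c3) = M' c3 by apply: MY; [lra|rewrite normrN s'E].
  by rewrite -E4 m4 m3 m2 m1.
set t := - 4 * s * s' in Meq.
have tE : t = 4 * (s * s) * Num.sg th by rewrite /t /s'; ring.
have lt_N : gauge4 (c0 + t *: delta_mx 0 (idx_t m)) (qm c0) < gauge4 c0 (qm c0).
  rewrite vertical_gauge4// NE -/th tE.
  have -> : th - 4 * (s * s) * Num.sg th = (`|th| - 4 * (s * s)) * Num.sg th.
    by rewrite mulrBl [`|th| * _]mulrC -numEsg.
  rewrite exprMn sqr_sg th0 mulr1 -(real_normK (num_real th)).
  have ss : s * s <= s by rewrite ler_piMr// ltW.
  have ss0 : 0 < s * s by rewrite mulr_gt0.
  rewrite ltr_pXn2r// ?nnegrE//; last by lra.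
  lra.
have [_ qmax] := qmP (c0 + t *: delta_mx 0 (idx_t m)).
have [qin _] := qmP c0; have qM := qmax _ qin.
have E5 : v (c0 + t *: delta_mx 0 (idx_t m)) (qm (c0 + t *: delta_mx 0 (idx_t m))) = v c0 (qm c0).
  by have := Meq; rewrite M'E.
rewrite E5 /v in qM; move: qM; clear E5 qmax qin Meq.
rewrite leNgt => /negP; apply; rewrite ltrD2l ltrN2.
have [_ mono _ der _] := bar.
set x := root4 (gauge4 c0 (qm c0)) in r_in *; set y := root4 (gauge4 _ (qm c0)).
have yx : y < x := root4_lt (gauge4_ge0 _ _) lt_N.
move: yx r_in; move: x y => x y yx r_in.
have /andP[rx xs] := r_in.
(* [y] may lie below [r0], where the barrier is flat; strict growth is used between [z] and [x],
   both in the annulus. *)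
pose z := Num.max y ((r0 + x) / 2).
have zx : z < x by rewrite gt_max yx/=; lra.
have rz : r0 < z by rewrite lt_max; apply/orP; right; lra.
have yz : y <= z by rewrite le_max lexx.
apply: (le_lt_trans (mono _ _ yz)).
have I w : z <= w <= x -> r0 < w < s1.
  by move=> /andP[zw wx]; rewrite (lt_le_trans rz zw) (le_lt_trans wx xs).
have zz : z <= z <= x by rewrite lexx ltW.
have xx : z <= x <= x by rewrite lexx ltW.
have dI w : z < w < x -> is_derive w 1 a (a1 w).
  by move=> /andP[zw wx]; have [|+ _ _ _] := der w => //; apply: I; rewrite !ltW.
have [za _ _ _] := der _ (I _ zz); have [xa _ _ _] := der _ (I _ xx).
have [w /andP[zw wx] E'] := MVT_oo zx dI (is_derive_continuous za) (is_derive_continuous xa).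
have Iw : r0 < w < s1 by apply: I; rewrite !ltW.
by have [_ _ _ a1w] := der _ Iw; rewrite -subr_gt0 E' mulr_gt0// subr_gt0.
Qed.

End MovingCentre.

(** * Choice of the parameters *)

Section Nonexistence.
Context {R : realType}.
Variables (m : nat) (p : R) (f l : R -> R) (B1 B2 mu C Lam : R).
Local Notation H := (heis R m).
Hypothesis m_gt0 : (1 <= m)%N.
Hypothesis p1 : 1 < p.
Hypothesis cf : {within `[0, +oo[, continuous f}.
Hypothesis f_lt : {in `[0, +oo[ &, {homo f : x y / x < y}}.
Hypothesis f_gt0 : forall t : R, 0 < t -> 0 < f t.
Hypothesis cl : {within `[0, +oo[, continuous l}.
Hypothesis l_gt0 : forall t : R, 0 < t -> 0 < l t.
Hypothesis C1 : 1 <= C.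
Hypothesis lC : C_monotone_nondecreasing l C.
Hypothesis lo : (fun t : R => t `^ (p - 1) / l t) x @[x --> 0^'+] --> 0.
Hypotheses (B1_gt0 : 0 < B1) (B2_gt0 : 0 < B2) (mu01 : 0 <= mu < 1).
Hypothesis l_le : forall t : R, 0 <= t -> l t <= B1 + B2 * t `^ mu.
Hypothesis Lam_gt0 : 0 < Lam.
Hypothesis l_scale : forall s t : R, 0 <= s <= 1 -> 0 <= t -> l t * s `^ p <= Lam * l (s * t).

(** The growth bound shows that [l] is bounded on $[0,t]$, so the supremum is a genuine upper
    bound. *)
Lemma C_monotone_le (s t : R) : 0 <= s -> s <= t -> l s <= C * l t.
Proof.
move=> s0 st; have t0 := le_trans s0 st; have /andP[mu0 _] := mu01.
apply: le_trans (lC t0); apply: ub_le_sup; last by exists s => //=; rewrite in_itv/= s0.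
exists (B1 + B2 * t `^ mu) => _ [x /= + <-]; rewrite in_itv/= => /andP[x0 xt].
apply: (le_trans (l_le x0)); rewrite lerD2l ler_pM2l//.
by apply: ge0_ler_powR; rewrite ?nnegrE.
Qed.

(** Gives continuity in the centre from continuity in the point. *)
Lemma gauge4_sym (c q : H) : gauge4 c q = gauge4 q c.
Proof.
rewrite /gauge4; congr (_ ^+ 2 + _).
  by apply: eq_bigr => k _; rewrite /relx /rely; ring.
rewrite -[RHS]sqrrN; congr (_ ^+ 2); rewrite /relt.
have -> : \sum_k (q 0 (idx_y k) * c 0 (idx_x k) - q 0 (idx_x k) * c 0 (idx_y k)) =
    - \sum_k (c 0 (idx_y k) * q 0 (idx_x k) - c 0 (idx_x k) * q 0 (idx_y k)).
  by rewrite -sumrN; apply: eq_bigr => k _; ring.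
ring.
Qed.

(** The parameters are fixed in an order that avoids circularity: the level [eta], the core radius
    [r0], the distance [r1] to [q1] and the factor [k] determine [T]; then [rho] bounds every
    annulus of outer radius below [T], and only then is [A] put above [u] on that ball. *)
Lemma no_solution (u : H -> R) : L1_at_pinfty (fun t => (KO_speed p f l t)^-1) ->
  (forall q, 0 <= u q) -> weak_solution p f l u -> forall c q, ~ u c < u q.
Proof.
pose g := KO_speed p f l.
pose dg (y : R) := f y * l (g y) / ((p - 1) * g y `^ (p - 1)).
have g_gt0 (y : R) : 0 < y -> 0 < g y by exact: (KO_speed_gt0 p1 cf f_gt0 cl l_gt0 lo B1_gt0 B2_gt0 mu01 l_le).
have g_der (y : R) : 0 < y -> is_derive y 1 g (dg y).
  exact: (KO_speed_derive p1 cf f_gt0 cl l_gt0 lo B1_gt0 B2_gt0 mu01 l_le).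
have g_lt (x y : R) : 0 < x -> x < y -> g x < g y.
  exact: (KO_speed_lt p1 cf f_gt0 cl l_gt0 lo B1_gt0 B2_gt0 mu01 l_le).
have g_small (e : R) : 0 < e -> exists2 y : R, 0 < y & g y < e.
  exact: (KO_speed_small p1 cf f_gt0 cl l_gt0 lo B1_gt0 B2_gt0 mu01 l_le).
have [G G_der] : exists G : R -> R, forall y : R, 0 < y -> is_derive y 1 G (g y)^-1.
  apply: primitive_pos => x x0; apply: cvgV; first by rewrite gt_eqF// g_gt0.
  exact: is_derive_continuous (g_der _ x0).
move=> /(L1_primitive_bounded g_gt0 g_der G_der)[Gmax G_le] u0 sol c0 q1 uu.
have u1 : Ck 1 u by case: sol.
have uc : continuous u by case: u1.
have fmE (x : R) : 0 <= x -> f (Num.max x 0) = f x by move=> x0; rewrite max_l.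
have lmE (x : R) : 0 <= x -> l (Num.max x 0) = l x by move=> x0; rewrite max_l.
have rhsc : continuous (fun q => f (u q) * l (hgrad_norm u q)).
  rewrite (_ : (fun q => _) = fun q => f (Num.max (u q) 0) * l (Num.max (hgrad_norm u q) 0)).
    apply: ctsM => q.
      apply: (@for_comp _ _ u (fun x => f (Num.max x 0))); first exact: uc.
      exact: within_ge0_continuous_max.
    apply: (@for_comp _ _ (hgrad_norm u) (fun x => l (Num.max x 0))).
      exact: (hgrad_norm_continuous sol).
    exact: within_ge0_continuous_max.
  by apply/funext => q; rewrite fmE// lmE// sqrtr_ge0.
have f_lt' (x y : R) : 0 <= x -> x < y -> f x < f y.
  by move=> x0 xy; apply: f_lt => //; rewrite in_itv/= andbT// (le_trans x0)// ltW.
have [fc _] := within_ge0_continuous cf; have [lc _] := within_ge0_continuous cl.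
pose eta := (u c0 + u q1) / 2.
have eta0 : 0 < eta by rewrite /eta; have := u0 c0; lra.
have etaU : eta < u q1 by rewrite /eta; lra.
have ce : 0 < eta - u c0 by rewrite /eta; lra.
have /continuousPe/(_ _ ce)[d d0 Hd] := uc c0.
pose D := `|c0| + 1; have D0 : 0 <= D by rewrite /D addr_ge0.
pose E := 3 + 4 * m%:R * D; have mD : 0 <= 4 * m%:R * D by rewrite !mulr_ge0.
have E0 : 0 < E by rewrite /E ltr_wpDr.
(* The core of radius [r0] around a good centre then lies within [d] of [c0]: half of [d] is for the
   core and half for the displacement of the centre. There [u] is below [eta]. *)
pose r0 := Num.min 1 (d / (2 * E)).
have r00 : 0 < r0 by rewrite lt_min ltr01 divr_gt0// mulr_gt0.
have r0E : r0 + r0 ^+ 2 + 4 * m%:R * D * r0 < d / 2.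
  have r01 : r0 <= 1 by rewrite ge_min lexx.
  have : r0 * E <= d / 2.
    apply: (@le_trans _ _ (d / (2 * E) * E)); first by rewrite ler_pM2r// ge_min lexx orbT.
    by rewrite le_eqVlt; apply/orP; left; apply/eqP; field; rewrite gt_eqF.
  have : r0 ^+ 2 <= r0 by rewrite expr2 ler_piMr// ltW.
  rewrite /E; lra.
have [d1 d10 Hd1] : exists2 d1 : R, 0 < d1 &
    forall c, `|c - c0| < d1 -> gauge4 c q1 <= gauge4 c0 q1 + 1.
  have [Nc _] := gauge4_C1 q1 (Logic.I : setT c0).
  have /continuousPe/(_ _ ltr01)[d1 d10 Hd1] := Nc; exists d1 => // c; rewrite distrC.
  by move=> /Hd1; rewrite !(gauge4_sym q1) => /ltr_normlP[+ _]; lra.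
(* Bounds the gauge distance to [q1] from all good centres; the barrier is kept below [u q1] up to
   [r1]. *)
pose r1 := root4 (gauge4 c0 q1 + 1).
pose k := (2 * Lam)^-1.
have k0 : 0 < k by rewrite invr_gt0 mulr_gt0.
have kLam : k * Lam < 1.
  rewrite (_ : k * Lam = 2^-1); last by rewrite /k; field; rewrite gt_eqF.
  by rewrite invf_lt1// ltr1n.
have Q0 : 0 <= m%:R *+ 2 + 1 :> R by rewrite addr_ge0// mulrn_wge0.
have C0 : 0 <= C by rewrite (le_trans ler01).
have [T HT] := barrier_exists p1 f_gt0 f_lt' fc l_gt0 lc C_monotone_le lo g_gt0 g_der
  (fun y _ => erefl) g_lt g_small G_der G_le r1 C0 Q0 k0 eta0 etaU r00.
pose rho := `|T| + `|T| ^+ 2 + 4 * m%:R * D * `|T| + D + `|q1| + 1.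
have [Cu _ HCu] := ball_bounded rho uc.
pose A := Num.max (u q1) (Cu + 1).
have UA : u q1 <= A by rewrite le_max lexx.
have [s1 [a [a1 [a2 [/andP[r0s1 s1T] bar a_lt]]]]] := HT A UA.
pose rho0 := Num.min (Num.min 1 (d / 2)) d1.
have rho00 : 0 < rho0 by rewrite !lt_min ltr01 d10 divr_gt0.
have goodP c : `|c - c0| < rho0 -> [/\ `|c - c0| < 1, `|c - c0| < d / 2 & `|c - c0| < d1].
  by rewrite !lt_min => /andP[/andP[-> ->] ->].
have goodD c : `|c - c0| < rho0 -> `|c| <= D.
  by move=> /goodP[c1 _ _]; have := ler_normD (c - c0) c0; rewrite subrK /D; lra.
have root_le (c q : H) (r : R) : 0 <= r -> root4 (gauge4 c q) <= r -> gauge4 c q <= r ^+ 4.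
  by move=> r_ge0 gr; rewrite -(root4K (gauge4_ge0 c q)) ler_pXn2r// nnegrE root4_ge0.
apply: (moving_centre_false (q1 := q1) (c0 := c0) (rho := rho) m_gt0 uc r00 bar _ rho00).
- exact: (local_max_on_axis p1 f_gt0 f_lt' l_gt0 l_scale (ltW k0) kLam sol rhsc r00 eta0 bar).
- move=> c q gc gr; have [_ cd _] := goodP c gc.
  have qc := gauge4_norm (goodD c gc) (ltW r00) (root_le _ _ _ (ltW r00) gr).
  have : `|c0 - q| < d.
    by have := ler_normD (q - c) (c - c0); rewrite addrA subrK (distrC c0); lra.
  by move=> /Hd/ltr_normlP[h1 h2]; lra.
- move=> c gc; apply: a_lt; apply: root4_le; first exact: gauge4_ge0.
  by have [_ _ /Hd1] := goodP c gc.
- move=> c q gc gr; have cD := goodD c gc.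
  have gT : root4 (gauge4 c q) <= `|T| by rewrite (le_trans (ltW gr))// (le_trans (ltW s1T))// ler_norm.
  have qc := gauge4_norm cD (normr_ge0 T) (root_le _ _ _ (normr_ge0 T) gT).
  by have := ler_normD (q - c) c; rewrite subrK /rho; have := normr_ge0 q1; lra.
- by move=> q /HCu; rewrite /A lt_max => uq; apply/orP; right; have := ler_norm (u q); lra.
rewrite /rho; have T0 := normr_ge0 T; have T2 := sqr_ge0 `|T|.
have : 0 <= 4 * m%:R * D * `|T| by rewrite mulr_ge0.
lra.
Qed.

End Nonexistence.

Unset Implicit Arguments.

Theorem theorem1p3 (R : realType) (m : nat) (p : R) (f l : R -> R)
    (B1 B2 mu : R) :
  (1 <= m)%N -> 1 < p ->
  {within `[0, +oo[, continuous f} ->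
  {in `[0, +oo[ &, {homo f : x y / x < y}} ->
  (forall t : R, 0 < t -> 0 < f t) ->
  {within `[0, +oo[, continuous l} ->
  (forall t : R, 0 < t -> 0 < l t) ->
  (exists2 C : R, 1 <= C & C_monotone_nondecreasing l C) ->
  (fun t : R => t `^ (p - 1) / l t) =o_ (0^'+) (fun=> 1 : R) ->
  0 < B1 -> 0 < B2 -> 0 <= mu < 1 ->
  (forall t : R, 0 <= t -> l t <= B1 + B2 * t `^ mu) ->
  (exists2 Lambda : R, 0 < Lambda &
     forall s t : R, 0 <= s <= 1 -> 0 <= t -> l t * s `^ p <= Lambda * l (s * t)) ->
  (exists u : heis R m -> R,
     [/\ forall q, 0 <= u q,
         ~ (exists c : R, forall q, u q = c) &
         weak_solution p f l u]) <->
  ~ L1_at_pinfty (fun t => (KO_Kinv p l (KO_F f t))^-1).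
Proof.
move=> m_gt0 p1 cf f_lt f_gt0 cl l_gt0 [C C1 lC] lo' B1_gt0 B2_gt0 mu01 l_le [Lam Lam_gt0 l_scale].
have lo : (fun t : R => t `^ (p - 1) / l t) x @[x --> 0^'+] --> 0 by exact/eqolim0P.
split; last exact: exists_solution m_gt0 p1 cf f_gt0 cl l_gt0 lo B1_gt0 B2_gt0 mu01 l_le.
move=> [u [u0 unc sol]] L1; apply: unc; exists (u 0) => q.
have no := no_solution m_gt0 p1 cf f_lt f_gt0 cl l_gt0 C1 lC lo B1_gt0 B2_gt0 mu01 l_le
  Lam_gt0 l_scale L1 u0 sol.
by have [uq|uq|] := ltgtP (u q) (u 0) => //; [case: (no q 0)|case: (no 0 q)].
Qed.
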